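(* Let $X_\epsilon$ be the perturbed Duffing oscillator $\dot x=H_y+\epsilon f(x,y,\epsilon)$, $\dot y=-H_x+\epsilon g(x,y,\epsilon)$, $H=\frac{y^2}{2}-\frac{x^2}{2}+\frac{x^4}{4}$, with $f,g$ cubic polynomials in $(x,y)$ with real coefficients depending analytically on $\epsilon$. Suppose that its first Melnikov function $M_1$ associated with an interior period annulus vanishes identically, and let $$M_2(h)=(\alpha_0+4\alpha_1h)I_0(h)+(\beta_0+4h\beta_1)I_1(h)+\rho I_2(h),$$ with real constants $\alpha_0,\alpha_1,\beta_0,\beta_1,\rho$, be the second Melnikov function associated with this annulus, assumed not identically zero. Then the analytic continuation of $M_2$ has at most four zeros in the complex domain $\mathcal{D}=\mathbb{C}\setminus[0,+\infty)$.
   Context: Interior period annulus: one of the two families of ovals $\gamma(h)\subset\{H=h\}$, $h\in(-\frac14,0)$, lying in $x>0$ or in $x<0$, oriented by the flow of $X_0$. Set $I_i(h)=\oint_{\gamma(h)}x^iy\,dx$. The functions $I_i$ extend to single-valued analytic functions on $\mathcal{D}=\mathbb{C}\setminus[0,+\infty)$. The Melnikov functions are the coefficients of the displacement map $P(h,\epsilon)-h=\epsilon M_1(h)+\epsilon^2M_2(h)+\cdots$, where $P$ is the first return map of $X_\epsilon$ on a cross-section parameterized by $h=H$.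
   Formalization: The bound of four counts zeros with multiplicity apart from one zero at h = -1/4, the value of H at the centre, where all I_i vanish; counting it the bound four is false, since some M_2 also vanishes at four prescribed points of (-1/4,0). *)

(* Defs.v *)
(* Real and complex analysis over Stdlib's [R] and Coquelicot. *)
From Stdlib Require Import Reals Lra List.
From Coquelicot Require Import Coquelicot.
Open Scope R_scope.

Definition H (x y : R) : R := y ^ 2 / 2 - x ^ 2 / 2 + x ^ 4 / 4.

(* [s = 1]: annulus in x > 0; [s = -1]: annulus in x < 0. *)
Definition oval (s h x y : R) : Prop := 0 < s * x /\ H x y = h.

(* On the level h one has (x^2 - 1)^2 + 2 y^2 = 1 + 4 h, whence the angular
   parametrization below, 0 <= t <= 2 PI, of the oval; [oval_param] and
   [oval_oriented] show that it runs through the oval once, in the direction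
   of the flow of X_0 (clockwise). *)
Definition oval_x (s h t : R) : R := s * sqrt (1 + sqrt (1 + 4 * h) * cos t).
Definition oval_y (s h t : R) : R := - s * (sqrt (1 + 4 * h) / sqrt 2) * sin t.

(* The integral of x^i y dx along the oval. *)
Definition oint (s : R) (i : nat) (h : R) : R :=
  RInt (fun t => oval_x s h t ^ i * oval_y s h t * Derive (oval_x s h) t)
       0 (2 * PI).

Definition analytic_at (u : R -> R) (x0 : R) : Prop :=
  exists c : nat -> R,
    Rbar_lt 0 (CV_radius c) /\ locally 0 (fun e => u (x0 + e) = PSeries c e).

(* [a i j eps] is the coefficient of x^i y^j, i + j <= 3. *)
Definition cubic (a : nat -> nat -> R -> R) (x y eps : R) : R :=
  sum_f_R0 (fun i => sum_f_R0 (fun j => a i j eps * x ^ i * y ^ j) (3 - i)) 3.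

Definition analytic_coefs (a : nat -> nat -> R -> R) : Prop :=
  forall i j : nat, (i + j <= 3)%nat -> analytic_at (a i j) 0.

Definition trajectory (f g : R -> R -> R -> R) (eps T : R) (x y : R -> R)
  : Prop :=
  forall t, 0 <= t <= T ->
    is_derive x t (Derive (fun v => H (x t) v) (y t) + eps * f (x t) (y t) eps)
    /\
    is_derive y t (- Derive (fun u => H u (y t)) (x t) + eps * g (x t) (y t) eps).

(* An analytic arc across the annulus parametrized by the value of H.
   Transversality to X_0 is automatic: dH maps the velocity of the arc to 1. *)
Definition cross_section (s : R) (sx sy : R -> R) : Prop :=
  forall h, -1/4 < h < 0 ->
    analytic_at sx h /\ analytic_at sy h /\ oval s h (sx h) (sy h).

Definition on_section (sx sy : R -> R) (x y : R) : Prop :=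
  exists k, -1/4 < k < 0 /\ x = sx k /\ y = sy k.

(* The trajectory of X_eps issued from the point h of the section meets the
   section again, for the first time, at the point k. *)
Definition first_return (f g : R -> R -> R -> R) (sx sy : R -> R)
  (eps h k : R) : Prop :=
  -1/4 < k < 0 /\
  exists (T : R) (x y : R -> R),
    0 < T /\ trajectory f g eps T x y /\
    x 0 = sx h /\ y 0 = sy h /\ x T = sx k /\ y T = sy k /\
    (forall t, 0 < t < T -> ~ on_section sx sy (x t) (y t)).

(* P (h, eps) - h = M 1 h * eps + M 2 h * eps^2 + ..., near eps = 0. The
   identity at eps = 0, where P (h, 0) = h, forces M 0 h = 0. *)
Definition Melnikov_functions (s : R) (f g : R -> R -> R -> R)
  (M : nat -> R -> R) : Prop :=
  exists (sx sy : R -> R) (P : R -> R -> R),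
    cross_section s sx sy /\
    forall h, -1/4 < h < 0 ->
      locally 0 (fun eps : R =>
        first_return f g sx sy eps h (P h eps) /\
        is_pseries (fun k => M k h) eps (P h eps - h)).

Definition slit_plane (z : C) : Prop := ~ (Im z = 0 /\ 0 <= Re z).

Definition holomorphic_on (D : C -> Prop) (F : C -> C) : Prop :=
  forall z : C, D z -> ex_derive (K := C_AbsRing) (V := C_NormedModule) F z.

Definition analytic_continuation (D : C -> Prop) (m : R -> R) (F : C -> C)
  : Prop :=
  holomorphic_on D F /\ forall h, -1/4 < h < 0 -> F (RtoC h) = RtoC (m h).

(* The points of the list [l], repeated according to multiplicity, are among
   the zeros of F in D: F (z) is the product of the z - a, a in l, times a
   function holomorphic on D. *)
Definition has_zeros (D : C -> Prop) (F : C -> C) (l : list C) : Prop :=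
  List.Forall D l /\
  exists G : C -> C, holomorphic_on D G /\
    forall z : C, D z -> F z = fold_right (fun a w => (z - a) * w)%C (G z) l.

(* Zeros other than the one at the value -1/4 of H at the centre, where the
   oval shrinks to a point and all the integrals I_i vanish, counted with
   multiplicity. A zero of order m at -1/4 still contributes m - 1. *)
Definition at_most_zeros_besides_centre (D : C -> Prop) (F : C -> C) (n : nat)
  : Prop :=
  forall l : list C, has_zeros D F (RtoC (-1/4) :: l) -> (length l <= n)%nat.

Section OvalParametrization.

Variables s h : R.
Hypotheses (Hs : s = 1 \/ s = -1) (Hh : -1/4 < h < 0).

Let r := sqrt (1 + 4 * h).

Lemma r_bounds : 0 < r < 1.
Proof.
unfold r; split; [apply sqrt_lt_R0; lra|].
rewrite <- sqrt_1 at 2; apply sqrt_lt_1_alt; lra.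
Qed.

Lemma r_sqr : r * r = 1 + 4 * h.
Proof. apply sqrt_sqrt; lra. Qed.

Lemma radicand_pos t : 0 < 1 + r * cos t.
Proof. pose proof r_bounds; pose proof (COS_bound t); nra. Qed.

Lemma s_sqr : s * s = 1.
Proof. destruct Hs; subst; lra. Qed.

Lemma sqrt2_facts : 0 < sqrt 2 /\ sqrt 2 * sqrt 2 = 2.
Proof. split; [apply sqrt_lt_R0 | apply sqrt_sqrt]; lra. Qed.

Lemma angle_unique X Y : X * X + Y * Y = 1 ->
  exists! t, 0 <= t < 2 * PI /\ cos t = X /\ sin t = Y.
Proof.
intros E; pose proof PI_RGT_0.
assert (HX : -1 <= X <= 1) by nra.
assert (Hsin : sin (acos X) = Rabs Y).
{ rewrite sin_acos by exact HX.
  replace (1 - X²) with (Y²) by (unfold Rsqr; lra); apply sqrt_Rsqr_abs. }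
pose proof (acos_bound X) as Ha; pose proof (cos_acos X HX) as Hc.
assert (U : forall t, 0 <= t < 2 * PI -> cos t = X -> sin t = Y ->
   (0 <= Y -> t = acos X) /\ (Y < 0 -> t = 2 * PI - acos X)).
{ intros t Ht Ct St; split; intros HY.
  - destruct (Rle_dec t PI) as [L|L]; [now rewrite <- Ct, acos_cos by lra|].
    exfalso; assert (sin t < 0) by (apply sin_lt_0; lra); lra.
  - destruct (Rle_dec t PI) as [L|L].
    + exfalso; assert (0 <= sin t) by (apply sin_ge_0; lra); lra.
    + rewrite <- Ct.
      replace (cos t) with (cos (2 * PI - t)).
      * rewrite acos_cos by lra; lra.
      * rewrite cos_minus, cos_2PI, sin_2PI; ring. }
destruct (Rle_dec 0 Y) as [HY|HY].
- exists (acos X); split.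
  + repeat split; try lra; rewrite Hsin; apply Rabs_pos_eq; lra.
  + intros t [Ht [Ct St]]; symmetry; now apply U.
- assert (HY' : Y < 0) by lra.
  exists (2 * PI - acos X); split.
  + assert (acos X <> 0).
    { intros Z; rewrite Z, sin_0, Rabs_left in Hsin by lra; lra. }
    repeat split; try lra.
    * rewrite cos_minus, cos_2PI, sin_2PI, Hc; ring.
    * rewrite sin_minus, cos_2PI, sin_2PI, Hsin, Rabs_left by lra; ring.
  + intros t [Ht [Ct St]]; symmetry; now apply U.
Qed.

Lemma oval_param x y :
  oval s h x y <->
  exists! t, 0 <= t < 2 * PI /\ x = oval_x s h t /\ y = oval_y s h t.
Proof.
pose proof r_bounds as Hr; pose proof r_sqr as Hr2; pose proof s_sqr as Hs2.
destruct sqrt2_facts as [Q0 Q2].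
assert (K : forall t, 0 < s * x ->
   (x = oval_x s h t /\ y = oval_y s h t <->
    cos t = (x * x - 1) / r /\ sin t = - s * sqrt 2 * y / r)).
{ intros t Hx; unfold oval_x, oval_y; fold r.
  pose proof (radicand_pos t) as Hp.
  pose proof (sqrt_sqrt _ (Rlt_le _ _ Hp)) as Hq.
  split; intros [A B].
  - split.
    + rewrite A.
      replace (s * sqrt (1 + r * cos t) * (s * sqrt (1 + r * cos t)))
        with (s * s * (sqrt (1 + r * cos t) * sqrt (1 + r * cos t))) by ring.
      rewrite Hq, Hs2; field; lra.
    + rewrite B; transitivity (s * s * sin t); [rewrite Hs2; ring|field]; lra.
  - split.
    + assert (E : 1 + r * cos t = (s * x) * (s * x)).
      { rewrite A; transitivity (s * s * (x * x)); [|ring].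
        rewrite Hs2; field; lra. }
      rewrite E, sqrt_square by lra.
      transitivity (s * s * x); [rewrite Hs2|]; ring.
    + rewrite B; transitivity (s * s * y); [rewrite Hs2; ring|field; lra]. }
split.
- intros [Hx E]; unfold H in E.
  destruct (angle_unique ((x * x - 1) / r) (- s * sqrt 2 * y / r))
    as [t [[Ht T] U]].
  { transitivity (((x * x - 1) * (x * x - 1)
       + (s * s) * (sqrt 2 * sqrt 2) * (y * y)) / (r * r)); [field; lra|].
    rewrite Hs2, Q2, Hr2.
    replace ((x * x - 1) * (x * x - 1) + 1 * 2 * (y * y))
      with (1 + 4 * h) by (rewrite <- E; field).
    field; lra. }
  exists t; split; [split; [exact Ht | now apply K]|].
  intros t' [Ht' T']; apply U; split; [exact Ht' | now apply K].
- intros [t [[Ht [A B]] _]].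
  pose proof (radicand_pos t) as Hp.
  assert (Hx : 0 < s * x).
  { rewrite A; unfold oval_x; fold r; rewrite <- Rmult_assoc, Hs2, Rmult_1_l.
    now apply sqrt_lt_R0. }
  split; [exact Hx|].
  destruct (proj1 (K t Hx) (conj A B)) as [Ct St].
  pose proof (sin2_cos2 t) as SC; unfold Rsqr in SC; rewrite Ct, St in SC.
  assert (E : (x * x - 1) * (x * x - 1) + 2 * (y * y) = 1 + 4 * h).
  { transitivity ((x * x - 1) * (x * x - 1)
      + (s * s) * (sqrt 2 * sqrt 2) * (y * y)); [rewrite Hs2, Q2; ring|].
    match type of SC with ?A = _ => transitivity (A * (r * r)) end;
      [field; lra | rewrite SC, Hr2; ring]. }
  unfold H; lra.
Qed.

Lemma oval_oriented t :
  exists lam, 0 < lam /\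
    let x := oval_x s h t in let y := oval_y s h t in
    is_derive (oval_x s h) t (lam * Derive (fun v => H x v) y) /\
    is_derive (oval_y s h) t (lam * - Derive (fun u => H u y) x).
Proof.
pose proof r_bounds as Hr; pose proof s_sqr as Hs2.
destruct sqrt2_facts as [Q0 Q2].
pose proof (radicand_pos t) as Hp.
pose proof (sqrt_lt_R0 _ Hp) as Hq0.
pose proof (sqrt_sqrt _ (Rlt_le _ _ Hp)) as Hq.
exists (/ (sqrt 2 * sqrt (1 + r * cos t))); split.
{ apply Rinv_0_lt_compat; nra. }
assert (DX : forall x y, Derive (fun u => H u y) x = - x + x ^ 3).
{ intros x y; apply is_derive_unique; unfold H; auto_derive; [easy|field]. }
assert (DY : forall x y, Derive (fun v => H x v) y = y).
{ intros x y; apply is_derive_unique; unfold H; auto_derive; [easy|field]. }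
simpl; rewrite DX, DY; unfold oval_x, oval_y; fold r; split.
- auto_derive; [exact Hp|].
  transitivity (- s * r * sin t / (sqrt 2 * sqrt 2) / sqrt (1 + r * cos t));
    [rewrite Q2|]; field; lra.
- auto_derive; [easy|].
  set (q := sqrt (1 + r * cos t)) in *.
  transitivity (/ (sqrt 2 * q) * (s * q) * (1 - (s * s) * (q * q)));
    [rewrite Hs2, Hq|]; field; lra.
Qed.

End OvalParametrization.

(* Main.v *)
Require Import Defs.
From Stdlib Require Import Reals Ranalysis5 Lra Lia List Classical ClassicalEpsilon Permutation.
From Coquelicot Require Import Coquelicot.
Open Scope R_scope.

(** Put zeta = 1 + 4 h, which turns the slit plane into the plane cut along
    [1, +oo), the centre into zeta = 0 and the saddle into zeta = 1. Folding
    the oval into one quadrant gives I_0 = Psi0 (zeta) and I_2 = Psi2 (zeta),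
    two elliptic integrals, while I_1 is a constant times zeta ([oint_Psi0],
    [oint_Psi2], [oint_1]). Psi0 and Psi2 satisfy a Picard-Fuchs system of
    order two ([Psi_eq0], [Psi_eq2]), singular at zeta = 0 and zeta = 1.

    The same formulas define, at the levels t > 0 on the other side of the
    saddle, the integrals cyc0 (t) and cyc2 (t) over the cycle vanishing at the
    saddle: the jumps of I_0 and I_2 across the cut are multiples of them. The
    Cauchy integrals of cyc0 and cyc2 over the cut satisfy the Picard-Fuchs
    system too, and they vanish at the centre; the solution vanishing there is
    unique up to a factor, whence the dispersion relation
    [Psi_proportional_disp]. It yields M_2 (h) = zeta E (zeta) with
        E (zeta) = b0 + b1 zeta + zeta S (zeta),
        S (zeta) = integral over 0 < tau < 1 of N / (1 - zeta tau),
    where tau = 1 / (1 + 4 t) and where N is a constant times a positive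
    function of t times
        phi (t) = alpha0 + 4 alpha1 t - rho w (t),    w = cyc2 / cyc0.
    The factor zeta is the zero at the centre, so that the claim is that E has
    at most four zeros.

    The ratio w is concave. Its derivative is W / cyc0^2 with W the Wronskian of
    cyc0 and cyc2; both W and the numerator Z of the second derivative of w are
    monotone functions of t with limit 0 at t = 0, which determines their signs
    ([cyc_wronskian_nonneg], [cyc_curvature_nonpos]). Hence phi is convex or
    concave, and some quadratic polynomial P makes P phi nonnegative on
    (0, +oo) ([density_sign]).

    Zeros are counted by divided differences. If a_1, ..., a_5 are zeros of E,
    then so are they, successively, of the divided differences of E at the
    preceding ones. Dividing by zeta - a divides the density by 1 - a tau,
    multiplies it by tau (but for the first time, when the factor zeta of the
    integral goes) and lowers the degree of b0 + b1 zeta, which is gone after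
    two steps; the last three differences say that the density
    N tau / ((1 - a_1 tau) ... (1 - a_5 tau)) is orthogonal to all polynomials
    in tau of degree at most two ([moments]). Since E is real on the real axis the
    list of zeros can be closed under conjugation ([symmetrize]), so that the
    product in the denominator is positive. The polynomial tau^2 P (t) in tau
    then contradicts orthogonality ([no_five_zeros]), unless N = 0; in that case
    E is affine, and two zeros make it vanish ([no_two_zeros_degenerate]).
    This counting treats multiple zeros and zeros near the cut like the others.

    The function F of the theorem is known only on (-1/4, 0). That it equals
    zeta E (zeta) on the whole slit plane is the identity theorem
    [slit_identity], obtained from Goursat's theorem, Cauchy's formula on
    circles, and a conformal map of the unit disc onto the slit plane. *)

(** * Functions with values in the complex plane: continuity, integrals, derivatives *)

Lemma continuous_C_pair {T : UniformSpace} (f : T -> C) x :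
  continuous (fun u => Re (f u)) x -> continuous (fun u => Im (f u)) x ->
  continuous (U := C_UniformSpace) f x.
Proof.
intros H1 H2.
intros P HP.
assert (L : locally (Re (f x), Im (f x)) P) by (now destruct (f x)).
destruct L as [eps He].
assert (B1 := H1 (fun v => ball (Re (f x)) eps v) (locally_ball _ eps)).
assert (B2 := H2 (fun v => ball (Im (f x)) eps v) (locally_ball _ eps)).
unfold filtermap in *.
generalize (filter_and _ _ B1 B2); apply filter_imp.
intros u [C1 C2].
generalize (He (f u)); intros HH; apply HH; split; assumption.
Qed.

Lemma continuous_Re {T : UniformSpace} (f : T -> C) x :
  continuous (U := C_UniformSpace) f x -> continuous (fun u => Re (f u)) x.
Proof.
intros H; apply (continuous_comp f fst); [exact H|apply continuous_fst].
Qed.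

Lemma continuous_Im {T : UniformSpace} (f : T -> C) x :
  continuous (U := C_UniformSpace) f x -> continuous (fun u => Im (f u)) x.
Proof.
intros H; apply (continuous_comp f snd); [exact H|apply continuous_snd].
Qed.

Notation ccont f x := (continuous (U := C_UniformSpace) f x).

Lemma ccont_plus {T : UniformSpace} (f g : T -> C) x :
  ccont f x -> ccont g x -> ccont (fun u => (f u + g u)%C) x.
Proof.
intros Hf Hg; apply continuous_C_pair; simpl.
- apply (continuous_plus (fun u => Re (f u))); now apply continuous_Re.
- apply (continuous_plus (fun u => Im (f u))); now apply continuous_Im.
Qed.

Lemma ccont_opp {T : UniformSpace} (f : T -> C) x :
  ccont f x -> ccont (fun u => (- f u)%C) x.
Proof.
intros Hf; apply continuous_C_pair; simpl.
- apply (continuous_opp (fun u => Re (f u))); now apply continuous_Re.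
- apply (continuous_opp (fun u => Im (f u))); now apply continuous_Im.
Qed.

Lemma ccont_minus {T : UniformSpace} (f g : T -> C) x :
  ccont f x -> ccont g x -> ccont (fun u => (f u - g u)%C) x.
Proof. intros Hf Hg; apply ccont_plus; [exact Hf|now apply ccont_opp]. Qed.

Lemma ccont_mult {T : UniformSpace} (f g : T -> C) x :
  ccont f x -> ccont g x -> ccont (fun u => (f u * g u)%C) x.
Proof.
intros Hf Hg.
pose proof (continuous_Re _ _ Hf); pose proof (continuous_Im _ _ Hf).
pose proof (continuous_Re _ _ Hg); pose proof (continuous_Im _ _ Hg).
apply continuous_C_pair; simpl.
- apply (continuous_minus (fun u => Re (f u) * Re (g u))); now apply (continuous_mult (K := R_AbsRing)).
- apply (continuous_plus (fun u => Re (f u) * Im (g u))); now apply (continuous_mult (K := R_AbsRing)).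
Qed.

Lemma ccont_inv {T : UniformSpace} (f : T -> C) x :
  ccont f x -> f x <> 0%C -> ccont (fun u => (/ f u)%C) x.
Proof.
intros Hf N.
pose proof (continuous_Re _ _ Hf) as HR; pose proof (continuous_Im _ _ Hf) as HI.
assert (HN : Re (f x) ^ 2 + Im (f x) ^ 2 <> 0).
{ intros E; apply N; destruct (f x) as [p q]; unfold Re, Im in E; simpl in E.
  apply injective_projections; simpl; nra. }
assert (HD : continuous (fun u => / (Re (f u) ^ 2 + Im (f u) ^ 2)) x).
{ assert (SQ : forall k : T -> R, continuous k x -> continuous (fun u => k u ^ 2) x).
  { intros k Hk; apply (continuous_mult (K := R_AbsRing) k); [exact Hk|].
    apply (continuous_mult (K := R_AbsRing) k); [exact Hk|apply continuous_const]. }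
  apply (continuous_comp (fun u => Re (f u) ^ 2 + Im (f u) ^ 2) Rinv); [|now apply continuous_Rinv].
  apply (continuous_plus (V := R_NormedModule)); now apply SQ. }
apply continuous_C_pair; unfold Cinv, Rdiv; simpl Re; simpl Im.
- apply (continuous_mult (K := R_AbsRing) (fun u => Re (f u))); assumption.
- apply (continuous_mult (K := R_AbsRing) (fun u => - Im (f u))); [|assumption].
  now apply (continuous_opp (fun u => Im (f u))).
Qed.

Lemma ccont_RtoC {T : UniformSpace} (f : T -> R) x :
  continuous f x -> ccont (fun u => RtoC (f u)) x.
Proof.
intros H; apply continuous_C_pair; simpl; [exact H|apply continuous_const].
Qed.

Lemma ccont_const {T : UniformSpace} (c : C) (x : T) : ccont (fun _ => c) x.
Proof. apply continuous_const. Qed.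

Ltac le_Rmin := first
  [ apply Rle_refl
  | eapply Rle_trans; [apply Rmin_l|]; le_Rmin
  | eapply Rle_trans; [apply Rmin_r|]; le_Rmin ].

(** The ambient uniform structure of the plane is the product one; its balls
    and those of the modulus are comparable up to a factor sqrt 2. *)
Lemma ccont_eps (f : C -> C) z :
  ccont f z <-> forall eps, 0 < eps -> exists d, 0 < d /\
    forall w, Cmod (w - z) < d -> Cmod (f w - f z) < eps.
Proof.
split.
- intros H eps He.
  assert (H2 : 0 < eps / sqrt 2) by (apply Rdiv_lt_0_compat; [lra|apply sqrt_lt_R0; lra]).
  destruct (H _ (locally_ball (f z) (mkposreal _ H2))) as [d Hd].
  exists d; split; [apply cond_pos|].
  intros w Hw.
  assert (B := Hd w (C_NormedModule_mixin_compat1 z w d Hw)).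
  assert (L := C_NormedModule_mixin_compat2 _ _ _ B).
  simpl in L.
  replace eps with (sqrt 2 * (eps / sqrt 2)); [exact L|].
  field; apply Rgt_not_eq, sqrt_lt_R0; lra.
- intros H P [eps He].
  destruct (H eps (cond_pos eps)) as [d [Hd0 Hd]].
  assert (H2 : 0 < d / sqrt 2) by (apply Rdiv_lt_0_compat; [lra|apply sqrt_lt_R0; lra]).
  exists (mkposreal _ H2); intros w Hw.
  apply He, C_NormedModule_mixin_compat1, Hd.
  assert (L := C_NormedModule_mixin_compat2 _ _ _ Hw); simpl in L.
  replace d with (sqrt 2 * (d / sqrt 2)); [exact L|].
  field; apply Rgt_not_eq, sqrt_lt_R0; lra.
Qed.

Notation CInt := (RInt (V := C_R_CompleteNormedModule)).
Notation ex_CInt := (ex_RInt (V := C_R_CompleteNormedModule)).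

Lemma ex_CInt_cont (f : R -> C) a b :
  a <= b -> (forall t, a <= t <= b -> ccont f t) -> ex_CInt f a b.
Proof.
intros L H; apply (ex_RInt_continuous (V := C_R_CompleteNormedModule)).
rewrite Rmin_left, Rmax_right by lra; exact H.
Qed.

Lemma CInt_plus (f g : R -> C) a b : ex_CInt f a b -> ex_CInt g a b ->
  CInt (fun t => (f t + g t)%C) a b = (CInt f a b + CInt g a b)%C.
Proof. intros Hf Hg; apply (RInt_plus (V := C_R_CompleteNormedModule)); assumption. Qed.

Lemma CInt_minus (f g : R -> C) a b : ex_CInt f a b -> ex_CInt g a b ->
  CInt (fun t => (f t - g t)%C) a b = (CInt f a b - CInt g a b)%C.
Proof. intros Hf Hg; apply (RInt_minus (V := C_R_CompleteNormedModule)); assumption. Qed.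

Lemma is_CInt_mult c (f : R -> C) a b l :
  is_RInt (V := C_R_NormedModule) f a b l ->
  is_RInt (V := C_R_NormedModule) (fun t => (c * f t)%C) a b (c * l)%C.
Proof.
intros H.
assert (H1 := is_RInt_fct_extend_fst (U := R_NormedModule) (V := R_NormedModule) f a b l H).
assert (H2 := is_RInt_fct_extend_snd (U := R_NormedModule) (V := R_NormedModule) f a b l H).
apply (is_RInt_fct_extend_pair (U := R_NormedModule) (V := R_NormedModule)); simpl.
- apply (is_RInt_minus (V := R_NormedModule)); now apply (is_RInt_scal (V := R_NormedModule)).
- apply (is_RInt_plus (V := R_NormedModule)); now apply (is_RInt_scal (V := R_NormedModule)).
Qed.

Lemma CInt_mult c (f : R -> C) a b : ex_CInt f a b ->
  CInt (fun t => (c * f t)%C) a b = (c * CInt f a b)%C.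
Proof.
intros H; apply (is_RInt_unique (V := C_R_CompleteNormedModule)), is_CInt_mult.
now apply (RInt_correct (V := C_R_CompleteNormedModule)).
Qed.

Lemma norm_C_R (z : C) : norm (z : C_R_NormedModule) = Cmod z.
Proof.
unfold norm; simpl; unfold prod_norm, norm; simpl; unfold abs; simpl.
unfold Cmod; f_equal; simpl; rewrite !Rmult_1_r, <- !Rabs_mult.
rewrite !Rabs_pos_eq by nra; reflexivity.
Qed.

Lemma CInt_bound (f : R -> C) a b M : a <= b -> ex_CInt f a b ->
  (forall t, a <= t <= b -> Cmod (f t) <= M) -> Cmod (CInt f a b) <= (b - a) * M.
Proof.
intros L E H; rewrite <- norm_C_R.
apply (norm_RInt_le_const (V := C_R_NormedModule) f a b (CInt f a b) M L).
- intros t Ht; rewrite norm_C_R; now apply H.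
- now apply (RInt_correct (V := C_R_CompleteNormedModule)).
Qed.

Lemma CInt_ext (f g : R -> C) a b : a <= b ->
  (forall t, a <= t <= b -> f t = g t) -> CInt f a b = CInt g a b.
Proof.
intros L H; apply (RInt_ext (V := C_R_CompleteNormedModule)).
rewrite Rmin_left, Rmax_right by lra; intros; apply H; lra.
Qed.

Lemma CInt_Chasles (f : R -> C) a b c : ex_CInt f a b -> ex_CInt f b c ->
  (CInt f a b + CInt f b c)%C = CInt f a c.
Proof. intros; now apply (RInt_Chasles (V := C_R_CompleteNormedModule)). Qed.

Lemma CInt_const (c : C) a b : CInt (fun _ => c) a b = (RtoC (b - a) * c)%C.
Proof.
etransitivity; [apply (RInt_const (V := C_R_CompleteNormedModule))|].
unfold scal; simpl; unfold prod_scal; simpl; unfold scal; simpl; unfold mult; simpl.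
apply injective_projections; simpl; ring.
Qed.

Lemma CInt_RtoC (f : R -> R) a b : ex_RInt f a b ->
  CInt (fun t => RtoC (f t)) a b = RtoC (RInt f a b).
Proof.
intros H; apply (is_RInt_unique (V := C_R_CompleteNormedModule)).
apply (is_RInt_fct_extend_pair (U := R_NormedModule) (V := R_NormedModule)); simpl.
- now apply (RInt_correct (V := R_CompleteNormedModule)).
- pose proof (is_RInt_const (V := R_NormedModule) a b 0) as K.
  unfold scal in K; simpl in K; unfold mult in K; simpl in K.
  rewrite Rmult_0_r in K; exact K.
Qed.

(** Caratheodory's form of complex differentiability: the difference quotient
    [q] is a function on the whole plane whose value at [z] is the
    derivative. Products and compositions then follow by algebra, and [q]
    is at hand as the integrand of Cauchy's formula. *)
Definition cder (f : C -> C) (z : C) : Prop :=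
  exists q : C -> C, ccont q z /\ forall w, f w = (f z + (w - z) * q w)%C.

Lemma cder_ccont f z : cder f z -> ccont f z.
Proof.
intros [q [Hq E]].
apply (continuous_ext (fun w => (f z + (w - z) * q w)%C)); [intros w; now rewrite <- E|].
apply ccont_plus; [apply ccont_const|].
apply ccont_mult; [|exact Hq].
apply ccont_minus; [apply continuous_id|apply ccont_const].
Qed.

Lemma Cmult_integral_contr (a b : C) : a <> 0%C -> (a * b = 0)%C -> b = 0%C.
Proof.
intros N E; rewrite <- (Cmult_1_l b), <- (Cinv_l a N), <- Cmult_assoc, E; ring.
Qed.

Lemma Cminus_eq_0 (a b : C) : (a - b = 0)%C -> a = b.
Proof. intros E; replace a with (a - b + b)%C by ring; rewrite E; ring. Qed.

Lemma Cminus_neq (z w : C) : z <> w -> (z - w)%C <> 0%C.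
Proof. intros N E; now apply N, Cminus_eq_0. Qed.

Lemma Cminus_0_r (z : C) : (z - 0 = z)%C.
Proof. ring. Qed.

Lemma Ceq_of_close (a b : C) : (forall eps, 0 < eps -> Cmod (a - b) <= eps) -> a = b.
Proof.
intros H; apply Cminus_eq_0, Cmod_eq_0, Rle_antisym; [|apply Cmod_ge_0].
apply Rle_plus_epsilon; intros eps He; rewrite Rplus_0_l; now apply H.
Qed.

(** Far from [z] the quotient can be taken to be the literal one, so only a
    neighbourhood of [z] matters. *)
Lemma cder_loc (f q : C -> C) (z : C) (d : R) : 0 < d -> ccont q z ->
  (forall w, Cmod (w - z) < d -> f w = (f z + (w - z) * q w)%C) -> cder f z.
Proof.
intros Hd Hq E.
exists (fun w => if Ceq_dec w z then q z else ((f w - f z) / (w - z))%C); split.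
- apply ccont_eps; intros eps He.
  destruct (proj1 (ccont_eps q z) Hq eps He) as [d' [Hd' K]].
  exists (Rmin d d'); split; [now apply Rmin_pos|].
  intros w Hw.
  destruct (Ceq_dec z z) as [_|N]; [|now destruct N].
  destruct (Ceq_dec w z) as [->|N].
  + replace (q z - q z)%C with (RtoC 0) by ring; rewrite Cmod_0; exact He.
  + rewrite (E w) by (eapply Rlt_le_trans; [exact Hw|apply Rmin_l]).
    replace ((f z + (w - z) * q w - f z) / (w - z))%C with (q w).
    * apply K; eapply Rlt_le_trans; [exact Hw|apply Rmin_r].
    * field; now apply Cminus_neq.
- intros w; destruct (Ceq_dec w z) as [->|N]; [ring|].
  field; now apply Cminus_neq.
Qed.

Lemma cder_of_ex_derive (f : C -> C) z :
  ex_derive (K := C_AbsRing) (V := C_NormedModule) f z -> cder f z.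
Proof.
intros [l [_ H]].
assert (Z : is_filter_lim (locally (T := AbsRing_UniformSpace C_AbsRing) z) z) by (intros P HP; exact HP).
specialize (H z Z).
apply (cder_loc f (fun w => if Ceq_dec w z then l else ((f w - f z) / (w - z))%C) z 1 Rlt_0_1).
- apply ccont_eps; intros eps He.
  assert (He2 : 0 < eps / 2) by lra.
  destruct (H (mkposreal _ He2)) as [d Hd].
  exists d; split; [apply cond_pos|]; intros w Hw.
  destruct (Ceq_dec z z) as [_|N]; [|now destruct N].
  destruct (Ceq_dec w z) as [->|N].
  + replace (l - l)%C with (RtoC 0) by ring; rewrite Cmod_0; exact He.
  + assert (B := Hd w Hw).
    change (Cmod (f w - f z - (w - z) * l) <= eps / 2 * Cmod (w - z)) in B.
    assert (N' := Cminus_neq w z N).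
    assert (P0 : 0 < Cmod (w - z)) by now apply Cmod_gt_0.
    replace ((f w - f z) / (w - z) - l)%C with ((f w - f z - (w - z) * l) / (w - z))%C by (field; exact N').
    rewrite Cmod_div by exact N'.
    apply Rle_lt_trans with (eps / 2); [|lra].
    apply (Rmult_le_reg_r (Cmod (w - z))); [exact P0|].
    unfold Rdiv; rewrite Rmult_assoc, Rinv_l, Rmult_1_r by lra; exact B.
- intros w _; destruct (Ceq_dec w z) as [->|N]; [ring|].
  field; now apply Cminus_neq.
Qed.

Lemma cder_const c z : cder (fun _ => c) z.
Proof. exists (fun _ => 0%C); split; [apply ccont_const|intros; ring]. Qed.

Lemma cder_id z : cder (fun w => w) z.
Proof. exists (fun _ => 1%C); split; [apply ccont_const|intros; ring]. Qed.

Lemma cder_plus f g z : cder f z -> cder g z -> cder (fun w => (f w + g w)%C) z.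
Proof.
intros [p [Hp Ep]] [q [Hq Eq]].
exists (fun w => (p w + q w)%C); split; [now apply ccont_plus|].
intros w; rewrite (Ep w), (Eq w); ring.
Qed.

Lemma cder_mult f g z : cder f z -> cder g z -> cder (fun w => (f w * g w)%C) z.
Proof.
intros Hf Hg; pose proof (cder_ccont _ _ Hf) as Cf.
destruct Hf as [p [Hp Ep]]; destruct Hg as [q [Hq Eq]].
exists (fun w => (p w * g z + f w * q w)%C); split.
- apply ccont_plus; apply ccont_mult; try assumption; apply ccont_const.
- intros w.
  assert (E : f z = (f w - (w - z) * p w)%C) by (rewrite (Ep w); ring).
  rewrite (Eq w), E; ring.
Qed.

Lemma cder_minus f g z : cder f z -> cder g z -> cder (fun w => (f w - g w)%C) z.
Proof.
intros Hf Hg.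
destruct (cder_plus f _ z Hf (cder_mult _ g z (cder_const (-(1)) z) Hg)) as [q [Hq E]].
exists q; split; [exact Hq|].
intros w; specialize (E w); transitivity (f w + - (1) * g w)%C; [ring|]; rewrite E; ring.
Qed.

Lemma cder_comp f g z : cder g z -> cder f (g z) -> cder (fun w => f (g w)) z.
Proof.
intros Hg [p [Hp Ep]]; pose proof (cder_ccont _ _ Hg) as Cg.
destruct Hg as [q [Hq Eq]].
exists (fun w => (q w * p (g w))%C); split.
- apply ccont_mult; [exact Hq|apply (continuous_comp g p); assumption].
- intros w; rewrite (Ep (g w)); rewrite (Eq w) at 1; ring.
Qed.

Lemma cder_inv f z : cder f z -> f z <> 0%C -> cder (fun w => (/ f w)%C) z.
Proof.
intros Hf N.
apply (cder_comp Cinv f z Hf).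
assert (P : 0 < Cmod (f z)) by now apply Cmod_gt_0.
apply (cder_loc Cinv (fun w => (- / f z * / w)%C) (f z) (Cmod (f z)) P).
- apply ccont_mult; [apply ccont_const|apply ccont_inv; [apply continuous_id|exact N]].
- intros w Hw.
  assert (w <> 0%C).
  { intros ->; replace (0 - f z)%C with (- f z)%C in Hw by ring; rewrite Cmod_opp in Hw; lra. }
  field; split; assumption.
Qed.

(** * Goursat's theorem for rectangles *)

Definition rect_int (f : C -> C) (a b c d : R) : C :=
  (CInt (fun x => f (x, c)) a b + Ci * CInt (fun y => f (b, y)) c d
   - CInt (fun x => f (x, d)) a b - Ci * CInt (fun y => f (a, y)) c d)%C.

Definition rect_cont (f : C -> C) (a b c d : R) : Prop :=
  forall x y, a <= x <= b -> c <= y <= d -> ccont f (x, y).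

Lemma ccont_horizontal f (x y : R) : ccont f (x, y) -> ccont (fun t : R => f (t, y)) x.
Proof.
intros H; apply (continuous_comp (fun t : R => (t, y) : C_UniformSpace) f); [|exact H].
apply continuous_C_pair; simpl; [apply continuous_id|apply continuous_const].
Qed.

Lemma ccont_vertical f (x y : R) : ccont f (x, y) -> ccont (fun t : R => f (x, t)) y.
Proof.
intros H; apply (continuous_comp (fun t : R => (x, t) : C_UniformSpace) f); [|exact H].
apply continuous_C_pair; simpl; [apply continuous_const|apply continuous_id].
Qed.

Lemma ex_CInt_horizontal f a b c d u v y : rect_cont f a b c d ->
  a <= u <= v -> v <= b -> c <= y <= d -> ex_CInt (fun x => f (x, y)) u v.
Proof.
intros H Hu Hv Hy; apply ex_CInt_cont; [lra|].
intros t Ht; apply ccont_horizontal, H; lra.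
Qed.

Lemma ex_CInt_vertical f a b c d u v x : rect_cont f a b c d ->
  c <= u <= v -> v <= d -> a <= x <= b -> ex_CInt (fun y => f (x, y)) u v.
Proof.
intros H Hu Hv Hy; apply ex_CInt_cont; [lra|].
intros t Ht; apply ccont_vertical, H; lra.
Qed.

Lemma rect_int_split f a b c d m n : rect_cont f a b c d ->
  a <= m <= b -> c <= n <= d ->
  rect_int f a b c d = (rect_int f a m c n + rect_int f m b c n
                        + rect_int f a m n d + rect_int f m b n d)%C.
Proof.
intros H Hm Hn; unfold rect_int.
assert (HX : forall y, c <= y <= d -> CInt (fun x => f (x, y)) a b =
   (CInt (fun x => f (x, y)) a m + CInt (fun x => f (x, y)) m b)%C).
{ intros y Hy; symmetry; apply CInt_Chasles; apply (ex_CInt_horizontal f a b c d); (exact H || lra). }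
assert (HY : forall x, a <= x <= b -> CInt (fun y => f (x, y)) c d =
   (CInt (fun y => f (x, y)) c n + CInt (fun y => f (x, y)) n d)%C).
{ intros x Hx; symmetry; apply CInt_Chasles; apply (ex_CInt_vertical f a b c d); (exact H || lra). }
rewrite (HX c), (HX d), (HY a), (HY b) by lra; ring.
Qed.

Lemma rect_int_bound f a b c d M : rect_cont f a b c d -> a <= b -> c <= d ->
  (forall x y, a <= x <= b -> c <= y <= d -> Cmod (f (x, y)) <= M) ->
  Cmod (rect_int f a b c d) <= 2 * ((b - a) + (d - c)) * M.
Proof.
intros H Hab Hcd HM; unfold rect_int.
assert (T : forall p q r s : C, Cmod (p + Ci * q - r - Ci * s) <= Cmod p + Cmod q + Cmod r + Cmod s).
{ intros p q r s.
  eapply Rle_trans; [apply Cmod_triangle|]; rewrite Cmod_opp, Cmod_mult, Cmod_Ci, Rmult_1_l.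
  apply Rplus_le_compat_r.
  eapply Rle_trans; [apply Cmod_triangle|]; rewrite Cmod_opp.
  apply Rplus_le_compat_r.
  eapply Rle_trans; [apply Cmod_triangle|]; rewrite Cmod_mult, Cmod_Ci; lra. }
eapply Rle_trans; [apply T|].
assert (B1 := CInt_bound (fun x => f (x, c)) a b M Hab
  (ex_CInt_horizontal f a b c d a b c H ltac:(lra) ltac:(lra) ltac:(lra)) (fun t Ht => HM t c Ht ltac:(lra))).
assert (B2 := CInt_bound (fun y => f (b, y)) c d M Hcd
  (ex_CInt_vertical f a b c d c d b H ltac:(lra) ltac:(lra) ltac:(lra)) (fun t Ht => HM b t ltac:(lra) Ht)).
assert (B3 := CInt_bound (fun x => f (x, d)) a b M Hab
  (ex_CInt_horizontal f a b c d a b d H ltac:(lra) ltac:(lra) ltac:(lra)) (fun t Ht => HM t d Ht ltac:(lra))).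
assert (B4 := CInt_bound (fun y => f (a, y)) c d M Hcd
  (ex_CInt_vertical f a b c d c d a H ltac:(lra) ltac:(lra) ltac:(lra)) (fun t Ht => HM a t ltac:(lra) Ht)).
lra.
Qed.

Lemma rect_int_plus f g a b c d : rect_cont f a b c d -> rect_cont g a b c d ->
  a <= b -> c <= d ->
  rect_int (fun z => (f z + g z)%C) a b c d = (rect_int f a b c d + rect_int g a b c d)%C.
Proof.
intros Hf Hg Hab Hcd; unfold rect_int.
assert (HX : forall y, c <= y <= d -> CInt (fun x => (f (x, y) + g (x, y))%C) a b =
   (CInt (fun x => f (x, y)) a b + CInt (fun x => g (x, y)) a b)%C).
{ intros y Hy; apply CInt_plus;
  [apply (ex_CInt_horizontal f a b c d)|apply (ex_CInt_horizontal g a b c d)]; (assumption || lra). }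
assert (HY : forall x, a <= x <= b -> CInt (fun y => (f (x, y) + g (x, y))%C) c d =
   (CInt (fun y => f (x, y)) c d + CInt (fun y => g (x, y)) c d)%C).
{ intros y Hy; apply CInt_plus;
  [apply (ex_CInt_vertical f a b c d)|apply (ex_CInt_vertical g a b c d)]; (assumption || lra). }
rewrite (HX c), (HX d), (HY a), (HY b) by lra; ring.
Qed.

Lemma RInt_id a b : RInt (fun x : R => x) a b = (b ^ 2 - a ^ 2) / 2.
Proof.
apply is_RInt_unique.
replace ((b ^ 2 - a ^ 2) / 2) with (minus (b ^ 2 / 2) (a ^ 2 / 2)) by (unfold minus, plus, opp; simpl; field).
apply (is_RInt_derive (fun x => x ^ 2 / 2) (fun x => x)).
- intros x _; auto_derive; [easy|field].
- intros x _; apply continuous_id.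
Qed.

Lemma CInt_pair (u v : R -> R) a b : ex_RInt u a b -> ex_RInt v a b ->
  CInt (fun t => (u t, v t)) a b = (RInt u a b, RInt v a b).
Proof.
intros Hu Hv; apply (is_RInt_unique (V := C_R_CompleteNormedModule)).
apply (is_RInt_fct_extend_pair (U := R_NormedModule) (V := R_NormedModule)); simpl;
now apply (RInt_correct (V := R_CompleteNormedModule)).
Qed.

Lemma ex_RInt_id a b : ex_RInt (fun x : R => x) a b.
Proof. apply (ex_RInt_continuous (V := R_CompleteNormedModule)); intros; apply continuous_id. Qed.

(** The affine part of a differentiable function is what subdivision does not
    make small relative to the squared size of the rectangle. *)
Lemma rect_int_affine (p q : C) a b c d : a <= b -> c <= d ->
  rect_int (fun z => (p + q * z)%C) a b c d = 0%C.
Proof.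
intros Hab Hcd.
assert (X : forall u v y, CInt (fun x => (x, y)) u v = ((v ^ 2 - u ^ 2) / 2, (v - u) * y)).
{ intros u v y; rewrite (CInt_pair (fun x => x) (fun _ => y)); [|apply ex_RInt_id|apply ex_RInt_const].
  rewrite RInt_id, RInt_const; reflexivity. }
assert (Y : forall u v x, CInt (fun y => (x, y)) u v = ((v - u) * x, (v ^ 2 - u ^ 2) / 2)).
{ intros u v x; rewrite (CInt_pair (fun _ => x) (fun y => y)); [|apply ex_RInt_const|apply ex_RInt_id].
  rewrite RInt_id, RInt_const; reflexivity. }
assert (EX : forall u v y, ex_CInt (fun x => (x, y)) u v).
{ intros; apply (ex_RInt_continuous (V := C_R_CompleteNormedModule)); intros.
  apply continuous_C_pair; simpl; [apply continuous_id|apply continuous_const]. }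
assert (EY : forall u v x, ex_CInt (fun y => (x, y)) u v).
{ intros; apply (ex_RInt_continuous (V := C_R_CompleteNormedModule)); intros.
  apply continuous_C_pair; simpl; [apply continuous_const|apply continuous_id]. }
assert (EC : forall u v, ex_CInt (fun _ => p) u v) by (intros; apply ex_RInt_const).
assert (AX : forall u v y, CInt (fun x => (p + q * (x, y))%C) u v = (RtoC (v - u) * p + q * ((v ^ 2 - u ^ 2) / 2, (v - u) * y)%R)%C).
{ intros; rewrite CInt_plus, CInt_const, CInt_mult, X; [reflexivity|apply EX|apply EC|].
  destruct (EX u v y) as [l Hl]; exists (q * l)%C; now apply is_CInt_mult. }
assert (AY : forall u v x, CInt (fun y => (p + q * (x, y))%C) u v = (RtoC (v - u) * p + q * ((v - u) * x, (v ^ 2 - u ^ 2) / 2)%R)%C).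
{ intros; rewrite CInt_plus, CInt_const, CInt_mult, Y; [reflexivity|apply EY|apply EC|].
  destruct (EY u v x) as [l Hl]; exists (q * l)%C; now apply is_CInt_mult. }
unfold rect_int; rewrite !AX, !AY.
destruct p as [p1 p2], q as [q1 q2]; apply injective_projections; simpl; field.
Qed.

Lemma rect_int_ext (f g : C -> C) a b c d : (forall z, f z = g z) ->
  rect_int f a b c d = rect_int g a b c d.
Proof.
intros E.
assert (HX : forall y, CInt (fun x => f (x, y)) a b = CInt (fun x => g (x, y)) a b).
{ intros y; apply (RInt_ext (V := C_R_CompleteNormedModule)); intros; apply E. }
assert (HY : forall x, CInt (fun y => f (x, y)) c d = CInt (fun y => g (x, y)) c d).
{ intros x; apply (RInt_ext (V := C_R_CompleteNormedModule)); intros; apply E. }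
unfold rect_int; now rewrite !HX, !HY.
Qed.

Record rectangle := Rect { rl : R; rr : R; rb : R; rt : R }.

Definition sub_rect (P : rectangle -> Prop) (r s : rectangle) : Prop :=
  P s /\ rl r <= rl s /\ rl s <= rr s /\ rr s <= rr r /\
  rb r <= rb s /\ rb s <= rt s /\ rt s <= rt r /\
  rr s - rl s = (rr r - rl r) / 2 /\ rt s - rb s = (rt r - rb r) / 2.

(** Iterating a choice of quarter gives nested rectangles whose sides are
    bounded monotone sequences; suprema give a common point. *)
Lemma bisection (P : rectangle -> Prop) (r0 : rectangle) :
  P r0 -> rl r0 <= rr r0 -> rb r0 <= rt r0 ->
  (forall r, P r -> rl r0 <= rl r -> rl r <= rr r -> rr r <= rr r0 ->
     rb r0 <= rb r -> rb r <= rt r -> rt r <= rt r0 -> exists s, sub_rect P r s) ->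
  exists x y, rl r0 <= x <= rr r0 /\ rb r0 <= y <= rt r0 /\
    forall n, exists r, P r /\ rl r0 <= rl r /\ rr r <= rr r0 /\ rb r0 <= rb r /\ rt r <= rt r0 /\
      rl r <= x <= rr r /\ rb r <= y <= rt r /\
      rr r - rl r = (rr r0 - rl r0) / 2 ^ n /\ rt r - rb r = (rt r0 - rb r0) / 2 ^ n.
Proof.
intros H0 Hlr Hbt Hs.
assert (Hg : exists g : rectangle -> rectangle, forall r, P r -> rl r0 <= rl r -> rl r <= rr r -> rr r <= rr r0 ->
     rb r0 <= rb r -> rb r <= rt r -> rt r <= rt r0 -> sub_rect P r (g r)).
{ apply (choice (fun r s => P r -> rl r0 <= rl r -> rl r <= rr r -> rr r <= rr r0 ->
     rb r0 <= rb r -> rb r <= rt r -> rt r <= rt r0 -> sub_rect P r s)).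
  intros r; destruct (classic (P r /\ rl r0 <= rl r /\ rl r <= rr r /\ rr r <= rr r0 /\
     rb r0 <= rb r /\ rb r <= rt r /\ rt r <= rt r0)) as [K|K].
  - destruct (Hs r) as [s S]; try tauto; exists s; intros; exact S.
  - exists r; intros; destruct K; tauto. }
destruct Hg as [g Hg].
set (u := fun n => Nat.iter n g r0).
assert (U : forall n, P (u n) /\ rl r0 <= rl (u n) /\ rl (u n) <= rr (u n) /\ rr (u n) <= rr r0 /\
     rb r0 <= rb (u n) /\ rb (u n) <= rt (u n) /\ rt (u n) <= rt r0).
{ induction n as [|n (A1 & A2 & A3 & A4 & A5 & A6 & A7)].
  - simpl; repeat split; try lra; exact H0.
  - destruct (Hg (u n)) as (B1 & B2 & B3 & B4 & B5 & B6 & B7 & B8); try assumption.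
    change (u (S n)) with (g (u n)); repeat split; try lra; exact B1. }
assert (V : forall n, sub_rect P (u n) (u (S n))).
{ intros n; destruct (U n) as (A1 & A2 & A3 & A4 & A5 & A6 & A7); now apply Hg. }
assert (M : forall n k, rl (u n) <= rl (u (n + k)%nat) /\ rr (u (n + k)%nat) <= rr (u n) /\
              rb (u n) <= rb (u (n + k)%nat) /\ rt (u (n + k)%nat) <= rt (u n)).
{ intros n k; induction k as [|k (A1 & A2 & A3 & A4)].
  - rewrite Nat.add_0_r; lra.
  - rewrite Nat.add_succ_r; destruct (V (n + k)%nat) as (B1 & B2 & B3 & B4 & B5 & B6 & B7 & B8); lra. }
assert (C : forall m n, rl (u m) <= rr (u n) /\ rb (u m) <= rt (u n)).
{ intros m n; destruct (M m n) as (A1 & A2 & A3 & A4); destruct (M n m) as (B1 & B2 & B3 & B4).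
  rewrite (Nat.add_comm n m) in *; destruct (U (m + n)%nat) as (C1 & C2 & C3 & C4 & C5 & C6 & C7); lra. }
assert (SUP : forall p q : nat -> R, (forall m n, p m <= q n) -> exists x, forall n, p n <= x <= q n).
{ intros p q Hpq; destruct (completeness (fun z => exists n, z = p n)) as [x [X1 X2]].
  - exists (q 0%nat); intros z [n ->]; apply Hpq.
  - exists (p 0%nat); now exists 0%nat.
  - exists x; intros n; split; [apply X1; now exists n|].
    apply X2; intros z [m ->]; apply Hpq. }
destruct (SUP (fun n => rl (u n)) (fun n => rr (u n)) (fun m n => proj1 (C m n))) as [x Hx].
destruct (SUP (fun n => rb (u n)) (fun n => rt (u n)) (fun m n => proj2 (C m n))) as [y Hy].
exists x, y; split; [exact (Hx 0%nat)|]; split; [exact (Hy 0%nat)|].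
intros n; exists (u n); destruct (U n) as (A1 & A2 & A3 & A4 & A5 & A6 & A7).
repeat (split; [first [assumption|apply Hx|apply Hy]|]).
clear - V; induction n as [|n [I1 I2]]; [simpl; split; field|].
destruct (V n) as (B1 & B2 & B3 & B4 & B5 & B6 & B7 & B8 & B9).
rewrite B8, B9, I1, I2; simpl; split; field; apply pow_nonzero; lra.
Qed.

(** If the integral were not zero, one of the four quarters would carry at
    least a quarter of it, and so on. At the limit point the function is
    affine up to an error o(|w - z|), so the integral over a rectangle of
    size S near it is o(S^2), whereas the selected ones carry a fixed
    multiple of S^2. *)
Theorem goursat (f : C -> C) a b c d : a <= b -> c <= d ->
  (forall x y, a <= x <= b -> c <= y <= d -> cder f (x, y)) ->
  rect_int f a b c d = 0%C.
Proof.
intros Hab Hcd Hf.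
assert (Hc : rect_cont f a b c d) by (intros x y Hx Hy; now apply cder_ccont, Hf).
apply Cmod_eq_0; destruct (Rle_lt_or_eq_dec _ _ (Cmod_ge_0 (rect_int f a b c d))) as [Hpos|E]; [exfalso|now symmetry].
set (L := (b - a) + (d - c)).
(* Small enough for the whole rectangle to have the property P below, which
   is such that failing on all four quarters implies failing on the
   rectangle. *)
set (eps := Cmod (rect_int f a b c d) / (2 * (L * L + 1))).
assert (HL : 0 <= L * L) by apply Rle_0_sqr.
assert (He : 0 < eps) by (apply Rdiv_lt_0_compat; lra).
set (P := fun r => eps * ((rr r - rl r) + (rt r - rb r)) ^ 2 < Cmod (rect_int f (rl r) (rr r) (rb r) (rt r))).
destruct (bisection P (Rect a b c d)) as (x & y & Hx & Hy & HP); simpl in *; try assumption.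
- unfold P; simpl; fold L.
  apply Rlt_le_trans with (eps * (2 * (L * L + 1))); [nra|].
  unfold eps; right; field; lra.
- intros [l r b' t] HP H1 H2 H3 H4 H5 H6; unfold P in HP; simpl in *.
  set (m := (l + r) / 2); set (n := (b' + t) / 2).
  assert (Hc' : rect_cont f l r b' t) by (intros u v Hu Hv; apply Hc; lra).
  rewrite (rect_int_split f l r b' t m n Hc') in HP by (unfold m, n; lra).
  set (S := ((r - l) + (t - b')) / 2).
  assert (HS : r - l + (t - b') = 2 * S) by (unfold S; field); rewrite HS in HP.
  assert (D : forall l' r' b'' t', sub_rect (fun _ => True) (Rect l r b' t) (Rect l' r' b'' t') ->
     eps * S ^ 2 < Cmod (rect_int f l' r' b'' t') -> sub_rect P (Rect l r b' t) (Rect l' r' b'' t')).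
  { intros l' r' b'' t' (_ & K1 & K2 & K3 & K4 & K5 & K6 & K7 & K8) K; simpl in *; unfold sub_rect; simpl.
    repeat split; try lra; unfold P; simpl.
    replace (r' - l' + (t' - b'')) with S by (unfold S; lra); exact K. }
  destruct (Rlt_dec (eps * S ^ 2) (Cmod (rect_int f l m b' n))) as [K1|K1].
  { exists (Rect l m b' n); apply D; [|exact K1]; unfold sub_rect, m, n; simpl; lra. }
  destruct (Rlt_dec (eps * S ^ 2) (Cmod (rect_int f m r b' n))) as [K2|K2].
  { exists (Rect m r b' n); apply D; [|exact K2]; unfold sub_rect, m, n; simpl; lra. }
  destruct (Rlt_dec (eps * S ^ 2) (Cmod (rect_int f l m n t))) as [K3|K3].
  { exists (Rect l m n t); apply D; [|exact K3]; unfold sub_rect, m, n; simpl; lra. }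
  destruct (Rlt_dec (eps * S ^ 2) (Cmod (rect_int f m r n t))) as [K4|K4].
  { exists (Rect m r n t); apply D; [|exact K4]; unfold sub_rect, m, n; simpl; lra. }
  exfalso.
  pose proof (Cmod_triangle (rect_int f l m b' n + rect_int f m r b' n + rect_int f l m n t) (rect_int f m r n t)).
  pose proof (Cmod_triangle (rect_int f l m b' n + rect_int f m r b' n) (rect_int f l m n t)).
  pose proof (Cmod_triangle (rect_int f l m b' n) (rect_int f m r b' n)).
  lra.
- destruct (Hf x y Hx Hy) as [q [Hq E]].
  destruct (proj1 (ccont_eps q (x, y)) Hq (eps / 2)) as [dl [Hdl K]]; [lra|].
  assert (Hn : exists n, L / 2 ^ n < dl).
  { destruct (pow_lt_1_zero (/ 2)) with (y := dl / (L + 1)) as [n Hn].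
    - rewrite Rabs_pos_eq; lra.
    - apply Rdiv_lt_0_compat; unfold L; lra.
    - exists n; specialize (Hn n (le_n n)).
      assert (0 < / 2 ^ n) by (apply Rinv_0_lt_compat, pow_lt; lra).
      rewrite pow_inv in Hn; rewrite Rabs_pos_eq in Hn by lra.
      apply Rmult_lt_compat_l with (r := L + 1) in Hn; [|unfold L; lra].
      replace ((L + 1) * (dl / (L + 1))) with dl in Hn by (field; unfold L; lra).
      unfold Rdiv; lra. }
  destruct Hn as [n Hn]; destruct (HP n) as ([l r b' t] & P1 & P2 & P3 & P4 & P5 & P6 & P7 & P8 & P9); simpl in *.
  unfold P in P1; simpl in P1.
  set (S := (r - l) + (t - b')) in *.
  assert (HS : S < dl).
  { unfold S; rewrite P8, P9; unfold L in Hn; unfold Rdiv in *; lra. }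
  (* The error e of the affine approximation A at the limit point is small
     relative to the distance from it. *)
  set (e := fun w => ((w - (x, y)) * (q w - q (x, y)))%C).
  set (A := fun w => ((f (x, y) - (x, y) * q (x, y)) + q (x, y) * w)%C).
  assert (Hc' : rect_cont f l r b' t) by (intros u v Hu Hv; apply Hc; lra).
  assert (HA : rect_cont A l r b' t).
  { intros u v Hu Hv; apply ccont_plus; [apply ccont_const|]; apply ccont_mult; [apply ccont_const|apply continuous_id]. }
  assert (Ee : forall w, e w = (f w - A w)%C) by (intros w; unfold e, A; rewrite (E w); ring).
  assert (He' : rect_cont e l r b' t).
  { intros u v Hu Hv; apply (continuous_ext (fun w => (f w - A w)%C)); [intros; now rewrite <- Ee|].
    apply ccont_minus; [now apply Hc'|now apply HA]. }
  assert (EI : rect_int f l r b' t = rect_int e l r b' t).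
  { transitivity (rect_int (fun w => (A w + e w)%C) l r b' t).
    - apply rect_int_ext; intros; rewrite Ee; ring.
    - rewrite rect_int_plus; try assumption; try lra.
      unfold A; rewrite rect_int_affine by lra; ring. }
  rewrite EI in P1; revert P1; apply Rle_not_lt.
  apply Rle_trans with (2 * ((r - l) + (t - b')) * (S * (eps / 2))); [|right; unfold S; field].
  apply rect_int_bound; try assumption; try lra.
  intros u v Hu Hv.
  assert (HD : Cmod ((u, v) - (x, y)) <= S).
  { replace ((u, v) - (x, y))%C with ((u - x)%R + Ci * (v - y)%R)%C by (apply injective_projections; simpl; ring).
    eapply Rle_trans; [apply Cmod_triangle|]; rewrite Cmod_mult, Cmod_Ci, !Cmod_R.
    unfold S; unfold Rabs; repeat destruct Rcase_abs; lra. }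
  unfold e; rewrite Cmod_mult; apply Rmult_le_compat; try apply Cmod_ge_0; [exact HD|].
  apply Rlt_le, K; lra.
Qed.

(** * Integrals over circles centred at the origin *)

(** Heine's theorem along the segment: it makes integrals over the segment
    continuous in the parameter. *)
Lemma uniform_in_parameter (k : R -> R -> C) (x0 a b : R) :
  (forall y, a <= y <= b ->
     continuous (T := prod_UniformSpace R_UniformSpace R_UniformSpace)
       (U := C_UniformSpace) (fun p => k (fst p) (snd p)) (x0, y)) ->
  forall eps, 0 < eps -> exists d, 0 < d /\
    forall x y, Rabs (x - x0) < d -> a <= y <= b -> Cmod (k x y - k x0 y) < eps.
Proof.
intros H eps He.
assert (He3 : 0 < eps / 3) by lra.
destruct (uniform_continuity_2d_1d' (fun u v => Re (k u v)) a b x0) with (eps := mkposreal _ He3) as [d1 H1].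
{ intros y Hy; apply continuity_2d_pt_filterlim; exact (continuous_Re _ _ (H y Hy)). }
destruct (uniform_continuity_2d_1d' (fun u v => Im (k u v)) a b x0) with (eps := mkposreal _ He3) as [d2 H2].
{ intros y Hy; apply continuity_2d_pt_filterlim; exact (continuous_Im _ _ (H y Hy)). }
exists (Rmin d1 d2); split; [apply Rmin_pos; apply cond_pos|].
intros x y Hx Hy.
assert (L1 := Rmin_l d1 d2); assert (L2 := Rmin_r d1 d2).
pose proof (cond_pos d1); pose proof (cond_pos d2).
assert (Hd : -Rmin d1 d2 < x - x0 < Rmin d1 d2) by now apply Rabs_def2 in Hx.
specialize (H1 y x0 y x Hy ltac:(lra) Hy ltac:(lra)); specialize (H2 y x0 y x Hy ltac:(lra) Hy ltac:(lra)).
rewrite Rminus_diag, Rabs_R0 in H1, H2.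
specialize (H1 (cond_pos d1)); specialize (H2 (cond_pos d2)); simpl in H1, H2.
replace (k x y - k x0 y)%C with (RtoC (Re (k x y) - Re (k x0 y)) + Ci * RtoC (Im (k x y) - Im (k x0 y)))%C
  by (apply injective_projections; unfold Re, Im; simpl; ring).
eapply Rle_lt_trans; [apply Cmod_triangle|]; rewrite Cmod_mult, Cmod_Ci, !Cmod_R; lra.
Qed.

Definition circ (rho th : R) : C := (rho * cos th, rho * sin th).

Lemma circ_Cmod rho th : 0 <= rho -> Cmod (circ rho th) = rho.
Proof.
intros H; unfold circ, Cmod; simpl.
replace (rho * cos th * (rho * cos th * 1) + rho * sin th * (rho * sin th * 1))
  with (rho * rho * (Rsqr (sin th) + Rsqr (cos th))) by (unfold Rsqr; ring).
rewrite sin2_cos2, Rmult_1_r; now apply sqrt_square.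
Qed.

(** The integral of g(z) dz / (i z). Dividing by z gives it a meaning for [rho
    = 0] and makes it a constant when g is one. *)
Definition circle_int (g : C -> C) (rho : R) : C := CInt (fun th => g (circ rho th)) 0 (2 * PI).

Lemma circ_cont rho th :
  continuous (T := prod_UniformSpace R_UniformSpace R_UniformSpace)
       (U := C_UniformSpace) (fun p => circ (fst p) (snd p)) (rho, th).
Proof.
apply continuous_C_pair; simpl;
apply (continuous_mult (K := R_AbsRing) (fun p : R * R => fst p)); try apply continuous_fst.
- apply (continuous_comp (fun p : R * R => snd p) cos); [apply continuous_snd|apply continuous_cos].
- apply (continuous_comp (fun p : R * R => snd p) sin); [apply continuous_snd|apply continuous_sin].
Qed.

Lemma circ_cont_th rho th : ccont (circ rho) th.
Proof.
apply continuous_C_pair; simpl; apply (continuous_mult (K := R_AbsRing) (fun _ => rho));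
try apply continuous_const; [apply continuous_cos|apply continuous_sin].
Qed.

Lemma ex_circle_int g rho : 0 <= rho -> (forall z, Cmod z = rho -> ccont g z) ->
  ex_CInt (fun th => g (circ rho th)) 0 (2 * PI).
Proof.
intros Hr Hg; apply ex_CInt_cont; [pose proof PI_RGT_0; lra|].
intros th _; apply (continuous_comp (circ rho) g); [apply circ_cont_th|].
now apply Hg, circ_Cmod.
Qed.

Lemma circle_int_cont g rho0 : 0 <= rho0 < 1 -> (forall z, Cmod z < 1 -> ccont g z) ->
  forall eps, 0 < eps -> exists d, 0 < d /\
    forall rho, 0 <= rho < 1 -> Rabs (rho - rho0) < d ->
      Cmod (circle_int g rho - circle_int g rho0) <= eps.
Proof.
intros Hr Hg eps He; pose proof PI_RGT_0 as HP.
destruct (uniform_in_parameter (fun r th => g (circ r th)) rho0 0 (2 * PI)) with (eps := eps / (2 * PI)) as [d [Hd H]].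
- intros y _.
  apply (continuous_comp (fun p : R * R => circ (fst p) (snd p)) g); [apply circ_cont|].
  apply Hg; simpl; rewrite circ_Cmod; lra.
- apply Rdiv_lt_0_compat; lra.
- exists d; split; [exact Hd|]; intros rho Hrho HD.
  assert (E1 : ex_CInt (fun th => g (circ rho th)) 0 (2 * PI)).
  { apply ex_circle_int; [lra|]; intros z Hz; apply Hg; lra. }
  assert (E2 : ex_CInt (fun th => g (circ rho0 th)) 0 (2 * PI)).
  { apply ex_circle_int; [lra|]; intros z Hz; apply Hg; lra. }
  unfold circle_int; rewrite <- CInt_minus by assumption.
  replace eps with ((2 * PI - 0) * (eps / (2 * PI))) by (field; lra).
  apply CInt_bound; [lra| |].
  + exact (ex_RInt_minus (V := C_R_NormedModule) _ _ _ _ E1 E2).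
  + intros t Ht; apply Rlt_le, H; [exact HD|lra].
Qed.

Definition cexp (z : C) : C := (exp (Re z) * cos (Im z), exp (Re z) * sin (Im z)).

Lemma cexp_circ x y : cexp (x, y) = circ (exp x) y.
Proof. reflexivity. Qed.

Lemma cexp_plus z w : cexp (z + w) = (cexp z * cexp w)%C.
Proof.
unfold cexp; destruct z as [a b], w as [c d]; simpl.
rewrite exp_plus, cos_plus, sin_plus; apply injective_projections; simpl; ring.
Qed.

Lemma real_der_eps (f : R -> R) l : is_derive f 0 l -> forall eps, 0 < eps -> exists d, 0 < d /\
  forall s, Rabs s < d -> Rabs (f s - f 0 - s * l) <= eps * Rabs s.
Proof.
intros [_ H] eps He.
assert (Z : is_filter_lim (locally (T := R_UniformSpace) 0) 0) by (intros P HP; exact HP).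
destruct (H 0 Z (mkposreal _ He)) as [d Hd].
exists d; split; [apply cond_pos|]; intros s Hs.
assert (B : ball (M := R_UniformSpace) 0 d s).
{ unfold ball; simpl; unfold AbsRing_ball, abs, minus, plus, opp; simpl; now rewrite Ropp_0, Rplus_0_r. }
specialize (Hd s B); unfold norm, minus, plus, opp, scal in Hd; simpl in Hd.
unfold abs, mult in Hd; simpl in Hd; rewrite Ropp_0, Rplus_0_r in Hd; exact Hd.
Qed.

(** The functional equation reduces the claim to the point 0, where it follows
    from the derivatives at 0 of exp, cos and sin. *)
Lemma cder_cexp z : cder cexp z.
Proof.
assert (K : ccont (fun w => if Ceq_dec w 0%C then RtoC 1 else ((cexp w - 1) / w)%C) (0%C : C)).
{ apply ccont_eps; intros eps He.
  destruct (real_der_eps exp 1) with (eps := eps / 9) as [d1 [Hd1 H1]]; [auto_derive; [easy|rewrite exp_0; ring]|lra|].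
  destruct (real_der_eps cos 0) with (eps := eps / 9) as [d2 [Hd2 H2]]; [auto_derive; [easy|rewrite sin_0; ring]|lra|].
  destruct (real_der_eps sin 1) with (eps := eps / 9) as [d3 [Hd3 H3]]; [auto_derive; [easy|rewrite cos_0; ring]|lra|].
  (* The errors below add up to at most 7 (eps / 9) |w|. *)
  set (d := Rmin (Rmin d1 d2) (Rmin d3 (Rmin (/ 2) (eps / 9)))).
  assert (Dd : 0 < d /\ d <= d1 /\ d <= d2 /\ d <= d3 /\ d <= / 2 /\ d <= eps / 9).
  { unfold d; repeat split; [repeat apply Rmin_pos; lra|le_Rmin..]. }
  exists d; split; [tauto|]; intros w Hw.
  replace (w - 0)%C with w in Hw by ring.
  destruct (Ceq_dec 0 0) as [_|N]; [|now destruct N].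
  destruct (Ceq_dec w 0) as [->|N].
  { replace (1 - 1)%C with (RtoC 0) by ring; rewrite Cmod_0; exact He. }
  assert (P0 : 0 < Cmod w) by now apply Cmod_gt_0.
  replace ((cexp w - 1) / w - 1)%C with ((cexp w - 1 - w) / w)%C by (field; exact N).
  rewrite Cmod_div by exact N.
  apply (Rmult_lt_reg_r (Cmod w)); [exact P0|].
  unfold Rdiv; rewrite Rmult_assoc, Rinv_l, Rmult_1_r by lra.
  destruct w as [s t].
  assert (Ls := Rmax_Cmod (s, t)); simpl in Ls.
  assert (Hs : Rabs s <= Cmod (s, t)) by (eapply Rle_trans; [apply Rmax_l|exact Ls]).
  assert (Ht : Rabs t <= Cmod (s, t)) by (eapply Rle_trans; [apply Rmax_r|exact Ls]).
  set (m := Cmod (s, t)) in *.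
  specialize (H1 s ltac:(lra)); specialize (H2 t ltac:(lra)); specialize (H3 t ltac:(lra)).
  rewrite exp_0 in H1; rewrite cos_0 in H2; rewrite sin_0 in H3.
  set (e1 := exp s - 1 - s * 1) in *; set (c1 := cos t - 1 - t * 0) in *; set (s1 := sin t - 0 - t * 1) in *.
  assert (Q1 : Rabs e1 <= eps / 9 * m) by nra.
  assert (Q2 : Rabs c1 <= eps / 9 * m) by nra.
  assert (Q3 : Rabs s1 <= eps / 9 * m) by nra.
  replace (cexp (s, t) - 1 - (s, t))%C with (RtoC (exp s * c1 + e1) + Ci * RtoC (s1 + (e1 + s) * sin t))%C
    by (unfold e1, c1, s1, cexp; apply injective_projections; simpl; ring).
  eapply Rle_lt_trans; [apply Cmod_triangle|]; rewrite Cmod_mult, Cmod_Ci, !Cmod_R, Rmult_1_l.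
  assert (Hexp : 0 < exp s <= 2).
  { split; [apply exp_pos|].
    assert (X := exp_ineq1_le (- s)); rewrite exp_Ropp in X.
    assert (S2 : s <= / 2) by (apply Rle_trans with (Rabs s); [apply Rle_abs|lra]).
    assert (Y : exp s * / exp s = 1) by (field; apply Rgt_not_eq, exp_pos).
    pose proof (exp_pos s); nra. }
  assert (T1 : Rabs (exp s * c1 + e1) <= 2 * (eps / 9 * m) + eps / 9 * m).
  { eapply Rle_trans; [apply Rabs_triang|]; rewrite Rabs_mult, (Rabs_pos_eq (exp s)) by lra.
    pose proof (Rabs_pos c1); nra. }
  assert (T2 : Rabs (s1 + (e1 + s) * sin t) <= 4 * (eps / 9 * m)).
  { eapply Rle_trans; [apply Rabs_triang|]; rewrite Rabs_mult.
    assert (Rabs (sin t) <= 1) by (apply Rabs_le; apply SIN_bound).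
    assert (Z : Rabs (sin t) <= eps / 9 * m + m).
    { replace (sin t) with (s1 + t) by (unfold s1; ring).
      eapply Rle_trans; [apply Rabs_triang|]; lra. }
    assert (Rabs (e1 + s) <= Rabs e1 + Rabs s) by apply Rabs_triang.
    pose proof (Rabs_pos (sin t)); pose proof (Rabs_pos e1); pose proof (Rabs_pos s).
    set (c := eps / 9 * m) in *.
    assert (U1 : Rabs (e1 + s) * Rabs (sin t) <= Rabs e1 * 1 + Rabs s * (c + m)).
    { apply Rle_trans with ((Rabs e1 + Rabs s) * Rabs (sin t)); [apply Rmult_le_compat_r; lra|].
      rewrite Rmult_plus_distr_r; apply Rplus_le_compat; apply Rmult_le_compat_l; lra. }
    assert (0 <= c) by (unfold c; nra).
    assert (U2 : Rabs s * c <= / 2 * c) by (apply Rmult_le_compat_r; lra).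
    assert (U3 : Rabs s * m <= c) by (unfold c; apply Rmult_le_compat_r; lra).
    lra. }
  assert (0 < eps / 9 * m) by nra.
  lra. }
apply (cder_loc cexp (fun w => cexp z * (if Ceq_dec (w - z) 0%C then RtoC 1 else (cexp (w - z) - 1) / (w - z)))%C z 1 Rlt_0_1).
- apply ccont_mult; [apply ccont_const|].
  apply (continuous_comp (fun w : C_UniformSpace => (w - z)%C : C_UniformSpace)
    (fun w => if Ceq_dec w 0%C then RtoC 1 else ((cexp w - 1) / w)%C)).
  + apply ccont_minus; [apply continuous_id|apply ccont_const].
  + replace (z - z)%C with (RtoC 0) by ring; exact K.
- intros w _; destruct (Ceq_dec (w - z) 0%C) as [E|N].
  + rewrite E; replace w with (w - z + z)%C by ring; rewrite E, Cplus_0_l; ring.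
  + replace (cexp w) with (cexp z * cexp (w - z))%C by (rewrite <- cexp_plus; f_equal; ring).
    field; exact N.
Qed.

Lemma exp_le_compat x y : x <= y -> exp x <= exp y.
Proof. intros [H| ->]; [left; now apply exp_increasing|right; reflexivity]. Qed.

(** In the coordinate log z an annulus is a rectangle; by periodicity the two
    sides on which the angle is 0 and 2 PI contribute equal integrals. *)
Lemma circle_int_const g r1 r2 : 0 < r1 <= r2 ->
  (forall z, r1 <= Cmod z <= r2 -> cder g z) ->
  circle_int g r1 = circle_int g r2.
Proof.
intros Hr Hg; pose proof PI_RGT_0 as HP.
assert (L : ln r1 <= ln r2) by (apply ln_le; lra).
assert (D : forall x y, ln r1 <= x <= ln r2 -> 0 <= y <= 2 * PI -> cder (fun u => g (cexp u)) (x, y)).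
{ intros x y Hx _; apply cder_comp; [apply cder_cexp|]; apply Hg.
  rewrite cexp_circ, circ_Cmod by (left; apply exp_pos).
  rewrite <- (exp_ln r1), <- (exp_ln r2) by lra.
  split; apply exp_le_compat; tauto. }
assert (G := goursat (fun u => g (cexp u)) (ln r1) (ln r2) 0 (2 * PI) L ltac:(lra) D).
unfold rect_int in G.
assert (E0 : CInt (fun x => g (cexp (x, 2 * PI))) (ln r1) (ln r2) = CInt (fun x => g (cexp (x, 0))) (ln r1) (ln r2)).
{ apply CInt_ext; [exact L|]; intros x _; unfold cexp; simpl.
  now rewrite cos_2PI, sin_2PI, cos_0, sin_0. }
assert (E1 : forall r, 0 < r -> CInt (fun y => g (cexp (ln r, y))) 0 (2 * PI) = circle_int g r).
{ intros r H; unfold circle_int; apply CInt_ext; [lra|]; intros t _; now rewrite cexp_circ, exp_ln. }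
rewrite E0, !E1 in G by lra.
assert (N : Ci <> 0%C) by (intros E; apply (f_equal snd) in E; simpl in E; lra).
symmetry; apply Cminus_eq_0, (Cmult_integral_contr Ci); [exact N|].
rewrite <- G; ring.
Qed.

Lemma cder_ext_loc f g z d : 0 < d -> (forall w, Cmod (w - z) < d -> f w = g w) ->
  cder g z -> cder f z.
Proof.
intros Hd E [q [Hq Eg]]; apply (cder_loc f q z d Hd Hq).
intros w Hw; rewrite (E w Hw), (E z), (Eg w); [reflexivity|].
replace (z - z)%C with (RtoC 0) by ring; now rewrite Cmod_0.
Qed.

(** The quotient [q] is differentiable except perhaps at [w]. So the integral
    is constant for radii below |w| and for radii above it; it is
    continuous in the radius, because [q] is continuous at [w] also, and it
    vanishes at radius 0. *)
Lemma circle_int_quotient (f q : C -> C) (w : C) : (forall z, Cmod z < 1 -> cder f z) ->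
  ccont q w -> (forall z : C, f z = f w + (z - w) * q z)%C ->
  forall rho, Cmod w < rho < 1 -> circle_int (fun z => q z * z)%C rho = 0%C.
Proof.
intros Hf Hq E.
set (g := fun z => (q z * z)%C).
assert (Dg : forall z, Cmod z < 1 -> z <> w -> cder g z).
{ intros z Hz N; apply cder_mult; [|apply cder_id].
  assert (P0 : 0 < Cmod (z - w)) by now apply Cmod_gt_0, Cminus_neq.
  apply (cder_ext_loc q (fun u => (f u - f w) * / (u - w))%C z (Cmod (z - w)) P0).
  - intros u Hu; rewrite (E u); field; apply Cminus_neq; intros ->.
    replace (w - z)%C with (- (z - w))%C in Hu by ring; rewrite Cmod_opp in Hu; lra.
  - apply cder_mult; [apply cder_minus; [now apply Hf|apply cder_const]|].
    apply cder_inv; [apply cder_minus; [apply cder_id|apply cder_const]|now apply Cminus_neq]. }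
assert (Cg : forall z, Cmod z < 1 -> ccont g z).
{ intros z Hz; destruct (Ceq_dec z w) as [->|N]; [|now apply cder_ccont, Dg].
  apply ccont_mult; [exact Hq|apply continuous_id]. }
assert (G0 : circle_int g 0 = 0%C).
{ unfold circle_int; rewrite (CInt_ext _ (fun _ => 0%C)); [rewrite CInt_const; ring|pose proof PI_RGT_0; lra|].
  intros t _; unfold g, circ; rewrite !Rmult_0_l; apply Cmult_0_r. }
assert (LIM : forall r0 c, 0 <= r0 < 1 ->
  (forall d, 0 < d -> exists r, 0 <= r < 1 /\ Rabs (r - r0) < d /\ circle_int g r = c) -> circle_int g r0 = c).
{ intros r0 c Hr0 H.
  symmetry; apply Ceq_of_close; intros eps He.
  destruct (circle_int_cont g r0 Hr0 Cg eps He) as [d [Hd K]].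
  destruct (H d Hd) as [r (H1 & H2 & <-)]; now apply K. }
assert (Small : forall r, 0 <= r <= Cmod w -> Cmod w < 1 -> circle_int g r = 0%C).
{ assert (S1 : forall r, 0 <= r < Cmod w -> Cmod w < 1 -> circle_int g r = 0%C).
  { intros r [[Hr|<-] Hw] H1; [|exact G0].
    rewrite <- G0; symmetry; apply LIM; [lra|].
    intros d Hd; exists (Rmin (d / 2) r).
    assert (P1 := Rmin_l (d / 2) r); assert (P2 := Rmin_r (d / 2) r).
    assert (0 < Rmin (d / 2) r) by (apply Rmin_pos; lra).
    split; [lra|]; split; [rewrite Rminus_0_r, Rabs_pos_eq by lra; lra|].
    apply circle_int_const; [lra|].
    intros z Hz; apply Dg; [lra|intros ->; lra]. }
  intros r [Hr [Hw| ->]] H1; [apply S1; lra|].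
  destruct (Rle_lt_or_eq_dec _ _ (Cmod_ge_0 w)) as [P0|E0]; [|now rewrite <- E0].
  apply LIM; [lra|]; intros d Hd; exists (Rmax 0 (Cmod w - d / 2)).
  assert (P1 := Rmax_l 0 (Cmod w - d / 2)); assert (P2 := Rmax_r 0 (Cmod w - d / 2)).
  assert (P3 : Rmax 0 (Cmod w - d / 2) < Cmod w) by (apply Rmax_lub_lt; lra).
  split; [lra|]; split; [apply Rabs_def1; lra|apply S1; lra]. }
intros rho Hrho; rewrite <- (Small (Cmod w)); [|split; [apply Cmod_ge_0|lra]|lra].
symmetry; apply LIM; [split; [apply Cmod_ge_0|lra]|].
intros d Hd; exists (Rmin (Cmod w + d / 2) rho).
assert (P1 := Rmin_l (Cmod w + d / 2) rho); assert (P2 := Rmin_r (Cmod w + d / 2) rho).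
assert (P3 : Cmod w < Rmin (Cmod w + d / 2) rho) by (apply Rmin_glb_lt; lra).
pose proof (Cmod_ge_0 w).
split; [lra|]; split; [apply Rabs_def1; lra|].
apply circle_int_const; [lra|]; intros z Hz; apply Dg; [lra|intros ->; lra].
Qed.

(** * Cauchy's formula and the identity theorem in the unit disc *)

Section Cauchy.

Variables (f : C -> C) (rho : R).
Hypotheses (Hf : forall z, Cmod z < 1 -> cder f z) (Hrho : 0 < rho < 1).

Let kern (n : nat) (v z : C) : C := (f z * (/ z) ^ n * (z / (z - v)))%C.
Let Cf (n : nat) (v : C) : C := circle_int (kern n v) rho.
Let c (n : nat) : C := circle_int (fun z => f z * (/ z) ^ n)%C rho.

Lemma circle_neq_0 z : Cmod z = rho -> z <> 0%C.
Proof. intros H ->; rewrite Cmod_0 in H; lra. Qed.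

Lemma circle_neq v z : Cmod v < rho -> Cmod z = rho -> (z - v)%C <> 0%C.
Proof. intros H1 H2; apply Cminus_neq; intros ->; lra. Qed.

Lemma ccont_pow {T : UniformSpace} (g : T -> C) x n : ccont g x -> ccont (fun u => (g u ^ n)%C) x.
Proof. intros H; induction n; simpl; [apply ccont_const|now apply ccont_mult]. Qed.

Lemma kern0_cont n z : Cmod z = rho -> ccont (fun z => f z * (/ z) ^ n)%C z.
Proof.
intros Hz; apply ccont_mult; [apply cder_ccont, Hf; lra|].
apply ccont_pow, ccont_inv; [apply continuous_id|now apply circle_neq_0].
Qed.

Lemma quot_cont v z : Cmod v < rho -> Cmod z = rho -> ccont (fun z => z / (z - v))%C z.
Proof.
intros Hv Hz; apply ccont_mult; [apply continuous_id|].
apply ccont_inv; [apply ccont_minus; [apply continuous_id|apply ccont_const]|now apply circle_neq].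
Qed.

Lemma kern_cont n v z : Cmod v < rho -> Cmod z = rho -> ccont (kern n v) z.
Proof. intros Hv Hz; apply ccont_mult; [now apply kern0_cont|now apply quot_cont]. Qed.

Lemma circle_int_ext g h : (forall z, Cmod z = rho -> g z = h z) -> circle_int g rho = circle_int h rho.
Proof.
intros E; unfold circle_int; apply CInt_ext; [pose proof PI_RGT_0; lra|].
intros t _; apply E, circ_Cmod; lra.
Qed.

Lemma circle_int_plus g h : (forall z, Cmod z = rho -> ccont g z) -> (forall z, Cmod z = rho -> ccont h z) ->
  circle_int (fun z => g z + h z)%C rho = (circle_int g rho + circle_int h rho)%C.
Proof. intros Hg Hh; unfold circle_int; apply (CInt_plus (fun t => g (circ rho t)) (fun t => h (circ rho t))); [apply (ex_circle_int g)|apply (ex_circle_int h)]; (lra || assumption). Qed.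

Lemma circle_int_mult a g : (forall z, Cmod z = rho -> ccont g z) ->
  circle_int (fun z => a * g z)%C rho = (a * circle_int g rho)%C.
Proof. intros Hg; apply (CInt_mult a (fun t => g (circ rho t))), (ex_circle_int g); (lra || assumption). Qed.

(** The expansion 1 = (z - v) / z + v / z under the integral: [Cf] behaves like
    the remainders of the Taylor series of f at 0, with coefficients [c]. *)
Lemma Cf_rec n v : Cmod v < rho -> Cf n v = (c n + v * Cf (S n) v)%C.
Proof.
intros Hv; unfold Cf, c.
rewrite <- circle_int_mult by (intros; now apply kern_cont).
rewrite <- circle_int_plus; [|intros; now apply kern0_cont|].
- apply circle_int_ext; intros z Hz; unfold kern; simpl.
  field; split; [now apply circle_neq|now apply circle_neq_0].
- intros z Hz; apply ccont_mult; [apply ccont_const|now apply kern_cont].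
Qed.

Lemma Cf_bound : exists M, 0 <= M /\ forall n v, Cmod v < rho ->
  Cmod (Cf n v) <= M * (/ rho) ^ n * / (rho - Cmod v).
Proof.
pose proof PI_RGT_0 as HP.
destruct (bounded_continuity (V := C_R_NormedModule) (fun t => f (circ rho t)) 0 (2 * PI)) as [M HM].
{ intros t _; apply (continuous_comp (circ rho) f); [apply circ_cont_th|].
  apply cder_ccont, Hf; rewrite circ_Cmod; lra. }
assert (M0 : 0 <= M).
{ eapply Rle_trans; [|apply Rlt_le, (HM 0); lra]; apply norm_ge_0. }
exists (2 * PI * (M * rho)); split; [apply Rmult_le_pos; [lra|apply Rmult_le_pos; lra]|].
intros n v Hv.
replace (2 * PI * (M * rho) * (/ rho) ^ n * / (rho - Cmod v)) with
  ((2 * PI - 0) * (M * (/ rho) ^ n * (rho * / (rho - Cmod v)))) by ring.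
apply (CInt_bound (fun t => kern n v (circ rho t))); [lra|apply (ex_circle_int (kern n v)); [lra|intros; now apply kern_cont]|].
intros t Ht; specialize (HM t Ht); rewrite norm_C_R in HM.
assert (Hz := circ_Cmod rho t ltac:(lra)); set (z := circ rho t) in *.
unfold kern; rewrite !Cmod_mult, Cmod_div, Cmod_pow, Cmod_inv, Hz
 by (first [now apply circle_neq|now apply circle_neq_0]).
assert (D : rho - Cmod v <= Cmod (z - v)).
{ assert (T := Cmod_triangle (z - v) v).
  replace (z - v + v)%C with z in T by ring; lra. }
assert (0 < (/ rho) ^ n) by (apply pow_lt, Rinv_0_lt_compat; lra).
assert (0 < / Cmod (z - v)) by (apply Rinv_0_lt_compat; lra).
apply Rmult_le_compat; [apply Rmult_le_pos; [apply Cmod_ge_0|lra]|unfold Rdiv; nra|nra|].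
apply Rmult_le_compat_l; [lra|]; apply Rinv_le_contravar; lra.
Qed.

(** The real part of z / (z - v) is positive on the circle because |v| < |z|;
    this replaces the evaluation of the integral. *)
Lemma winding_neq_0 v : Cmod v < rho -> circle_int (fun z => z / (z - v))%C rho <> 0%C.
Proof.
intros Hv; pose proof PI_RGT_0 as HP.
assert (E : ex_CInt (fun t => (circ rho t / (circ rho t - v))%C) 0 (2 * PI)).
{ apply (ex_circle_int (fun z => z / (z - v))%C rho); [lra|]; intros; now apply quot_cont. }
intros Z; apply (f_equal fst) in Z; change (fst (RtoC 0)) with 0 in Z.
assert (Q := is_RInt_fct_extend_fst (U := R_NormedModule) (V := R_NormedModule) _ _ _ _
   (RInt_correct (V := C_R_CompleteNormedModule) _ _ _ E)).
apply (is_RInt_unique (V := R_CompleteNormedModule)) in Q; assert (Q' := eq_trans Q Z); clear Q; rename Q' into Q.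
revert Q; apply Rgt_not_eq, RInt_gt_0; [lra|..].
- intros t _; assert (Hz := circ_Cmod rho t ltac:(lra)).
  assert (Hn := circle_neq v _ Hv Hz).
  destruct (circ rho t) as [a b]; destruct v as [p q].
  assert (A1 : a ^ 2 + b ^ 2 = rho ^ 2).
  { rewrite <- Hz; rewrite Cmod2_alt; reflexivity. }
  assert (A2 : p ^ 2 + q ^ 2 < rho ^ 2).
  { replace (p ^ 2 + q ^ 2) with (Cmod (p, q) ^ 2) by (rewrite Cmod2_alt; reflexivity).
    pose proof (Cmod_ge_0 (p, q)); simpl; nra. }
  assert (A3 : 0 < (a - p) ^ 2 + (b - q) ^ 2).
  { destruct (Rle_lt_or_eq_dec 0 ((a - p) ^ 2 + (b - q) ^ 2)) as [H|H]; [|exact H|].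
    { apply Rplus_le_le_0_compat; apply pow2_ge_0. }
    exfalso; apply Hn.
    pose proof (pow2_ge_0 (a - p)); pose proof (pow2_ge_0 (b - q)).
    assert (a - p = 0) by (apply Rsqr_0_uniq; unfold Rsqr; lra).
    assert (b - q = 0) by (apply Rsqr_0_uniq; unfold Rsqr; lra).
    apply injective_projections; simpl; lra. }
  simpl; unfold Rdiv.
  replace (a * ((a + - p) * / ((a + - p) * ((a + - p) * 1) + (b + - q) * ((b + - q) * 1))) -
   b * (- (b + - q) * / ((a + - p) * ((a + - p) * 1) + (b + - q) * ((b + - q) * 1))))
   with ((a * (a - p) + b * (b - q)) / ((a - p) ^ 2 + (b - q) ^ 2)) by (field; lra).
  apply Rdiv_lt_0_compat; nra.
- intros t _; apply (continuous_Re (fun t => (circ rho t / (circ rho t - v))%C)).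
  apply (continuous_comp (circ rho) (fun z => z / (z - v))%C); [apply circ_cont_th|].
  apply quot_cont; [exact Hv|apply circ_Cmod; lra].
Qed.

(** On the circle f(z) z / (z - v) = q(z) z + f(v) z / (z - v) with q the
    difference quotient at [v], and q(z) z has integral zero. *)
Lemma cauchy_formula v : Cmod v < rho ->
  (f v * circle_int (fun z => z / (z - v)) rho = Cf 0 v)%C.
Proof.
intros Hv; destruct (Hf v ltac:(lra)) as [q [Hq E]].
assert (Z := circle_int_quotient f q v Hf Hq E rho ltac:(lra)).
assert (E2 : Cf 0 v = circle_int (fun z => q z * z + f v * (z / (z - v)))%C rho).
{ apply circle_int_ext; intros z Hz; unfold kern; simpl; rewrite (E z).
  field; now apply circle_neq. }
rewrite E2, circle_int_plus, Z, circle_int_mult, Cplus_0_l; [reflexivity|..].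
- intros; now apply quot_cont.
- intros z Hz; apply (continuous_ext_loc (T := C_UniformSpace) (U := C_UniformSpace) _ (fun z => (f z - f v) * (z / (z - v)))%C).
  + assert (P0 : 0 < Cmod (z - v)) by (apply Cmod_gt_0; now apply circle_neq).
    assert (CC : ccont (fun z : C => (z - v)%C) z) by (apply ccont_minus; [apply continuous_id|apply ccont_const]).
    assert (O : locally (T := C_UniformSpace) z (fun u : C => (u - v)%C <> 0%C)).
    { assert (P2 : 0 < Cmod (z - v) / sqrt 2) by (apply Rdiv_lt_0_compat; [exact P0|apply sqrt_lt_R0; lra]).
      exists (mkposreal _ P2); intros u Hu U.
      assert (L := C_NormedModule_mixin_compat2 _ _ _ Hu); simpl in L.
      replace (sqrt 2 * (Cmod (z - v) / sqrt 2)) with (Cmod (z - v)) in L by (field; apply Rgt_not_eq, sqrt_lt_R0; lra).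
      change (Cmod (u - z) < Cmod (z - v)) in L.
      replace (u - z)%C with (- (z - v) + (u - v))%C in L by ring.
      rewrite U, Cplus_0_r, Cmod_opp in L; lra. }
    generalize O; apply filter_imp; intros u Hu; change ((f u - f v) * (u / (u - v)) = q u * u)%C; rewrite (E u); field; exact Hu.
  + apply ccont_mult; [|now apply quot_cont].
    apply ccont_minus; [apply cder_ccont, Hf; lra|apply ccont_const].
- intros z Hz; apply ccont_mult; [apply ccont_const|now apply quot_cont].
Qed.

(** Letting x tend to 0 in [Cf_rec] along the real zeros shows one coefficient
    after the other to vanish. Then f(w) is, up to a factor, w^n [Cf n w]
    for every n, which is O((|w| / rho)^n). *)
Lemma real_zeros_propagate d : 0 < d -> (forall x : R, Rabs x < d -> f (RtoC x) = 0%C) ->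
  forall w, Cmod w < rho -> f w = 0%C.
Proof.
intros Hd Hz.
destruct Cf_bound as [M [M0 HM]].
set (d' := Rmin d (rho / 2)).
assert (Hd' : 0 < d' <= d /\ d' <= rho / 2).
{ unfold d'; split; [split; [apply Rmin_pos; lra|apply Rmin_l]|apply Rmin_r]. }
assert (Key : forall n, (forall x : R, 0 < Rabs x < d' -> Cf n (RtoC x) = 0%C) /\
   (c n = 0%C)).
{ assert (Step : forall n, (forall x : R, 0 < Rabs x < d' -> Cf n (RtoC x) = 0%C) -> c n = 0%C).
  { intros n H.
    apply Ceq_of_close; intros eps He; rewrite Cminus_0_r.
    set (B := M * (/ rho) ^ S n * / (rho / 2)).
    assert (B0 : 0 <= B).
    { unfold B; apply Rmult_le_pos; [apply Rmult_le_pos; [exact M0|apply pow_le]|]; left; apply Rinv_0_lt_compat; lra. }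
    set (x := Rmin (d' / 2) (eps / (B + 1))).
    assert (X0 : 0 < x) by (apply Rmin_pos; [lra|apply Rdiv_lt_0_compat; lra]).
    assert (X1 : x <= d' / 2) by apply Rmin_l.
    assert (X2 : x * (B + 1) <= eps).
    { apply Rle_trans with (eps / (B + 1) * (B + 1)); [|right; field; lra].
      apply Rmult_le_compat_r; [lra|apply Rmin_r]. }
    assert (XX : Rabs x = x) by (apply Rabs_pos_eq; lra).
    assert (R1 := Cf_rec n (RtoC x)); rewrite Cmod_R, XX in R1; specialize (R1 ltac:(lra)).
    rewrite H in R1 by (rewrite XX; lra).
    assert (R2 : c n = (- (RtoC x * Cf (S n) (RtoC x)))%C).
    { transitivity (c n + RtoC x * Cf (S n) (RtoC x) - RtoC x * Cf (S n) (RtoC x))%C; [ring|].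
      rewrite <- R1; ring. }
    rewrite R2, Cmod_opp, Cmod_mult, Cmod_R, XX.
    assert (R3 := HM (S n) (RtoC x)); rewrite Cmod_R, XX in R3; specialize (R3 ltac:(lra)).
    assert (R4 : Cmod (Cf (S n) (RtoC x)) <= B).
    { eapply Rle_trans; [exact R3|]; unfold B; apply Rmult_le_compat_l.
      - apply Rmult_le_pos; [exact M0|apply pow_le; left; apply Rinv_0_lt_compat; lra].
      - apply Rinv_le_contravar; lra. }
    nra. }
  induction n as [|n [IH1 IH2]].
  - assert (H0 : forall x : R, 0 < Rabs x < d' -> Cf 0 (RtoC x) = 0%C).
    { intros x Hx; rewrite <- cauchy_formula by (rewrite Cmod_R; lra).
      rewrite Hz by lra; ring. }
    split; [exact H0|now apply Step].
  - assert (H0 : forall x : R, 0 < Rabs x < d' -> Cf (S n) (RtoC x) = 0%C).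
    { intros x Hx; apply (Cmult_integral_contr (RtoC x)).
      - intros E; apply (f_equal Cmod) in E; rewrite Cmod_R, Cmod_0 in E; lra.
      - assert (R1 := Cf_rec n (RtoC x)); rewrite Cmod_R in R1; specialize (R1 ltac:(lra)).
        rewrite IH1, IH2 in R1 by exact Hx; rewrite R1; ring. }
    split; [exact H0|now apply Step]. }
intros w Hw.
apply (Cmult_integral_contr _ _ (winding_neq_0 w Hw)).
rewrite Cmult_comm, (cauchy_formula w Hw).
assert (Pw : forall n, Cf 0 w = (w ^ n * Cf n w)%C).
{ induction n as [|n IH]; [simpl; ring|].
  rewrite IH, (Cf_rec n w Hw), (proj2 (Key n)); simpl; ring. }
apply Ceq_of_close; intros eps He; rewrite Cminus_0_r.
set (K := M * / (rho - Cmod w)).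
assert (K0 : 0 <= K) by (apply Rmult_le_pos; [exact M0|left; apply Rinv_0_lt_compat; lra]).
pose proof (Cmod_ge_0 w) as W0.
destruct (pow_lt_1_zero (Cmod w * / rho)) with (y := eps / (K + 1)) as [n Hn].
- rewrite Rabs_pos_eq.
  + apply (Rmult_lt_reg_r rho); [lra|]; rewrite Rmult_assoc, Rinv_l; lra.
  + apply Rmult_le_pos; [lra|left; apply Rinv_0_lt_compat; lra].
- apply Rdiv_lt_0_compat; lra.
- specialize (Hn n (le_n n)); apply Rabs_def2 in Hn; destruct Hn as [Hn _].
  rewrite (Pw n), Cmod_mult, Cmod_pow.
  apply Rle_trans with (Cmod w ^ n * (M * (/ rho) ^ n * / (rho - Cmod w))).
  + apply Rmult_le_compat_l; [now apply pow_le|now apply HM].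
  + replace (Cmod w ^ n * (M * (/ rho) ^ n * / (rho - Cmod w))) with ((Cmod w * / rho) ^ n * K)
      by (unfold K; rewrite Rpow_mult_distr; ring).
    assert (Q : 0 <= (Cmod w * / rho) ^ n).
    { apply pow_le, Rmult_le_pos; [lra|left; apply Rinv_0_lt_compat; lra]. }
    apply Rle_trans with (eps / (K + 1) * (K + 1)); [|right; field; lra].
    apply Rmult_le_compat; lra.
Qed.

End Cauchy.

Theorem disc_identity (f : C -> C) d : (forall z, Cmod z < 1 -> cder f z) -> 0 < d ->
  (forall x : R, Rabs x < d -> f (RtoC x) = 0%C) -> forall w, Cmod w < 1 -> f w = 0%C.
Proof.
intros Hf Hd Hz w Hw; pose proof (Cmod_ge_0 w).
apply (real_zeros_propagate f ((1 + Cmod w) / 2) Hf ltac:(lra) d Hd Hz); lra.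
Qed.

(** * The identity theorem in the slit plane *)

(** The Moebius map (1 + w) / (1 - w) sends the disc onto the right half-plane
    and its square is the plane cut along the negative axis; the factor -
    1/8 sends 0 to the midpoint of (-1/4, 0). *)
Definition slit_chart (w : C) : C := (- (1 / 8)%R * ((1 + w) / (1 - w)) * ((1 + w) / (1 - w)))%C.

Lemma one_minus_neq_0 w : Cmod w < 1 -> (1 - w)%C <> 0%C.
Proof. intros H; apply Cminus_neq; intros <-; rewrite Cmod_1 in H; lra. Qed.

Lemma cder_slit_chart w : Cmod w < 1 -> cder slit_chart w.
Proof.
intros H.
assert (K : cder (fun w => (1 + w) / (1 - w))%C w).
{ apply cder_mult; [apply cder_plus; [apply cder_const|apply cder_id]|].
  apply cder_inv; [apply cder_minus; [apply cder_const|apply cder_id]|now apply one_minus_neq_0]. }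
unfold slit_chart; apply cder_mult; [apply cder_mult; [apply cder_const|]|]; exact K.
Qed.

Lemma Cmod_lt_1 (a b : R) : Cmod (a, b) < 1 -> a ^ 2 + b ^ 2 < 1.
Proof.
intros H; pose proof (Cmod_ge_0 (a, b)) as P.
assert (E := Cmod2_alt (a, b)); unfold Re, Im in E; simpl in E |- *; nra.
Qed.

Lemma slit_chart_in w : Cmod w < 1 -> slit_plane (slit_chart w).
Proof.
intros H; assert (N := one_minus_neq_0 w H).
assert (HR : 0 < Re ((1 + w) / (1 - w))%C).
{ destruct w as [a b]; apply Cmod_lt_1 in H.
  unfold Re; simpl.
  assert (D : 0 < (1 - a) ^ 2 + b ^ 2) by nra.
  match goal with |- 0 < ?e => replace e with ((1 - a ^ 2 - b ^ 2) / ((1 - a) ^ 2 + b ^ 2)) end.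
  - apply Rdiv_lt_0_compat; lra.
  - field; repeat split; lra. }
unfold slit_chart; destruct ((1 + w) / (1 - w))%C as [p q]; unfold Re in HR; simpl in HR.
unfold slit_plane, Re, Im; simpl; intros [E1 E2].
assert (p * q = 0) by nra.
assert (q = 0) by (apply Rmult_integral in H0; lra).
subst; nra.
Qed.

Lemma sqrt_right_half_plane (x y : R) : ~ (y = 0 /\ x <= 0) ->
  exists v : C, 0 < Re v /\ (v * v = (x, y))%C.
Proof.
intros H; set (m := sqrt (x ^ 2 + y ^ 2)).
assert (Hm : m ^ 2 = x ^ 2 + y ^ 2) by (apply pow2_sqrt; nra).
assert (M0 : 0 <= m) by apply sqrt_pos.
assert (P : 0 < m + x).
{ destruct (Rle_dec x 0) as [L|L]; [|lra].
  assert (y <> 0) by (intros E; now apply H).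
  assert (0 < y ^ 2) by (apply pow2_gt_0; assumption).
  nra. }
set (al := sqrt ((m + x) / 2)).
assert (A0 : 0 < al) by (apply sqrt_lt_R0; lra).
assert (A2 : al * al = (m + x) / 2) by (apply sqrt_sqrt; lra).
exists (al, y / (2 * al)); split; [exact A0|].
apply injective_projections; simpl; [|field; lra].
transitivity (al * al - y ^ 2 / (4 * (al * al))); [field; lra|].
rewrite A2; replace (y ^ 2) with (m ^ 2 - x ^ 2) by lra; field; lra.
Qed.

Lemma slit_chart_onto z : slit_plane z -> exists w, Cmod w < 1 /\ slit_chart w = z.
Proof.
destruct z as [x y]; unfold slit_plane, Re, Im; simpl; intros H.
destruct (sqrt_right_half_plane (- 8 * x) (- 8 * y)) as [v [V1 V2]]; [intros [E1 E2]; apply H; lra|].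
assert (N : (v + 1)%C <> 0%C).
{ intros E; apply (f_equal fst) in E; simpl in E; unfold Re in V1; lra. }
exists ((v - 1) / (v + 1))%C; split.
- rewrite Cmod_div by exact N.
  apply (Rmult_lt_reg_r (Cmod (v + 1))); [now apply Cmod_gt_0|].
  unfold Rdiv; rewrite Rmult_assoc, Rinv_l, Rmult_1_l, Rmult_1_r by (apply Rgt_not_eq; now apply Cmod_gt_0).
  unfold Cmod; apply sqrt_lt_1_alt; destruct v as [a b]; unfold Re in V1; simpl in *; split; [|nra].
  apply Rplus_le_le_0_compat; apply (pow2_ge_0 (_ + _)).
- unfold slit_chart.
  assert (E : ((1 + (v - 1) / (v + 1)) / (1 - (v - 1) / (v + 1)) = v)%C).
  { field; split; [exact N|].
    replace (v + 1 - (v - 1))%C with (RtoC 2) by (apply injective_projections; simpl; ring).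
    intros E; apply (f_equal fst) in E; simpl in E; lra. }
  rewrite E, <- Cmult_assoc, V2; apply injective_projections; simpl; field.
Qed.

Lemma slit_identity (f : C -> C) : (forall z, slit_plane z -> cder f z) ->
  (forall h : R, -1/4 < h < 0 -> f (RtoC h) = 0%C) -> forall z, slit_plane z -> f z = 0%C.
Proof.
intros Hf Hz z Dz; destruct (slit_chart_onto z Dz) as [w [Hw <-]].
apply (disc_identity (fun w => f (slit_chart w)) (1 / 8)); [|lra| |exact Hw].
- intros u Hu; apply cder_comp; [now apply cder_slit_chart|]; now apply Hf, slit_chart_in.
- intros x Hx; apply Rabs_def2 in Hx.
  replace (slit_chart (RtoC x)) with (RtoC (- (1 / 8) * ((1 + x) / (1 - x)) ^ 2)).
  + apply Hz.
    (* For |x| < 1/8 the square of the quotient stays below 2, hence the image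
       above -1/4. *)
    assert (0 < (1 + x) / (1 - x) < 5 / 4 + 1 / 10).
    { split; [apply Rdiv_lt_0_compat; lra|].
      apply (Rmult_lt_reg_r (1 - x)); [lra|]; unfold Rdiv at 1; rewrite Rmult_assoc, Rinv_l; lra. }
    nra.
  + unfold slit_chart; apply injective_projections; simpl; field; nra.
Qed.

(** * Two elliptic integrals and their Picard-Fuchs system *)

Ltac smooth := apply (ex_derive_continuous (V := R_NormedModule)); auto_derive; easy.

Ltac real_eq := match goal with |- ?a = ?b => change (@eq R a b) end.

(** Differentiation under the integral sign with the partial derivative given
    by a formula rather than by [Derive]. *)
Lemma derive_under_integral (f df : R -> R -> R) (a b x : R) : a <= b ->
  locally x (fun u => forall t, a <= t <= b ->
     is_derive (fun z => f z t) u (df u t) /\ continuous (f u) t) ->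
  (forall t, a <= t <= b -> locally_2d (fun u v => is_derive (fun z => f z v) u (df u v)) x t) ->
  (forall t, a <= t <= b -> continuity_2d_pt df x t) ->
  is_derive (fun u => RInt (f u) a b) x (RInt (df x) a b).
Proof.
intros L H1 H2 H3.
assert (E : RInt (df x) a b = RInt (fun t => Derive (fun u => f u t) x) a b).
{ apply RInt_ext; rewrite Rmin_left, Rmax_right by lra; intros t Ht.
  symmetry; apply is_derive_unique; apply (locally_singleton _ _ H1); lra. }
rewrite E; apply is_derive_RInt_param; rewrite ?Rmin_left, ?Rmax_right by lra.
- generalize H1; apply filter_imp; intros u Hu t Ht; exists (df u t); now apply Hu.
- intros t Ht; apply (continuity_2d_pt_ext_loc df); [|now apply H3].
  destruct (H2 t Ht) as [d Hd]; exists d; intros u v Hu Hv.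
  symmetry; apply is_derive_unique; now apply Hd.
- generalize H1; apply filter_imp; intros u Hu.
  apply (ex_RInt_continuous (V := R_CompleteNormedModule)).
  rewrite Rmin_left, Rmax_right by lra; intros t Ht; now apply Hu.
Qed.

(** With x = 1 + 4 h these are the radicals that appear when the oval is folded
    into a quadrant, see [half_angle]. They are smooth for all x < 1, so
    the integrals below are defined also for x < 0, where there is no oval;
    those values give the integrals over the vanishing cycle. *)
Definition ellR (x th : R) : R := sqrt (1 - x * sin th ^ 2).
Definition ellQ (x th : R) : R := sqrt (1 + ellR x th).
Definition psi0 (x th : R) : R := x * cos th ^ 2 * ellQ x th / ellR x th.
Definition psi2 (x th : R) : R := x * cos th ^ 2 * ellQ x th.
(** The derivatives in x, simplified by x sin^2 = 1 - R^2 and R = Q^2 - 1. *)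
Definition dpsi0 (x th : R) : R := cos th ^ 2 * ellQ x th *
  (3 / 4 / ellR x th - / 4 / ellR x th ^ 2 + / 2 / ellR x th ^ 3).
Definition dpsi2 (x th : R) : R := cos th ^ 2 * ellQ x th * (5 / 4 - / 4 / ellR x th).

Lemma sin_sqr_bound th : 0 <= sin th ^ 2 <= 1.
Proof. split; [apply pow2_ge_0|]; pose proof (SIN_bound th); nra. Qed.

Lemma ell_radicand_pos x th : x < 1 -> 0 < 1 - x * sin th ^ 2.
Proof. intros H; pose proof (sin_sqr_bound th); destruct (Rle_dec x 0); nra. Qed.

Lemma ellR_pos x th : x < 1 -> 0 < ellR x th.
Proof. intros H; apply sqrt_lt_R0; now apply ell_radicand_pos. Qed.

Lemma ellQ_pos x th : x < 1 -> 0 < ellQ x th.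
Proof. intros H; apply sqrt_lt_R0; pose proof (ellR_pos x th H); lra. Qed.

Lemma ellR_sqr x th : x < 1 -> ellR x th ^ 2 = 1 - x * sin th ^ 2.
Proof. intros H; apply pow2_sqrt, Rlt_le; now apply ell_radicand_pos. Qed.

Lemma ellQ_sqr x th : x < 1 -> ellQ x th ^ 2 = 1 + ellR x th.
Proof. intros H; apply pow2_sqrt; pose proof (ellR_pos x th H); lra. Qed.

Lemma is_derive_sqrt_comp (f : R -> R) x l : is_derive f x l -> 0 < f x ->
  is_derive (fun z => sqrt (f z)) x (l / (2 * sqrt (f x))).
Proof.
intros H P; evar_last.
- apply (is_derive_comp sqrt f); [|exact H].
  apply is_derive_Reals, derivable_pt_lim_sqrt, P.
- reflexivity.
Qed.

Lemma is_derive_ellR x th : x < 1 ->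
  is_derive (fun z => ellR z th) x (- sin th ^ 2 / (2 * ellR x th)).
Proof.
intros H; apply (is_derive_sqrt_comp (fun z => 1 - z * sin th ^ 2)); [|now apply ell_radicand_pos].
auto_derive; [easy|ring].
Qed.

Lemma is_derive_ellQ x th : x < 1 ->
  is_derive (fun z => ellQ z th) x (- sin th ^ 2 / (4 * ellR x th * ellQ x th)).
Proof.
intros H; pose proof (ellR_pos x th H) as HR; pose proof (ellQ_pos x th H) as HQ.
evar_last.
- apply (is_derive_sqrt_comp (fun z => 1 + ellR z th)); [|lra].
  apply (is_derive_plus (fun _ => 1)); [apply is_derive_const|now apply is_derive_ellR].
- unfold plus, zero; simpl; fold (ellQ x th); field; lra.
Qed.

Ltac rewrite_derive := repeat match goal with
  | H : is_derive ?f ?x ?l |- context [Derive ?g ?x] =>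
    replace (Derive g x) with l by (symmetry; exact (is_derive_unique f x l H))
  end.

Lemma is_derive_psi0 x th : x < 1 -> is_derive (fun z => psi0 z th) x (dpsi0 x th).
Proof.
intros H; pose proof (ellR_pos x th H) as HR; pose proof (ellQ_pos x th H) as HQ.
pose proof (is_derive_ellR x th H) as DR; pose proof (is_derive_ellQ x th H) as DQ.
pose proof (ellR_sqr x th H) as E1; pose proof (ellQ_sqr x th H) as E2.
unfold psi0, dpsi0; auto_derive.
- repeat split; try (eexists; eassumption); lra.
- rewrite_derive.
  set (R1 := ellR x th) in *; set (Q1 := ellQ x th) in *; set (s2 := sin th ^ 2) in *; set (c2 := cos th ^ 2).
  transitivity (c2 * Q1 / R1 - c2 * (x * s2) / (4 * R1 ^ 2 * Q1) + c2 * Q1 * (x * s2) / (2 * R1 ^ 3)).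
  { unfold c2; field; lra. }
  replace (x * s2) with (1 - R1 ^ 2) by lra; replace R1 with (Q1 ^ 2 - 1) by lra.
  field; split; nra.
Qed.

Lemma is_derive_psi2 x th : x < 1 -> is_derive (fun z => psi2 z th) x (dpsi2 x th).
Proof.
intros H; pose proof (ellR_pos x th H) as HR; pose proof (ellQ_pos x th H) as HQ.
pose proof (is_derive_ellQ x th H) as DQ.
pose proof (ellR_sqr x th H) as E1; pose proof (ellQ_sqr x th H) as E2.
unfold psi2, dpsi2; auto_derive.
- eexists; eassumption.
- rewrite_derive.
  set (R1 := ellR x th) in *; set (Q1 := ellQ x th) in *; set (s2 := sin th ^ 2) in *; set (c2 := cos th ^ 2).
  transitivity (c2 * Q1 - c2 * (x * s2) / (4 * R1 * Q1)).
  { unfold c2; field; lra. }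
  replace (x * s2) with (1 - R1 ^ 2) by lra; replace R1 with (Q1 ^ 2 - 1) by lra.
  field; split; nra.
Qed.

Lemma c2d_ellR x th : x < 1 -> continuity_2d_pt ellR x th.
Proof.
intros H; unfold ellR.
apply (continuity_1d_2d_pt_comp sqrt (fun u v => 1 - u * sin v ^ 2)).
- apply continuity_pt_sqrt, Rlt_le; now apply ell_radicand_pos.
- apply continuity_2d_pt_minus; [apply continuity_2d_pt_const|].
  apply continuity_2d_pt_mult; [apply continuity_2d_pt_id1|].
  apply (continuity_1d_2d_pt_comp (fun v => sin v ^ 2) (fun u v => v)); [|apply continuity_2d_pt_id2].
  apply continuity_pt_filterlim; smooth.
Qed.

Lemma c2d_ellQ x th : x < 1 -> continuity_2d_pt ellQ x th.
Proof.
intros H; unfold ellQ; pose proof (ellR_pos x th H).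
apply (continuity_1d_2d_pt_comp sqrt (fun u v => 1 + ellR u v)).
- apply continuity_pt_sqrt; lra.
- apply continuity_2d_pt_plus; [apply continuity_2d_pt_const|now apply c2d_ellR].
Qed.

Lemma c2d_cos2 x th : continuity_2d_pt (fun u v => cos v ^ 2) x th.
Proof.
apply (continuity_1d_2d_pt_comp (fun v => cos v ^ 2) (fun u v => v)); [|apply continuity_2d_pt_id2].
apply continuity_pt_filterlim; smooth.
Qed.

Lemma c2d_pow f x y n : continuity_2d_pt f x y -> continuity_2d_pt (fun u v => f u v ^ n) x y.
Proof.
intros H; induction n as [|n IH]; simpl; [apply continuity_2d_pt_const|now apply continuity_2d_pt_mult].
Qed.

Lemma c2d_dpsi0 x th : x < 1 -> continuity_2d_pt dpsi0 x th.
Proof.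
intros H; pose proof (ellR_pos x th H); unfold dpsi0, Rdiv.
apply continuity_2d_pt_mult; [apply continuity_2d_pt_mult; [apply c2d_cos2|now apply c2d_ellQ]|].
apply continuity_2d_pt_plus; [apply continuity_2d_pt_minus|];
 (apply continuity_2d_pt_mult; [apply continuity_2d_pt_const|]);
 (apply continuity_2d_pt_inv; [try apply c2d_pow; now apply c2d_ellR|try apply pow_nonzero; lra]).
Qed.

Lemma c2d_dpsi2 x th : x < 1 -> continuity_2d_pt dpsi2 x th.
Proof.
intros H; pose proof (ellR_pos x th H); unfold dpsi2, Rdiv.
apply continuity_2d_pt_mult; [apply continuity_2d_pt_mult; [apply c2d_cos2|now apply c2d_ellQ]|].
apply continuity_2d_pt_minus; [apply continuity_2d_pt_const|].
apply continuity_2d_pt_mult; [apply continuity_2d_pt_const|].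
apply continuity_2d_pt_inv; [now apply c2d_ellR|lra].
Qed.

Lemma is_derive_ellR_th x th : x < 1 ->
  is_derive (ellR x) th (- x * sin th * cos th / ellR x th).
Proof.
intros H; pose proof (ellR_pos x th H) as HR; evar_last.
- apply (is_derive_sqrt_comp (fun z => 1 - x * sin z ^ 2)); [auto_derive; [easy|reflexivity]|now apply ell_radicand_pos].
- fold (ellR x th); simpl; field; lra.
Qed.

Lemma is_derive_ellQ_th x th : x < 1 ->
  is_derive (ellQ x) th (- x * sin th * cos th / (2 * ellR x th * ellQ x th)).
Proof.
intros H; pose proof (ellR_pos x th H) as HR; pose proof (ellQ_pos x th H) as HQ.
evar_last.
- apply (is_derive_sqrt_comp (fun z => 1 + ellR x z)); [|lra].
  apply (is_derive_plus (fun _ => 1)); [apply is_derive_const|now apply is_derive_ellR_th].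
- unfold plus, zero; simpl; fold (ellQ x th); field; lra.
Qed.

Lemma cont_of_c2d (f : R -> R -> R) x y : continuity_2d_pt f x y -> continuous (f x) y.
Proof.
intros H; apply (continuous_comp_2 (fun _ => x) (fun v => v) f).
- apply continuous_const.
- apply continuous_id.
- now apply continuity_2d_pt_filterlim.
Qed.

Lemma cont_ellR x th : x < 1 -> continuous (ellR x) th.
Proof. intros H; now apply cont_of_c2d, c2d_ellR. Qed.

Lemma cont_ellQ x th : x < 1 -> continuous (ellQ x) th.
Proof. intros H; now apply cont_of_c2d, c2d_ellQ. Qed.

Lemma cont_cos2 th : continuous (fun t => cos t ^ 2) th.
Proof. smooth. Qed.

Lemma cont_mult (f g : R -> R) x : continuous f x -> continuous g x -> continuous (fun t => f t * g t) x.
Proof. apply (continuous_mult (K := R_AbsRing)). Qed.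

Lemma cont_plus (f g : R -> R) x : continuous f x -> continuous g x -> continuous (fun t => f t + g t) x.
Proof. apply (continuous_plus (V := R_NormedModule)). Qed.

Lemma cont_minus (f g : R -> R) x : continuous f x -> continuous g x -> continuous (fun t => f t - g t) x.
Proof. apply (continuous_minus (V := R_NormedModule)). Qed.

Lemma cont_inv (f : R -> R) x : continuous f x -> f x <> 0 -> continuous (fun t => / f t) x.
Proof. apply continuous_Rinv_comp. Qed.

Lemma cont_pow (f : R -> R) x n : continuous f x -> continuous (fun t => f t ^ n) x.
Proof. intros H; induction n; simpl; [apply continuous_const|now apply cont_mult]. Qed.

Lemma cont_psi0 x th : x < 1 -> continuous (psi0 x) th.
Proof.
intros H; pose proof (ellR_pos x th H); unfold psi0, Rdiv.
apply cont_mult; [apply cont_mult; [apply cont_mult; [apply continuous_const|apply cont_cos2]|now apply cont_ellQ]|].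
apply cont_inv; [now apply cont_ellR|lra].
Qed.

Lemma cont_psi2 x th : x < 1 -> continuous (psi2 x) th.
Proof.
intros H; unfold psi2.
apply cont_mult; [apply cont_mult; [apply continuous_const|apply cont_cos2]|now apply cont_ellQ].
Qed.

Lemma cont_dpsi0 x th : x < 1 -> continuous (dpsi0 x) th.
Proof. intros H; now apply cont_of_c2d, c2d_dpsi0. Qed.

Lemma cont_dpsi2 x th : x < 1 -> continuous (dpsi2 x) th.
Proof. intros H; now apply cont_of_c2d, c2d_dpsi2. Qed.

Definition Psi0 (x : R) : R := RInt (psi0 x) 0 (PI / 2).
Definition Psi2 (x : R) : R := RInt (psi2 x) 0 (PI / 2).
Definition dPsi0 (x : R) : R := RInt (dpsi0 x) 0 (PI / 2).
Definition dPsi2 (x : R) : R := RInt (dpsi2 x) 0 (PI / 2).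

Lemma PI2_pos : 0 < PI / 2.
Proof. pose proof PI_RGT_0; lra. Qed.

Lemma locally_lt_1 x : x < 1 -> locally x (fun u => u < 1).
Proof. intros H; now apply (open_lt 1). Qed.

Lemma locally_2d_fst (P : R -> Prop) x t : locally x P -> locally_2d (fun u _ => P u) x t.
Proof. intros [d Hd]; exists d; intros u v Hu _; apply Hd, Hu. Qed.

Lemma is_derive_Psi0 x : x < 1 -> is_derive Psi0 x (dPsi0 x).
Proof.
intros H; apply (derive_under_integral psi0 dpsi0); [pose proof PI2_pos; lra|..].
- generalize (locally_lt_1 x H); apply filter_imp; intros u Hu t _.
  split; [now apply is_derive_psi0|now apply cont_psi0].
- intros t _; destruct (locally_2d_fst _ x t (locally_lt_1 x H)) as [d Hd]; exists d.
  intros u v Hu Hv; apply is_derive_psi0; exact (Hd u v Hu Hv).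
- intros t _; now apply c2d_dpsi0.
Qed.

Lemma is_derive_Psi2 x : x < 1 -> is_derive Psi2 x (dPsi2 x).
Proof.
intros H; apply (derive_under_integral psi2 dpsi2); [pose proof PI2_pos; lra|..].
- generalize (locally_lt_1 x H); apply filter_imp; intros u Hu t _.
  split; [now apply is_derive_psi2|now apply cont_psi2].
- intros t _; destruct (locally_2d_fst _ x t (locally_lt_1 x H)) as [d Hd]; exists d.
  intros u v Hu Hv; apply is_derive_psi2; exact (Hd u v Hu Hv).
- intros t _; now apply c2d_dpsi2.
Qed.

Lemma ex_RInt_cont (f : R -> R) a b : a <= b -> (forall t, a <= t <= b -> continuous f t) -> ex_RInt f a b.
Proof.
intros L H; apply (ex_RInt_continuous (V := R_CompleteNormedModule)).
rewrite Rmin_left, Rmax_right by lra; exact H.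
Qed.

Lemma RInt_ext_le (f g : R -> R) a b : a <= b -> (forall t, a <= t <= b -> f t = g t) ->
  RInt f a b = RInt g a b.
Proof.
intros L H; apply RInt_ext; rewrite Rmin_left, Rmax_right by lra.
intros t Ht; apply H; lra.
Qed.

Lemma cont_lin2 (p q : R) (f g : R -> R) x : continuous f x -> continuous g x ->
  continuous (fun t => p * f t + q * g t) x.
Proof.
intros Hf Hg; apply cont_plus; (apply cont_mult; [apply continuous_const|assumption]).
Qed.

Lemma RInt_lin2 (p q : R) (f g : R -> R) a b : ex_RInt f a b -> ex_RInt g a b ->
  RInt (fun t => p * f t + q * g t) a b = p * RInt f a b + q * RInt g a b.
Proof.
intros Hf Hg; apply is_RInt_unique.
apply (is_RInt_plus (V := R_NormedModule)); apply (is_RInt_scal (V := R_NormedModule));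
now apply (RInt_correct (V := R_CompleteNormedModule)).
Qed.

(** This equation holds already between the integrands. *)
Lemma Psi_eq2 x : x < 1 -> 4 * x * dPsi2 x = 5 * Psi2 x - Psi0 x.
Proof.
intros H; pose proof PI2_pos as HP.
assert (X0 : ex_RInt (psi0 x) 0 (PI / 2)) by (apply ex_RInt_cont; [lra|intros; now apply cont_psi0]).
assert (X2 : ex_RInt (psi2 x) 0 (PI / 2)) by (apply ex_RInt_cont; [lra|intros; now apply cont_psi2]).
assert (Y2 : ex_RInt (dpsi2 x) 0 (PI / 2)) by (apply ex_RInt_cont; [lra|intros; now apply cont_dpsi2]).
unfold dPsi2, Psi2, Psi0.
replace (4 * x * RInt (dpsi2 x) 0 (PI / 2)) with (4 * x * RInt (dpsi2 x) 0 (PI / 2) + 0 * RInt (dpsi2 x) 0 (PI / 2)) by ring.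
replace (5 * RInt (psi2 x) 0 (PI / 2) - RInt (psi0 x) 0 (PI / 2)) with (5 * RInt (psi2 x) 0 (PI / 2) + - 1 * RInt (psi0 x) 0 (PI / 2)) by ring.
rewrite <- !RInt_lin2 by assumption; apply RInt_ext_le; [lra|]; intros t _.
pose proof (ellR_pos x t H); unfold dpsi2, psi2, psi0; field; lra.
Qed.

(** It vanishes at 0 and at PI / 2, and its derivative in the angle is the
    difference of the two sides of the other equation under the integral
    sign. *)
Definition psi0_primitive (x th : R) : R := 2 * x * sin th * cos th ^ 3 / (ellR x th * ellQ x th).

Lemma is_derive_psi0_primitive x th : x < 1 -> is_derive (psi0_primitive x) th
  (4 * (x - 1) * dpsi0 x th - 3 * psi0 x th + 4 * dpsi2 x th).
Proof.
intros H; pose proof (ellR_pos x th H) as HR; pose proof (ellQ_pos x th H) as HQ.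
pose proof (is_derive_ellR_th x th H) as DR; pose proof (is_derive_ellQ_th x th H) as DQ.
pose proof (ellR_sqr x th H) as E1; pose proof (ellQ_sqr x th H) as E2.
unfold psi0_primitive; auto_derive.
- repeat split; try (eexists; eassumption); nra.
- rewrite_derive.
  unfold dpsi0, psi0, dpsi2.
  pose proof (sin2_cos2 th) as SC; unfold Rsqr in SC.
  set (R1 := ellR x th) in *; set (Q1 := ellQ x th) in *; set (s := sin th) in *; set (c := cos th) in *.
  assert (Es : x * s ^ 2 = 1 - R1 ^ 2) by lra.
  assert (Ec : x * c ^ 2 = x - 1 + R1 ^ 2) by nra.
  (* After this the sines and cosines occur only through x sin^2 = 1 - R^2
     and x cos^2 = x - 1 + R^2. *)
  transitivity (c ^ 2 * (2 * (x * c ^ 2) / (R1 * Q1) - 6 * (x * s ^ 2) / (R1 * Q1)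
     + 2 * (x * s ^ 2) * (x * c ^ 2) / (R1 ^ 3 * Q1) + (x * s ^ 2) * (x * c ^ 2) / (R1 ^ 2 * Q1 ^ 3))).
  { field; lra. }
  transitivity (c ^ 2 * Q1 * (5 - 4 / R1 + (1 - x) * (/ R1 ^ 2 - 2 / R1 ^ 3))); [|field; lra].
  rewrite Es, Ec; replace R1 with (Q1 ^ 2 - 1) by lra.
  field; split; nra.
Qed.

Lemma Psi_eq0 x : x < 1 -> 4 * (x - 1) * dPsi0 x = 3 * Psi0 x - 4 * dPsi2 x.
Proof.
intros H; pose proof PI2_pos as HP.
assert (X0 : ex_RInt (psi0 x) 0 (PI / 2)) by (apply ex_RInt_cont; [lra|intros; now apply cont_psi0]).
assert (Y0 : ex_RInt (dpsi0 x) 0 (PI / 2)) by (apply ex_RInt_cont; [lra|intros; now apply cont_dpsi0]).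
assert (Y2 : ex_RInt (dpsi2 x) 0 (PI / 2)) by (apply ex_RInt_cont; [lra|intros; now apply cont_dpsi2]).
assert (E : RInt (fun t => 1 * (4 * (x - 1) * dpsi0 x t + - 3 * psi0 x t) + 4 * dpsi2 x t) 0 (PI / 2) = 0).
{ apply is_RInt_unique.
  replace 0 with (minus (psi0_primitive x (PI / 2)) (psi0_primitive x 0)) at 2.
  - apply (is_RInt_derive (psi0_primitive x)); rewrite Rmin_left, Rmax_right by lra.
    + intros t _; evar_last; [now apply is_derive_psi0_primitive|simpl; ring].
    + intros t _; apply (cont_lin2 1 4 (fun t => 4 * (x - 1) * dpsi0 x t + - 3 * psi0 x t) (dpsi2 x)); [|now apply cont_dpsi2].
      apply cont_lin2; [now apply cont_dpsi0|now apply cont_psi0].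
  - unfold psi0_primitive, minus, plus, opp; simpl; rewrite cos_PI2, sin_0; unfold Rdiv; ring. }
rewrite (RInt_lin2 1 4 (fun t => 4 * (x - 1) * dpsi0 x t + - 3 * psi0 x t) (dpsi2 x)) in E; [|clear E|assumption].
- rewrite (RInt_lin2 _ _ (dpsi0 x) (psi0 x)) in E by assumption.
  unfold dPsi0, Psi0, dPsi2; lra.
- apply ex_RInt_cont; [lra|]; intros t _; apply cont_lin2; [now apply cont_dpsi0|now apply cont_psi0].
Qed.

(** * The integrals over the oval *)

Lemma nondecreasing_of_derive (f df : R -> R) u v : u <= v ->
  (forall t, u <= t <= v -> is_derive f t (df t)) -> (forall t, u <= t <= v -> 0 <= df t) ->
  f u <= f v.
Proof.
intros L D P.
destruct (MVT_gen f u v df) as [c [Hc E]].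
- rewrite Rmin_left, Rmax_right by lra; intros t Ht; apply D; lra.
- rewrite Rmin_left, Rmax_right by lra; intros t Ht; apply continuity_pt_filterlim.
  apply (ex_derive_continuous (V := R_NormedModule)); exists (df t); apply D; lra.
- rewrite Rmin_left, Rmax_right in Hc by lra; specialize (P c Hc).
  assert (0 <= df c * (v - u)) by (apply Rmult_le_pos; lra); lra.
Qed.

Lemma RInt_shift (F : R -> R) c d : (forall t, continuous F t) ->
  RInt F c (c + d) = RInt (fun y => F (c + y)) 0 d.
Proof.
intros H.
assert (E := RInt_comp_lin (V := R_CompleteNormedModule) F 1 c 0 d).
replace (1 * 0 + c) with c in E by ring; replace (1 * d + c) with (c + d) in E by ring.
rewrite <- E by (apply (ex_RInt_continuous (V := R_CompleteNormedModule)); intros; apply H).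
apply RInt_ext; intros y _; unfold scal; simpl; unfold mult; simpl.
replace (1 * y + c) with (c + y) by ring; apply Rmult_1_l.
Qed.

Lemma RInt_reflect (F : R -> R) c d : (forall t, continuous F t) ->
  RInt F (c - d) c = RInt (fun y => F (c - y)) 0 d.
Proof.
intros H.
assert (E := RInt_comp_lin (V := R_CompleteNormedModule) F (-1) c 0 d).
replace (-1 * 0 + c) with c in E by ring; replace (-1 * d + c) with (c - d) in E by ring.
rewrite <- (opp_RInt_swap (V := R_CompleteNormedModule)) by (apply (ex_RInt_continuous (V := R_CompleteNormedModule)); intros; apply H).
rewrite <- E by (apply (ex_RInt_continuous (V := R_CompleteNormedModule)); intros; apply H).
rewrite <- (RInt_opp (V := R_CompleteNormedModule)).
- apply RInt_ext; intros y _; unfold scal, opp; simpl; unfold mult; simpl.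
  replace (-1 * y + c) with (c - y) by ring; ring.
- apply (ex_RInt_continuous (V := R_CompleteNormedModule)); intros y _.
  apply cont_mult; [apply continuous_const|].
  apply (continuous_comp (fun y => -1 * y + c) F); [|apply H].
  smooth.
Qed.

(** The four angles at which cos t takes one of the values sin th, - sin th are
    brought together, with th between 0 and PI / 2. *)
Lemma RInt_fold (k : R -> R) : (forall t, continuous (fun t => k (cos t)) t) ->
  RInt (fun t => sin t ^ 2 * k (cos t)) 0 (2 * PI) =
  RInt (fun th => 2 * cos th ^ 2 * (k (sin th) + k (- sin th))) 0 (PI / 2).
Proof.
intros H; set (F := fun t => sin t ^ 2 * k (cos t)); pose proof PI2_pos as HP.
assert (HF : forall t, continuous F t).
{ intros t; apply cont_mult; [|apply H].
  smooth. }
assert (EF : forall a b, ex_RInt F a b).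
{ intros; apply (ex_RInt_continuous (V := R_CompleteNormedModule)); intros; apply HF. }
assert (CH : forall a b c, RInt F a c = RInt F a b + RInt F b c).
{ intros a b c; symmetry; now apply (RInt_Chasles (V := R_CompleteNormedModule)). }
rewrite (CH 0 PI (2 * PI)), (CH 0 (PI / 2) PI), (CH PI (3 * (PI / 2)) (2 * PI)).
assert (E1 := RInt_reflect F (PI / 2) (PI / 2) HF).
assert (E2 := RInt_shift F (PI / 2) (PI / 2) HF).
assert (E3 := RInt_reflect F (3 * (PI / 2)) (PI / 2) HF).
assert (E4 := RInt_shift F (3 * (PI / 2)) (PI / 2) HF).
replace (PI / 2 - PI / 2) with 0 in E1 by ring.
replace (PI / 2 + PI / 2) with PI in E2 by field.
replace (3 * (PI / 2) - PI / 2) with PI in E3 by field.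
replace (3 * (PI / 2) + PI / 2) with (2 * PI) in E4 by field.
rewrite E1, E2, E3, E4; clear E1 E2 E3 E4.
set (kp := fun th => cos th ^ 2 * k (sin th)); set (km := fun th => cos th ^ 2 * k (- sin th)).
assert (Q1 : forall y, F (PI / 2 - y) = kp y).
{ intros y; unfold F, kp; now rewrite cos_shift, sin_shift. }
assert (Q2 : forall y, F (PI / 2 + y) = km y).
{ intros y; unfold F, km; rewrite sin_plus, cos_plus, sin_PI2, cos_PI2.
  f_equal; [ring|f_equal; ring]. }
assert (C3 : cos (3 * (PI / 2)) = 0) by (apply cos_3PI2).
assert (S3 : sin (3 * (PI / 2)) = -1) by (apply sin_3PI2).
assert (Q3 : forall y, F (3 * (PI / 2) - y) = km y).
{ intros y; unfold F, km; rewrite sin_minus, cos_minus, C3, S3.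
  f_equal; [ring|f_equal; ring]. }
assert (Q4 : forall y, F (3 * (PI / 2) + y) = kp y).
{ intros y; unfold F, kp; rewrite sin_plus, cos_plus, C3, S3.
  f_equal; [ring|f_equal; ring]. }
assert (CS : forall p, continuous (fun y => p + y) 0 /\ forall t, continuous (fun y => p + y) t).
{ intros p; split; [|intros t]; smooth. }
assert (Xp : ex_RInt kp 0 (PI / 2)).
{ apply ex_RInt_cont; [lra|]; intros t _.
  apply (continuous_ext (fun y => F (3 * (PI / 2) + y))); [apply Q4|].
  apply (continuous_comp (fun y => 3 * (PI / 2) + y) F); [apply CS|apply HF]. }
assert (Xm : ex_RInt km 0 (PI / 2)).
{ apply ex_RInt_cont; [lra|]; intros t _.
  apply (continuous_ext (fun y => F (PI / 2 + y))); [apply Q2|].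
  apply (continuous_comp (fun y => PI / 2 + y) F); [apply CS|apply HF]. }
rewrite (RInt_ext_le (fun y => F (PI / 2 - y)) kp), (RInt_ext_le (fun y => F (PI / 2 + y)) km),
  (RInt_ext_le (fun y => F (3 * (PI / 2) - y)) km), (RInt_ext_le (fun y => F (3 * (PI / 2) + y)) kp)
  by (first [lra|intros; first [apply Q1|apply Q2|apply Q3|apply Q4]]).
transitivity (RInt (fun th => 2 * kp th + 2 * km th) 0 (PI / 2)).
- rewrite RInt_lin2 by assumption; match goal with |- ?a = ?b => change (@eq R a b) end; ring.
- apply RInt_ext_le; [lra|]; intros; unfold kp, km; ring.
Qed.

Section Oval.

Variables s h : R.
Hypotheses (Hs : s = 1 \/ s = -1) (Hh : -1/4 < h < 0).

Let r := sqrt (1 + 4 * h).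
Let rb := r_bounds h Hh.
Let rq : r * r = 1 + 4 * h := r_sqr h Hh.

Lemma oval_rad y : -1 <= y <= 1 -> 0 < 1 + r * y.
Proof. intros H; assert (B : 0 < r < 1) by exact rb; nra. Qed.

Lemma oval_x_derive t :
  is_derive (oval_x s h) t (s * (- r * sin t / (2 * sqrt (1 + r * cos t)))).
Proof.
assert (P := oval_rad (cos t) (COS_bound t)).
assert (D : is_derive (fun t => sqrt (1 + r * cos t)) t (- r * sin t / (2 * sqrt (1 + r * cos t)))).
{ apply (is_derive_sqrt_comp (fun t => 1 + r * cos t)); [|exact P]; auto_derive; [easy|ring]. }
exact (is_derive_scal (fun t => sqrt (1 + r * cos t)) t s _ D).
Qed.

Lemma cont_sqrt_cos t : continuous (fun t => sqrt (1 + r * cos t)) t.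
Proof.
assert (P := oval_rad (cos t) (COS_bound t)).
apply (ex_derive_continuous (V := R_NormedModule)); eexists.
apply (is_derive_sqrt_comp (fun t => 1 + r * cos t)); [|exact P]; auto_derive; [easy|reflexivity].
Qed.

(** The radicals at two folded points have a product free of the square root r
    of x = 1 + 4 h, and a sum that is, up to sqrt 2, a nested radical free
    of r. *)
Lemma half_angle th :
  let p := sqrt (1 + r * sin th) in let m := sqrt (1 + r * - sin th) in
  0 < p /\ 0 < m /\ p + m = sqrt 2 * ellQ (1 + 4 * h) th /\ p * m = ellR (1 + 4 * h) th.
Proof.
intros p m.
assert (P := oval_rad (sin th) (SIN_bound th)).
assert (M : 0 < 1 + r * - sin th) by (apply oval_rad; pose proof (SIN_bound th); lra).
assert (p0 : 0 < p) by (now apply sqrt_lt_R0); assert (m0 : 0 < m) by (now apply sqrt_lt_R0).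
assert (E : p * m = ellR (1 + 4 * h) th).
{ unfold p, m, ellR; rewrite <- sqrt_mult by lra; f_equal; rewrite <- rq; ring. }
repeat split; try assumption.
unfold ellQ; rewrite <- E, <- sqrt_mult by nra.
symmetry; apply sqrt_lem_1; [nra|lra|].
assert (p * p = 1 + r * sin th) by (apply sqrt_sqrt; lra).
assert (m * m = 1 + r * - sin th) by (apply sqrt_sqrt; lra).
nra.
Qed.

Lemma oint_Psi0 : oint s 0 h = Psi0 (1 + 4 * h).
Proof.
assert (Q2 : 0 < sqrt 2) by (apply sqrt_lt_R0; lra).
assert (Q22 : sqrt 2 * sqrt 2 = 2) by (apply sqrt_sqrt; lra).
set (k := fun y => (1 + 4 * h) / (2 * sqrt 2) * / sqrt (1 + r * y)).
transitivity (RInt (fun t => sin t ^ 2 * k (cos t)) 0 (2 * PI)).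
- apply RInt_ext_le; [pose proof PI_RGT_0; lra|]; intros t _.
  rewrite (is_derive_unique _ _ _ (oval_x_derive t)).
  assert (P := sqrt_lt_R0 _ (oval_rad (cos t) (COS_bound t))).
  unfold k, oval_y; fold r; rewrite <- rq.
  transitivity (s * s * (sin t ^ 2 * (r * r / (2 * sqrt 2) * / sqrt (1 + r * cos t)))); [field; lra|].
  rewrite (s_sqr s Hs); ring.
- rewrite RInt_fold.
  + apply RInt_ext_le; [pose proof PI2_pos; lra|]; intros th _.
    destruct (half_angle th) as (p0 & m0 & S1 & S2).
    unfold k, psi0; set (p := sqrt (1 + r * sin th)) in *; set (m := sqrt (1 + r * - sin th)) in *.
    rewrite <- S2.
    replace (ellQ (1 + 4 * h) th) with ((p + m) / sqrt 2) by (rewrite S1; field; lra).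
    field; lra.
  + intros t; apply cont_mult; [apply continuous_const|].
    apply (cont_inv (fun t => sqrt (1 + r * cos t))); [apply cont_sqrt_cos|].
    apply Rgt_not_eq, sqrt_lt_R0, oval_rad, COS_bound.
Qed.

Lemma oint_Psi2 : oint s 2 h = Psi2 (1 + 4 * h).
Proof.
assert (Q2 : 0 < sqrt 2) by (apply sqrt_lt_R0; lra).
assert (Q22 : sqrt 2 * sqrt 2 = 2) by (apply sqrt_sqrt; lra).
set (k := fun y => (1 + 4 * h) / (2 * sqrt 2) * sqrt (1 + r * y)).
transitivity (RInt (fun t => sin t ^ 2 * k (cos t)) 0 (2 * PI)).
- apply RInt_ext_le; [pose proof PI_RGT_0; lra|]; intros t _.
  rewrite (is_derive_unique _ _ _ (oval_x_derive t)).
  assert (P := sqrt_lt_R0 _ (oval_rad (cos t) (COS_bound t))).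
  unfold k, oval_y, oval_x; fold r; rewrite <- rq.
  transitivity ((s * s) * (s * s) * (sin t ^ 2 * (r * r / (2 * sqrt 2) * sqrt (1 + r * cos t)))); [field; lra|].
  rewrite (s_sqr s Hs); ring.
- rewrite RInt_fold.
  + apply RInt_ext_le; [pose proof PI2_pos; lra|]; intros th _.
    destruct (half_angle th) as (p0 & m0 & S1 & S2).
    unfold k, psi2; set (p := sqrt (1 + r * sin th)) in *; set (m := sqrt (1 + r * - sin th)) in *.
    replace (ellQ (1 + 4 * h) th) with ((p + m) / sqrt 2) by (rewrite S1; field; lra).
    field; lra.
  + intros t; apply cont_mult; [apply continuous_const|apply cont_sqrt_cos].
Qed.

(** Since x dx = d(x^2) / 2, the radical disappears and the integral is linear
    in 1 + 4 h. *)
Lemma oint_1 : oint s 1 h = (1 + 4 * h) * RInt (fun t => s / (2 * sqrt 2) * sin t ^ 2) 0 (2 * PI).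
Proof.
assert (Q2 : 0 < sqrt 2) by (apply sqrt_lt_R0; lra).
transitivity (RInt (fun t => (1 + 4 * h) * (s / (2 * sqrt 2) * sin t ^ 2)) 0 (2 * PI)).
- apply RInt_ext_le; [pose proof PI_RGT_0; lra|]; intros t _.
  rewrite (is_derive_unique _ _ _ (oval_x_derive t)).
  assert (P := sqrt_lt_R0 _ (oval_rad (cos t) (COS_bound t))).
  unfold oval_y, oval_x; fold r; rewrite <- rq.
  transitivity (s * s * (r * r * (s / (2 * sqrt 2) * sin t ^ 2))); [field; lra|].
  rewrite (s_sqr s Hs); ring.
- apply (RInt_scal (V := R_CompleteNormedModule)), (ex_RInt_continuous (V := R_CompleteNormedModule)).
  intros t _; smooth.
Qed.

End Oval.

(** * The integrals over the cycle vanishing at the saddle *)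

(** The reflection of zeta = 1 + 4 t into 1 - zeta = - 4 t exchanges the centre
    and the saddle. The functions [cyc0] and - [cyc2] of the level t
    satisfy the same system as I_0 and I_2, and vanish at the saddle t = 0:
    up to a common factor they are the integrals over the vanishing cycle.
    The signs make both nonnegative. *)
Definition cyc0 (t : R) : R := - Psi0 (- 4 * t) / 2.
Definition cyc2 (t : R) : R := (Psi0 (- 4 * t) - Psi2 (- 4 * t)) / 2.
Definition dcyc0 (t : R) : R := 2 * dPsi0 (- 4 * t).
Definition dcyc2 (t : R) : R := 2 * (dPsi2 (- 4 * t) - dPsi0 (- 4 * t)).

Lemma is_derive_cyc0 t : -1/4 < t -> is_derive cyc0 t (dcyc0 t).
Proof.
intros H; assert (D0 := is_derive_Psi0 (- 4 * t) ltac:(lra)).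
unfold cyc0, dcyc0; auto_derive; [eexists; exact D0|].
rewrite_derive.
field.
Qed.

Lemma is_derive_cyc2 t : -1/4 < t -> is_derive cyc2 t (dcyc2 t).
Proof.
intros H; assert (D0 := is_derive_Psi0 (- 4 * t) ltac:(lra)).
assert (D2 := is_derive_Psi2 (- 4 * t) ltac:(lra)).
unfold cyc2, dcyc2; auto_derive; [split; [eexists; exact D0|split; [eexists; exact D2|easy]]|].
rewrite_derive.
field.
Qed.

Lemma cyc0_ode t : -1/4 < t -> 4 * t * dcyc0 t = 3 * cyc0 t + dcyc2 t.
Proof.
intros H; assert (E0 := Psi_eq0 (- 4 * t) ltac:(lra)); assert (E2 := Psi_eq2 (- 4 * t) ltac:(lra)).
unfold dcyc0, dcyc2, cyc0; lra.
Qed.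

Lemma cyc2_ode t : -1/4 < t -> (4 * t + 1) * dcyc2 t = cyc0 t + 5 * cyc2 t.
Proof.
intros H; assert (E0 := Psi_eq0 (- 4 * t) ltac:(lra)); assert (E2 := Psi_eq2 (- 4 * t) ltac:(lra)).
unfold dcyc2, cyc0, cyc2; lra.
Qed.

Lemma cyc0_at_0 : cyc0 0 = 0.
Proof.
unfold cyc0, Psi0; rewrite (RInt_ext_le _ (fun _ => 0)); [|pose proof PI2_pos; lra|].
- rewrite RInt_const; unfold scal; simpl; unfold mult; simpl; field.
- intros; unfold psi0, Rdiv; ring.
Qed.

Lemma cyc2_at_0 : cyc2 0 = 0.
Proof.
assert (E := cyc0_at_0); unfold cyc0 in E; unfold cyc2.
replace (Psi2 (- 4 * 0)) with 0; [lra|].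
unfold Psi2; rewrite (RInt_ext_le _ (fun _ => 0)); [|pose proof PI2_pos; lra|].
- rewrite RInt_const; unfold scal; simpl; unfold mult; simpl; ring.
- intros; unfold psi2; ring.
Qed.

Definition cyc0_density (t th : R) : R := 2 * t * cos th ^ 2 * ellQ (- 4 * t) th / ellR (- 4 * t) th.

Lemma cyc0_density_cont t th : 0 <= t -> continuous (cyc0_density t) th.
Proof.
intros H.
apply (continuous_ext (fun th => - / 2 * psi0 (- 4 * t) th)); [|apply cont_mult; [apply continuous_const|apply cont_psi0; lra]].
intros u; unfold psi0, cyc0_density; pose proof (ellR_pos (- 4 * t) u ltac:(lra)); real_eq; field; lra.
Qed.

Lemma cyc0_RInt t : 0 <= t -> cyc0 t = RInt (cyc0_density t) 0 (PI / 2).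
Proof.
intros H; pose proof PI2_pos as HP.
assert (X0 : ex_RInt (psi0 (- 4 * t)) 0 (PI / 2)) by (apply ex_RInt_cont; [lra|intros; apply cont_psi0; lra]).
unfold cyc0, Psi0.
transitivity (- / 2 * RInt (psi0 (- 4 * t)) 0 (PI / 2) + 0 * RInt (psi0 (- 4 * t)) 0 (PI / 2)); [field|].
rewrite <- RInt_lin2 by assumption; apply RInt_ext_le; [lra|]; intros u _.
unfold psi0, cyc0_density; pose proof (ellR_pos (- 4 * t) u ltac:(lra)); field; lra.
Qed.

Definition cyc2_density (t th : R) : R := cyc0_density t th * (ellR (- 4 * t) th - 1).

Lemma cyc2_density_cont t th : 0 <= t -> continuous (cyc2_density t) th.
Proof.
intros H; apply cont_mult; [now apply cyc0_density_cont|].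
apply cont_minus; [apply cont_ellR; lra|apply continuous_const].
Qed.

Lemma cyc2_RInt t : 0 <= t -> cyc2 t = RInt (cyc2_density t) 0 (PI / 2).
Proof.
intros H; pose proof PI2_pos as HP.
assert (X0 : ex_RInt (psi0 (- 4 * t)) 0 (PI / 2)) by (apply ex_RInt_cont; [lra|intros; apply cont_psi0; lra]).
assert (X2 : ex_RInt (psi2 (- 4 * t)) 0 (PI / 2)) by (apply ex_RInt_cont; [lra|intros; apply cont_psi2; lra]).
unfold cyc2, Psi0, Psi2.
transitivity (/ 2 * RInt (psi0 (- 4 * t)) 0 (PI / 2) + - / 2 * RInt (psi2 (- 4 * t)) 0 (PI / 2)); [field|].
rewrite <- RInt_lin2 by assumption; apply RInt_ext_le; [lra|]; intros u _.
unfold psi0, psi2, cyc2_density, cyc0_density; pose proof (ellR_pos (- 4 * t) u ltac:(lra)); field; lra.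
Qed.

Lemma cos_bounds th : 0 <= th <= PI / 2 -> 0 <= cos th <= 1.
Proof.
intros H; split; [apply cos_ge_0; lra|]; pose proof (COS_bound th); lra.
Qed.

Lemma sin_bounds th : 0 <= th <= PI / 2 -> 0 <= sin th <= 1.
Proof.
intros H; pose proof PI_RGT_0; split; [apply sin_ge_0; lra|]; pose proof (SIN_bound th); lra.
Qed.

Lemma ellR_bounds t th : 0 <= t -> 1 <= ellR (- 4 * t) th <= 1 + 2 * t.
Proof.
intros H; pose proof (ellR_pos (- 4 * t) th ltac:(lra)) as P; pose proof (ellR_sqr (- 4 * t) th ltac:(lra)) as E.
pose proof (sin_sqr_bound th); split; nra.
Qed.

Lemma cyc0_pos t : 0 < t -> 0 < cyc0 t.
Proof.
intros H; rewrite cyc0_RInt by lra; apply RInt_gt_0; [apply PI2_pos| |intros; apply cyc0_density_cont; lra].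
intros th Hth; unfold cyc0_density.
assert (0 < cos th) by (apply cos_gt_0; lra).
pose proof (ellR_pos (- 4 * t) th ltac:(lra)); pose proof (ellQ_pos (- 4 * t) th ltac:(lra)).
apply Rdiv_lt_0_compat; [|assumption].
apply Rmult_lt_0_compat; [apply Rmult_lt_0_compat; [lra|now apply pow_lt]|assumption].
Qed.

Lemma cyc0_density_nonneg t th : 0 <= t -> 0 <= cyc0_density t th.
Proof.
intros H; unfold cyc0_density.
pose proof (ellR_pos (- 4 * t) th ltac:(lra)); pose proof (ellQ_pos (- 4 * t) th ltac:(lra)).
apply Rmult_le_pos; [|left; now apply Rinv_0_lt_compat].
apply Rmult_le_pos; [apply Rmult_le_pos; [lra|apply pow2_ge_0]|lra].
Qed.

Lemma ex_RInt_cyc0_density t : 0 <= t -> ex_RInt (cyc0_density t) 0 (PI / 2).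
Proof. intros H; pose proof PI2_pos; apply ex_RInt_cont; [lra|intros; now apply cyc0_density_cont]. Qed.

(** Under the integral the two densities differ by the factor R - 1, which lies
    between 0 and 2 t. *)
Lemma cyc2_bounds t : 0 <= t -> 0 <= cyc2 t <= 2 * t * cyc0 t.
Proof.
intros H; pose proof PI2_pos as HP; rewrite cyc2_RInt, cyc0_RInt by exact H.
assert (Xb : ex_RInt (cyc2_density t) 0 (PI / 2)) by (apply ex_RInt_cont; [lra|intros; now apply cyc2_density_cont]).
assert (Xa := ex_RInt_cyc0_density t H).
split.
- apply RInt_ge_0; [lra|exact Xb|]; intros th _; apply Rmult_le_pos; [now apply cyc0_density_nonneg|].
  pose proof (ellR_bounds t th H); lra.
- transitivity (RInt (fun th => 2 * t * cyc0_density t th + 0 * cyc0_density t th) 0 (PI / 2)); [|right; rewrite RInt_lin2 by assumption; ring].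
  apply RInt_le; [lra|exact Xb| |].
  + apply ex_RInt_cont; [lra|intros; apply cont_lin2; now apply cyc0_density_cont].
  + intros th _; unfold cyc2_density; pose proof (cyc0_density_nonneg t th H); pose proof (ellR_bounds t th H); nra.
Qed.

Lemma cyc0_linear_bound t : 0 <= t -> cyc0 t <= 8 * t.
Proof.
intros H; pose proof PI2_pos as HP; rewrite cyc0_RInt by exact H.
apply Rle_trans with (RInt (fun _ => 4 * t) 0 (PI / 2)).
- apply RInt_le; [lra|now apply ex_RInt_cyc0_density|apply ex_RInt_const|].
  intros th Hth; unfold cyc0_density; pose proof (cos_bounds th ltac:(lra)) as Cb.
  pose proof (ellR_bounds t th H) as RB; pose proof (ellQ_pos (- 4 * t) th ltac:(lra)) as QP.
  pose proof (ellQ_sqr (- 4 * t) th ltac:(lra)) as QS.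
  set (R1 := ellR (- 4 * t) th) in *; set (Q1 := ellQ (- 4 * t) th) in *.
  assert (Q1 <= 2 * R1) by nra.
  assert (0 <= cos th ^ 2 <= 1) by (split; [apply pow2_ge_0|nra]).
  apply (Rmult_le_reg_r R1); [lra|]; unfold Rdiv; rewrite Rmult_assoc, Rinv_l, Rmult_1_r by lra.
  assert (cos th ^ 2 * Q1 <= 1 * (2 * R1)) by (apply Rmult_le_compat; lra).
  nra.
- rewrite RInt_const; unfold scal; simpl; unfold mult; simpl; pose proof PI_4; nra.
Qed.

(** The growth t^(3/4) at infinity, which makes the Cauchy integrals below
    converge. The integrand is compared with the derivative of 8 t / T sqrt
    (1 + T sin th), where T = 2 sqrt t, using 2 R >= 1 + T sin th. *)
Lemma cyc0_growth t : 0 <= t -> cyc0 t <= 8 * t / sqrt (sqrt (1 + 4 * t)).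
Proof.
intros [H| <-]; [|rewrite cyc0_at_0; right; field; apply Rgt_not_eq; repeat apply sqrt_lt_R0; lra].
pose proof PI2_pos as HP; rewrite cyc0_RInt by lra.
set (T := sqrt (4 * t)).
assert (T0 : 0 < T) by (apply sqrt_lt_R0; lra).
assert (T2 : T * T = 4 * t) by (apply sqrt_sqrt; lra).
set (g := fun th => 8 * t / T * sqrt (1 + T * sin th)).
set (dg := fun th => 4 * t * cos th / sqrt (1 + T * sin th)).
assert (PS : forall th, 0 <= th <= PI / 2 -> 0 < 1 + T * sin th).
{ intros th Hth; pose proof (sin_bounds th Hth); nra. }
assert (Dg : forall th, 0 <= th <= PI / 2 -> is_derive g th (dg th)).
{ intros th Hth; specialize (PS th Hth).
  assert (D : is_derive (fun th => sqrt (1 + T * sin th)) th (T * cos th / (2 * sqrt (1 + T * sin th)))).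
  { apply (is_derive_sqrt_comp (fun th => 1 + T * sin th)); [auto_derive; [easy|ring]|exact PS]. }
  unfold g, dg; evar_last; [apply (is_derive_scal _ _ (8 * t / T) _ D)|].
  pose proof (sqrt_lt_R0 _ PS); simpl; field; lra. }
assert (Cg : forall th, 0 <= th <= PI / 2 -> continuous dg th).
{ intros th Hth; specialize (PS th Hth); unfold dg, Rdiv.
  apply cont_mult; [smooth|].
  apply (cont_inv (fun th => sqrt (1 + T * sin th))); [|apply Rgt_not_eq, sqrt_lt_R0, PS].
  apply (ex_derive_continuous (V := R_NormedModule)); eexists.
  apply (is_derive_sqrt_comp (fun th => 1 + T * sin th)); [auto_derive; [easy|reflexivity]|exact PS]. }
assert (I : RInt dg 0 (PI / 2) = g (PI / 2) - g 0).
{ apply is_RInt_unique, (is_RInt_derive g dg); rewrite Rmin_left, Rmax_right by lra; assumption. }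
apply Rle_trans with (RInt dg 0 (PI / 2)).
- apply RInt_le; [lra|apply ex_RInt_cyc0_density; lra|apply ex_RInt_cont; [lra|exact Cg]|].
  intros th Hth; unfold cyc0_density, dg; pose proof (cos_bounds th ltac:(lra)) as Cb.
  pose proof (sin_bounds th ltac:(lra)) as Sb; specialize (PS th ltac:(lra)).
  pose proof (ellR_bounds t th ltac:(lra)) as RB; pose proof (ellQ_pos (- 4 * t) th ltac:(lra)) as QP.
  pose proof (ellQ_sqr (- 4 * t) th ltac:(lra)) as QS; pose proof (ellR_sqr (- 4 * t) th ltac:(lra)) as RS.
  set (R1 := ellR (- 4 * t) th) in *; set (Q1 := ellQ (- 4 * t) th) in *.
  assert (S0 := sqrt_lt_R0 _ PS); set (y := 1 + T * sin th) in *; set (S := sqrt y) in *.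
  assert (SS : S * S = y) by (apply sqrt_sqrt; lra).
    assert (Y : y <= 2 * R1).
  { assert (R1 ^ 2 = 1 + (T * sin th) ^ 2) by (rewrite RS, Rpow_mult_distr; replace (T ^ 2) with (4 * t) by (rewrite <- T2; ring); ring).
    assert (0 <= T * sin th) by nra; unfold y; nra. }
  assert (QS2 : Q1 * S <= 2 * R1).
  { apply Rsqr_incr_0_var; [|lra]; unfold Rsqr.
    replace (Q1 * S * (Q1 * S)) with ((1 + R1) * y) by (rewrite <- SS, <- QS; ring).
    nra. }
  assert (K : Q1 / R1 <= 2 / S).
  { apply (Rmult_le_reg_r (R1 * S)); [nra|].
    replace (Q1 / R1 * (R1 * S)) with (Q1 * S) by (field; lra).
    replace (2 / S * (R1 * S)) with (2 * R1) by (field; lra); exact QS2. }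
  assert (0 < 2 / S) by (apply Rdiv_lt_0_compat; lra).
  replace (2 * t * cos th ^ 2 * Q1 / R1) with (2 * t * cos th * (cos th * (Q1 / R1))) by (field; lra).
  replace (4 * t * cos th / S) with (2 * t * cos th * (1 * (2 / S))) by (field; lra).
  assert (0 <= Q1 / R1) by (apply Rlt_le, Rdiv_lt_0_compat; lra).
  apply Rmult_le_compat_l; [nra|]; apply Rmult_le_compat; lra.
- rewrite I; unfold g; rewrite sin_PI2, sin_0, Rmult_0_r, Rplus_0_r, sqrt_1, !Rmult_1_r.
  set (y := sqrt (1 + T)); assert (Y1 : y * y = 1 + T) by (apply sqrt_sqrt; lra).
  assert (Y0 : 0 < y) by (apply sqrt_lt_R0; lra).
  replace (8 * t / T * y - 8 * t / T) with (8 * t / (y + 1)).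
  + apply Rmult_le_compat_l; [lra|]; apply Rinv_le_contravar; [repeat apply sqrt_lt_R0; lra|].
    apply Rle_trans with y; [|lra]; unfold y; apply sqrt_le_1_alt.
    rewrite <- (sqrt_square (1 + T)) by lra; apply sqrt_le_1_alt; nra.
  + replace T with (y * y - 1) at 1 2 by lra; field; split; nra.
Qed.

Definition cyc_ratio (t : R) : R := cyc2 t / cyc0 t.
Definition wron (t : R) : R := cyc0 t * dcyc2 t - cyc2 t * dcyc0 t.

Lemma dcyc0_eq t : 0 < t -> dcyc0 t = (3 * cyc0 t + (cyc0 t + 5 * cyc2 t) / (4 * t + 1)) / (4 * t).
Proof.
intros H; assert (E1 := cyc0_ode t ltac:(lra)); assert (E2 := cyc2_ode t ltac:(lra)).
replace (cyc0 t + 5 * cyc2 t) with ((4 * t + 1) * dcyc2 t).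
replace (3 * cyc0 t) with (4 * t * dcyc0 t - dcyc2 t) by lra; field; lra.
Qed.

Lemma dcyc2_eq t : 0 < t -> dcyc2 t = (cyc0 t + 5 * cyc2 t) / (4 * t + 1).
Proof. intros H; assert (E2 := cyc2_ode t ltac:(lra)); rewrite <- E2; field; lra. Qed.

(** The Wronskian [wron] with its derivatives eliminated by the system, in
    which form it can be differentiated again. *)
Definition cyc_wronskian (t : R) : R := cyc0 t * ((cyc0 t + 5 * cyc2 t) / (4 * t + 1))
  - cyc2 t * ((3 * cyc0 t + (cyc0 t + 5 * cyc2 t) / (4 * t + 1)) / (4 * t)).

Lemma wron_eq t : 0 < t -> wron t = cyc_wronskian t.
Proof. intros H; unfold wron, cyc_wronskian; now rewrite dcyc0_eq, dcyc2_eq. Qed.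

Ltac use_derivs t H :=
  replace (Derive (fun x => cyc0 x) t) with (dcyc0 t) by (symmetry; apply is_derive_unique, is_derive_cyc0; lra);
  replace (Derive (fun x => cyc2 x) t) with (dcyc2 t) by (symmetry; apply is_derive_unique, is_derive_cyc2; lra);
  rewrite ?dcyc0_eq, ?dcyc2_eq by exact H.

Lemma is_derive_cyc_wronskian t : 0 < t ->
  is_derive cyc_wronskian t ((4 * cyc0 t ^ 2 + 8 * cyc0 t * cyc2 t) / (4 * t * (4 * t + 1))).
Proof.
intros H; unfold cyc_wronskian; auto_derive.
- repeat split; try lra; try (exists (dcyc0 t); apply is_derive_cyc0; lra); try (exists (dcyc2 t); apply is_derive_cyc2; lra).
- use_derivs t H; field; lra.
Qed.

(** The numerator of the second derivative of the ratio, see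
    [is_derive2_cyc_ratio]. Its derivative is manifestly nonpositive as
    soon as the Wronskian is nonnegative; this is what makes the ratio
    concave. *)
Definition cyc_curvature (t : R) : R := 4 * cyc0 t ^ 2 + 8 * cyc0 t * cyc2 t
  - 2 * cyc_wronskian t * ((12 * t + 4) * cyc0 t + 5 * cyc2 t) / cyc0 t.

Lemma is_derive_cyc_curvature t : 0 < t ->
  is_derive cyc_curvature t (- (10 * cyc_wronskian t ^ 2 / cyc0 t ^ 2 + 16 * cyc_wronskian t)).
Proof.
intros H; pose proof (cyc0_pos t H) as P.
assert (D := is_derive_cyc_wronskian t H).
unfold cyc_curvature; auto_derive.
- repeat split; try lra; try (exists (dcyc0 t); apply is_derive_cyc0; lra); try (exists (dcyc2 t); apply is_derive_cyc2; lra).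
  eexists; exact D.
- use_derivs t H.
  rewrite_derive.
  unfold cyc_wronskian; field; lra.
Qed.

Lemma is_derive_cyc_ratio t : 0 < t -> is_derive cyc_ratio t (cyc_wronskian t / cyc0 t ^ 2).
Proof.
intros H; pose proof (cyc0_pos t H) as P.
unfold cyc_ratio; auto_derive.
- repeat split; try lra; try (exists (dcyc0 t); apply is_derive_cyc0; lra); try (exists (dcyc2 t); apply is_derive_cyc2; lra).
- use_derivs t H; unfold cyc_wronskian; field; lra.
Qed.

Lemma is_derive2_cyc_ratio t : 0 < t -> is_derive (fun t => cyc_wronskian t / cyc0 t ^ 2) t
  (cyc_curvature t / (4 * t * (4 * t + 1) * cyc0 t ^ 2)).
Proof.
intros H; pose proof (cyc0_pos t H) as P.
assert (D := is_derive_cyc_wronskian t H).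
auto_derive.
- repeat split; try nra; try (exists (dcyc0 t); apply is_derive_cyc0; lra); eexists; exact D.
- use_derivs t H.
  rewrite_derive.
  unfold cyc_curvature; field; lra.
Qed.

(** * Concavity of the ratio of the two integrals *)

(** The system is singular at t = 0; these bounds serve as its initial
    conditions. *)
Lemma near_0_bounds t : 0 < t <= 1 ->
  0 < cyc0 t <= 8 * t /\ 0 <= cyc2 t <= 16 * t ^ 2 /\ 0 <= dcyc2 t <= 88 * t /\ 0 <= dcyc0 t <= 28.
Proof.
intros H; pose proof (cyc0_pos t ltac:(lra)) as P; pose proof (cyc0_linear_bound t ltac:(lra)) as L.
pose proof (cyc2_bounds t ltac:(lra)) as B.
assert (B2 : cyc2 t <= 16 * t ^ 2) by nra.
assert (D : 0 <= dcyc2 t <= 88 * t).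
{ pose proof (cyc2_ode t ltac:(lra)) as E; split; [|nra].
  assert (0 <= (4 * t + 1) * dcyc2 t) by nra; nra. }
assert (D2 : 0 <= dcyc0 t <= 28).
{ pose proof (cyc0_ode t ltac:(lra)) as E; split.
  - assert (0 <= 4 * t * dcyc0 t) by nra; nra.
  - assert (4 * t * dcyc0 t <= 4 * t * 28) by nra.
    apply (Rmult_le_reg_l (4 * t)); lra. }
repeat split; lra.
Qed.

(** The Wronskian is nondecreasing and tends to 0 at t = 0. *)
Lemma cyc_wronskian_nonneg t : 0 < t -> 0 <= cyc_wronskian t.
Proof.
intros H; apply Rle_plus_epsilon; intros eps He.
(* Near 0 the Wronskian is at least - cyc2 dcyc0, and 16 s^2 28 <= 448 s. *)
set (s := Rmin (Rmin t 1) (eps / 448)).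
assert (S0 : 0 < s) by (repeat apply Rmin_pos; lra).
assert (S1 : s <= t) by le_Rmin.
assert (S2 : s <= 1) by le_Rmin.
assert (S3 : s <= eps / 448) by apply Rmin_r.
assert (M : cyc_wronskian s <= cyc_wronskian t).
{ apply (nondecreasing_of_derive cyc_wronskian (fun t => (4 * cyc0 t ^ 2 + 8 * cyc0 t * cyc2 t) / (4 * t * (4 * t + 1)))); [exact S1| |].
  - intros u Hu; apply is_derive_cyc_wronskian; lra.
  - intros u Hu; pose proof (cyc0_pos u ltac:(lra)); pose proof (cyc2_bounds u ltac:(lra)).
    apply Rmult_le_pos; [nra|left; apply Rinv_0_lt_compat; nra]. }
destruct (near_0_bounds s ltac:(lra)) as (A & B & C & D).
rewrite <- (wron_eq s S0) in M; unfold wron in M.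
assert (0 <= cyc0 s * dcyc2 s) by nra.
assert (cyc2 s * dcyc0 s <= 16 * s ^ 2 * 28) by (apply Rmult_le_compat; lra).
nra.
Qed.

(** It is nonincreasing and its upper limit at t = 0 is at most 0. *)
Lemma cyc_curvature_nonpos t : 0 < t -> cyc_curvature t <= 0.
Proof.
intros H; apply Rle_plus_epsilon; intros eps He; rewrite Rplus_0_l.
(* Near 0 the value is at most 4 cyc0^2 + 8 cyc0 cyc2 <= 256 s + 1024 s. *)
set (s := Rmin (Rmin t 1) (eps / 1280)).
assert (S0 : 0 < s) by (repeat apply Rmin_pos; lra).
assert (S1 : s <= t) by le_Rmin.
assert (S2 : s <= 1) by le_Rmin.
assert (S3 : s <= eps / 1280) by apply Rmin_r.
assert (M : - cyc_curvature s <= - cyc_curvature t).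
{ apply (nondecreasing_of_derive (fun t => - cyc_curvature t) (fun t => 10 * cyc_wronskian t ^ 2 / cyc0 t ^ 2 + 16 * cyc_wronskian t)); [exact S1| |].
  - intros u Hu; evar_last; [apply (is_derive_opp cyc_curvature), is_derive_cyc_curvature; lra|].
    unfold opp; simpl; ring.
  - intros u Hu; pose proof (cyc0_pos u ltac:(lra)); pose proof (cyc_wronskian_nonneg u ltac:(lra)).
    apply Rplus_le_le_0_compat; [|lra].
    apply Rmult_le_pos; [nra|left; apply Rinv_0_lt_compat; nra]. }
destruct (near_0_bounds s ltac:(lra)) as (A & B & _).
assert (K : cyc_curvature s <= 4 * cyc0 s ^ 2 + 8 * cyc0 s * cyc2 s).
{ unfold cyc_curvature; pose proof (cyc_wronskian_nonneg s S0).
  assert (0 <= 2 * cyc_wronskian s * ((12 * s + 4) * cyc0 s + 5 * cyc2 s) / cyc0 s); [|lra].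
  apply Rmult_le_pos; [|left; apply Rinv_0_lt_compat; lra].
  apply Rmult_le_pos; [lra|nra]. }
assert (cyc0 s ^ 2 <= 64 * s) by nra.
assert (cyc2 s <= 16 * s) by nra.
assert (cyc0 s * cyc2 s <= (8 * s) * (16 * s)) by (apply Rmult_le_compat; lra).
nra.
Qed.

Definition concave_pos (f : R -> R) : Prop :=
  forall x y z, 0 < x < y -> y < z -> (z - y) * f x + (y - x) * f z <= (z - x) * f y.

Lemma concave_of_derive (f df : R -> R) :
  (forall t, 0 < t -> is_derive f t (df t)) ->
  (forall u v, 0 < u <= v -> df v <= df u) -> concave_pos f.
Proof.
intros D M x y z Hxy Hyz.
assert (MV : forall u v, 0 < u < v -> exists c, u <= c <= v /\ f v - f u = df c * (v - u)).
{ intros u v Huv; destruct (MVT_gen f u v df) as [c [Hc E]].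
  - rewrite Rmin_left, Rmax_right by lra; intros t Ht; apply D; lra.
  - rewrite Rmin_left, Rmax_right by lra; intros t Ht; apply continuity_pt_filterlim.
    apply (ex_derive_continuous (V := R_NormedModule)); exists (df t); apply D; lra.
  - rewrite Rmin_left, Rmax_right in Hc by lra; now exists c. }
destruct (MV x y ltac:(lra)) as [c1 [H1 E1]]; destruct (MV y z ltac:(lra)) as [c2 [H2 E2]].
assert (L := M c1 c2 ltac:(lra)).
replace (f x) with (f y - df c1 * (y - x)) by lra; replace (f z) with (f y + df c2 * (z - y)) by lra.
assert (0 <= (df c1 - df c2) * ((y - x) * (z - y))) by (apply Rmult_le_pos; [lra|apply Rmult_le_pos; lra]).
lra.
Qed.

Lemma cyc_ratio_derive_decreasing u v : 0 < u <= v -> cyc_wronskian v / cyc0 v ^ 2 <= cyc_wronskian u / cyc0 u ^ 2.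
Proof.
intros H.
enough (- (cyc_wronskian u / cyc0 u ^ 2) <= - (cyc_wronskian v / cyc0 v ^ 2)) by lra.
apply (nondecreasing_of_derive (fun t => - (cyc_wronskian t / cyc0 t ^ 2)) (fun t => - (cyc_curvature t / (4 * t * (4 * t + 1) * cyc0 t ^ 2)))); [lra| |].
- intros t Ht; apply (is_derive_opp (fun t => cyc_wronskian t / cyc0 t ^ 2)), is_derive2_cyc_ratio; lra.
- intros t Ht; pose proof (cyc_curvature_nonpos t ltac:(lra)); pose proof (cyc0_pos t ltac:(lra)).
  assert (0 < 4 * t * (4 * t + 1) * cyc0 t ^ 2) by (apply Rmult_lt_0_compat; nra).
  assert (P := Rinv_0_lt_compat _ H2); unfold Rdiv; nra.
Qed.

Lemma concave_combination p q rho : 0 <= rho -> concave_pos (fun t => p + q * t + rho * cyc_ratio t).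
Proof.
intros Hr; apply (concave_of_derive _ (fun t => q + rho * (cyc_wronskian t / cyc0 t ^ 2))).
- intros t Ht; pose proof (is_derive_cyc_ratio t Ht) as D.
  auto_derive; [eexists; exact D|].
  rewrite_derive.
  ring.
- intros u v H; pose proof (cyc_ratio_derive_decreasing u v H); nra.
Qed.

Section Concave.

Variable f : R -> R.
Hypotheses (Hc : concave_pos f) (Hf : forall t, 0 < t -> continuity_pt f t).

(** A concave function positive at [s] changes sign at most once to the left of
    [s]; the linear factor changes sign there, or is constant. *)
Lemma sign_factor_left s : 0 < s -> 0 < f s -> exists l0 l1,
  (forall t, s <= t -> 0 < l0 + l1 * t) /\ (forall t, 0 < t < s -> 0 <= (l0 + l1 * t) * f t).
Proof.
intros Hs P; destruct (classic (exists t, 0 < t < s /\ f t < 0)) as [[t0 [Ht0 N]]|N].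
- destruct (IVT_interv f t0 s) as [t1 [H1 Z]]; [intros; apply Hf; lra|lra|lra|lra|].
  assert (t1 <> s) by (intros ->; lra).
  exists (- t1), 1; split; [intros; lra|]; intros t Ht.
  destruct (Rtotal_order t t1) as [L|[E|L]]; [|subst; rewrite Z; lra|].
  + assert (K := Hc t t1 s ltac:(lra) ltac:(lra)); rewrite Z in K.
    assert (0 <= (t1 - t) * f s) by (apply Rmult_le_pos; lra).
    assert (f t <= 0).
    { apply Rnot_lt_le; intros F; assert (0 < (s - t1) * f t) by (apply Rmult_lt_0_compat; lra); lra. }
    nra.
  + assert (K := Hc t1 t s ltac:(lra) ltac:(lra)); rewrite Z in K.
    assert (0 <= (t - t1) * f s) by (apply Rmult_le_pos; lra).
    apply Rmult_le_pos; [lra|]; apply (Rmult_le_reg_l (s - t1)); lra.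
- exists 1, 0; split; [intros; lra|]; intros t Ht.
  destruct (Rle_dec 0 (f t)); [nra|exfalso; apply N; exists t; lra].
Qed.

Lemma sign_factor_right s : 0 < s -> 0 < f s -> exists l0 l1,
  (forall t, 0 < t <= s -> 0 < l0 + l1 * t) /\ (forall t, s < t -> 0 <= (l0 + l1 * t) * f t).
Proof.
intros Hs P; destruct (classic (exists t, s < t /\ f t < 0)) as [[t0 [Ht0 N]]|N].
- destruct (IVT_interv (fun t => - f t) s t0) as [t1 [H1 Z]].
  { intros a Ha; apply continuity_pt_opp, Hf; lra. }
  { lra. } { lra. } { lra. }
  assert (t1 <> s) by (intros ->; lra).
  exists t1, (-1); split; [intros; lra|]; intros t Ht.
  destruct (Rtotal_order t t1) as [L|[E|L]]; [|subst; nra|].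
  + assert (K := Hc s t t1 ltac:(lra) ltac:(lra)); replace (f t1) with 0 in K by lra.
    assert (0 <= (t1 - t) * f s) by (apply Rmult_le_pos; lra).
    apply Rmult_le_pos; [lra|]; apply (Rmult_le_reg_l (t1 - s)); lra.
  + assert (K := Hc s t1 t ltac:(lra) ltac:(lra)); replace (f t1) with 0 in K by lra.
    assert (0 <= (t - t1) * f s) by (apply Rmult_le_pos; lra).
    assert (f t <= 0).
    { apply Rnot_lt_le; intros F; assert (0 < (t1 - s) * f t) by (apply Rmult_lt_0_compat; lra); lra. }
    nra.
- exists 1, 0; split; [intros; lra|]; intros t Ht.
  destruct (Rle_dec 0 (f t)); [nra|exfalso; apply N; exists t; lra].
Qed.

(** The two sign changes of a concave function that is positive somewhere are
    those of a product of two linear factors; otherwise a constant will do. *)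
Lemma sign_quadratic : (exists t, 0 < t /\ f t <> 0) -> exists p0 p1 p2,
  (forall t, 0 < t -> 0 <= (p0 + p1 * t + p2 * t ^ 2) * f t) /\
  (exists s, 0 < s /\ 0 < (p0 + p1 * s + p2 * s ^ 2) * f s).
Proof.
intros [t0 [Ht0 N]]; destruct (classic (exists s, 0 < s /\ 0 < f s)) as [[s [Hs P]]|NP].
- destruct (sign_factor_left s Hs P) as (l0 & l1 & L1 & L2).
  destruct (sign_factor_right s Hs P) as (r0 & r1 & R1 & R2).
  exists (l0 * r0), (l0 * r1 + l1 * r0), (l1 * r1).
  assert (E : forall t, l0 * r0 + (l0 * r1 + l1 * r0) * t + l1 * r1 * t ^ 2 = (l0 + l1 * t) * (r0 + r1 * t)) by (intros; ring).
  split; [intros t Ht|exists s; split; [exact Hs|]]; rewrite E.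
  + destruct (Rtotal_order t s) as [L|[->|L]].
    * specialize (L2 t ltac:(lra)); specialize (R1 t ltac:(lra)).
      replace ((l0 + l1 * t) * (r0 + r1 * t) * f t) with ((l0 + l1 * t) * f t * (r0 + r1 * t)) by ring.
      apply Rmult_le_pos; lra.
    * specialize (L1 s ltac:(lra)); specialize (R1 s ltac:(lra)).
      repeat apply Rmult_le_pos; lra.
    * specialize (R2 t ltac:(lra)); specialize (L1 t ltac:(lra)).
      rewrite Rmult_assoc; apply Rmult_le_pos; lra.
  + specialize (L1 s ltac:(lra)); specialize (R1 s ltac:(lra)).
    repeat apply Rmult_lt_0_compat; lra.
- assert (Q : forall t, 0 < t -> f t <= 0).
  { intros t Ht; destruct (Rle_dec (f t) 0); [assumption|exfalso; apply NP; exists t; lra]. }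
  exists (-1), 0, 0; split; [intros t Ht; specialize (Q t Ht); lra|].
  exists t0; specialize (Q t0 Ht0); split; lra.
Qed.

End Concave.

(** According to the sign of [rho], the density or its opposite is concave. *)
Lemma density_sign p q rho : (exists t, 0 < t /\ p + q * t - rho * cyc_ratio t <> 0) -> exists p0 p1 p2,
  (forall t, 0 < t -> 0 <= (p0 + p1 * t + p2 * t ^ 2) * (p + q * t - rho * cyc_ratio t)) /\
  (exists s, 0 < s /\ 0 < (p0 + p1 * s + p2 * s ^ 2) * (p + q * s - rho * cyc_ratio s)).
Proof.
intros [t0 [H0 N0]].
assert (C : forall p q rho t, 0 < t -> continuity_pt (fun t => p + q * t + rho * cyc_ratio t) t).
{ intros p' q' r' t Ht; apply continuity_pt_filterlim.
  apply (ex_derive_continuous (V := R_NormedModule) (fun t => p' + q' * t + r' * cyc_ratio t)).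
  pose proof (is_derive_cyc_ratio t Ht) as D; auto_derive; eexists; exact D. }
destruct (Rle_dec 0 (- rho)) as [L|L].
- destruct (sign_quadratic (fun t => p + q * t + - rho * cyc_ratio t)) as (p0 & p1 & p2 & Q1 & s & Q2).
  + now apply concave_combination.
  + intros; now apply C.
  + exists t0; split; [exact H0|lra].
  + exists p0, p1, p2; split.
    * intros t Ht; specialize (Q1 t Ht); lra.
    * exists s; destruct Q2 as [Q2 Q3]; split; [exact Q2|lra].
- destruct (sign_quadratic (fun t => - p + - q * t + rho * cyc_ratio t)) as (p0 & p1 & p2 & Q1 & s & Q2).
  + apply concave_combination; lra.
  + intros; now apply C.
  + exists t0; split; [exact H0|lra].
  + exists (- p0), (- p1), (- p2); split.
    * intros t Ht; specialize (Q1 t Ht); lra.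
    * exists s; destruct Q2 as [Q2 Q3]; split; [exact Q2|lra].
Qed.

(** * The dispersion relation *)

(** The level t with 1 / (1 + 4 t) = x^8. The power 8 absorbs the fractional
    exponents at x = 0, which is t = +oo, so that all integrals over 0 < t
    < +oo become proper integrals of continuous functions on [0, 1]. At x =
    0 itself the convention / 0 = 0 gives the meaningless level - 1/4,
    which the powers of x in the weights suppress. *)
Definition level (x : R) : R := (/ x ^ 8 - 1) / 4.
Definition cyc0_at (x : R) : R := cyc0 (level x).
Definition cyc2_at (x : R) : R := cyc2 (level x).
(** With tau = x^8 these are cyc0 d tau and cyc2 tau d tau divided by dx. *)
Definition weight0 (x : R) : R := 8 * x ^ 7 * cyc0_at x.
Definition weight2 (x : R) : R := 8 * x ^ 15 * cyc2_at x.

Lemma pow8_pos x : x <> 0 -> 0 < x ^ 8.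
Proof. intros H; replace (x ^ 8) with ((x ^ 4) ^ 2) by ring; apply pow2_gt_0, pow_nonzero, H. Qed.

Lemma level_gt x : x <> 0 -> -1/4 < level x.
Proof. intros H; unfold level; assert (P := Rinv_0_lt_compat _ (pow8_pos x H)); lra. Qed.

Lemma level_eq x : x <> 0 -> 1 + 4 * level x = / x ^ 8.
Proof. intros H; unfold level; field; exact H. Qed.

Lemma pow8_le_1 x : -1 <= x <= 1 -> 0 <= x ^ 8 <= 1.
Proof.
intros H; replace (x ^ 8) with ((x ^ 2) ^ 4) by ring.
assert (0 <= x ^ 2 <= 1) by (split; [apply pow2_ge_0|nra]).
split; [apply pow_le; lra|]; rewrite <- (pow1 4); apply pow_incr; lra.
Qed.

Lemma eighth_root y : 0 < y <= 1 -> exists x, 0 <= x <= 1 /\ x ^ 8 = y.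
Proof.
intros H; assert (S : forall y, 0 <= y <= 1 -> 0 <= sqrt y <= 1 /\ sqrt y ^ 2 = y).
{ intros z Hz; split; [split; [apply sqrt_pos|]|now apply pow2_sqrt].
  rewrite <- sqrt_1; now apply sqrt_le_1_alt. }
destruct (S y ltac:(lra)) as [B1 E1]; destruct (S _ B1) as [B2 E2]; destruct (S _ B2) as [B3 E3].
exists (sqrt (sqrt (sqrt y))); split; [exact B3|].
replace (sqrt (sqrt (sqrt y)) ^ 8) with (((sqrt (sqrt (sqrt y)) ^ 2) ^ 2) ^ 2) by ring.
now rewrite E3, E2.
Qed.

Lemma level_pos x : 0 < x < 1 -> 0 < level x.
Proof.
intros Hx; assert (P := pow8_pos x ltac:(lra)).
assert (x ^ 8 < 1).
{ apply Rle_lt_trans with x; [|lra]; replace (x ^ 8) with (x * x ^ 7) by ring.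
  assert (x ^ 7 <= 1) by (rewrite <- (pow1 7); apply pow_incr; lra); nra. }
assert (1 < / x ^ 8) by (rewrite <- Rinv_1; apply Rinv_lt_contravar; lra); unfold level; lra.
Qed.

Lemma level_1 : level 1 = 0.
Proof. unfold level; field. Qed.

Lemma level_nonneg x : x <> 0 -> -1 <= x <= 1 -> 0 <= level x.
Proof.
intros H B; assert (P := pow8_pos x H); assert (L := pow8_le_1 x B).
assert (1 <= / x ^ 8) by (rewrite <- Rinv_1; apply Rinv_le_contravar; lra); unfold level; lra.
Qed.

Lemma is_derive_level x : x <> 0 -> is_derive level x (- 2 / x ^ 9).
Proof.
intros H; unfold level; auto_derive; [exact (pow_nonzero x 8 H)|]; field; exact H.
Qed.

Lemma is_derive_cyc0_at x : x <> 0 -> is_derive cyc0_at x (- 2 / x ^ 9 * dcyc0 (level x)).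
Proof.
intros H; exact (is_derive_comp cyc0 level x _ _ (is_derive_cyc0 _ (level_gt x H)) (is_derive_level x H)).
Qed.

Lemma is_derive_cyc2_at x : x <> 0 -> is_derive cyc2_at x (- 2 / x ^ 9 * dcyc2 (level x)).
Proof.
intros H; exact (is_derive_comp cyc2 level x _ _ (is_derive_cyc2 _ (level_gt x H)) (is_derive_level x H)).
Qed.

Lemma cyc2_at_ode x : x <> 0 -> dcyc2 (level x) = x ^ 8 * (cyc0_at x + 5 * cyc2_at x).
Proof.
intros H; assert (E := cyc2_ode (level x) (level_gt x H)); replace (4 * level x + 1) with (/ x ^ 8) in E by (rewrite <- level_eq; [ring|exact H]).
unfold cyc0_at, cyc2_at; rewrite <- E; field; exact H.
Qed.

Lemma cyc0_at_ode x : x <> 0 -> (1 - x ^ 8) * dcyc0 (level x) = x ^ 8 * (3 * cyc0_at x + x ^ 8 * (cyc0_at x + 5 * cyc2_at x)).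
Proof.
intros H; assert (E := cyc0_ode (level x) (level_gt x H)); rewrite cyc2_at_ode in E by exact H; fold (cyc0_at x) in E.
rewrite <- E; unfold level at 2; field; exact H.
Qed.

Lemma cyc0_at_bounds x : x <> 0 -> -1 <= x <= 1 -> 0 <= cyc0_at x <= 2 * / x ^ 6.
Proof.
intros H B; assert (P := level_nonneg x H B).
assert (P2 : 0 < x ^ 2) by (now apply pow2_gt_0).
assert (P8 := pow8_pos x H).
split.
- destruct P as [P|P]; [left; now apply cyc0_pos|]; unfold cyc0_at; rewrite <- P, cyc0_at_0; lra.
- eapply Rle_trans; [apply cyc0_growth, P|].
  rewrite level_eq by exact H.
  replace (sqrt (sqrt (/ x ^ 8))) with (/ x ^ 2).
  + replace (2 * / x ^ 6) with (2 * / x ^ 8 / / x ^ 2) by (field; exact H).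
    apply Rmult_le_compat_r; [left; apply Rinv_0_lt_compat; now apply Rinv_0_lt_compat|].
    unfold level; lra.
  + symmetry; apply sqrt_lem_1; [apply sqrt_pos|left; now apply Rinv_0_lt_compat|].
    symmetry; apply sqrt_lem_1; [left; now apply Rinv_0_lt_compat| |field; exact H].
    left; apply Rmult_lt_0_compat; now apply Rinv_0_lt_compat.
Qed.

Lemma cyc2_at_bounds x : x <> 0 -> -1 <= x <= 1 -> 0 <= cyc2_at x /\ x ^ 8 * cyc2_at x <= cyc0_at x.
Proof.
intros H B; assert (P := level_nonneg x H B); assert (P8 := pow8_pos x H).
destruct (cyc2_bounds (level x) P) as [B1 B2]; split; [exact B1|].
destruct (cyc0_at_bounds x H B) as [A1 _]; fold (cyc0_at x) in *; unfold cyc2_at.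
apply Rle_trans with (x ^ 8 * (2 * level x * cyc0_at x)); [apply Rmult_le_compat_l; [lra|exact B2]|].
replace (x ^ 8 * (2 * level x * cyc0_at x)) with ((1 - x ^ 8) / 2 * cyc0_at x) by (unfold level; field; exact H).
nra.
Qed.

(** From [cyc0_growth]: cyc0 is O(x^(-6)). *)
Lemma weight0_bound x : -1 <= x <= 1 -> Rabs (weight0 x) <= 16 * Rabs x.
Proof.
intros B; destruct (Req_dec x 0) as [->|H]; [unfold weight0; rewrite pow_i, Rmult_0_r, Rmult_0_l, Rabs_R0 by lia; lra|].
destruct (cyc0_at_bounds x H B) as [A1 A2].
unfold weight0; replace (8 * x ^ 7 * cyc0_at x) with (x * (8 * (x ^ 6 * cyc0_at x))) by ring.
assert (P6 : 0 < x ^ 6) by (replace (x ^ 6) with ((x ^ 3) ^ 2) by ring; apply pow2_gt_0, pow_nonzero, H).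
assert (x ^ 6 * cyc0_at x <= 2).
{ apply Rle_trans with (x ^ 6 * (2 * / x ^ 6)); [apply Rmult_le_compat_l; lra|right; field; exact H]. }
rewrite Rabs_mult, (Rabs_pos_eq (8 * _)) by nra; pose proof (Rabs_pos x); nra.
Qed.

Lemma weight2_bound x : -1 <= x <= 1 -> Rabs (weight2 x) <= 16 * Rabs x.
Proof.
intros B; destruct (Req_dec x 0) as [->|H]; [unfold weight2; rewrite pow_i, Rmult_0_r, Rmult_0_l, Rabs_R0 by lia; lra|].
destruct (cyc2_at_bounds x H B) as [B1 B2]; assert (P8 := pow8_pos x H).
eapply Rle_trans; [|apply (weight0_bound x B)].
unfold weight0, weight2; replace (8 * x ^ 15 * cyc2_at x) with (8 * x ^ 7 * (x ^ 8 * cyc2_at x)) by ring.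
rewrite !(Rabs_mult (8 * x ^ 7)); apply Rmult_le_compat_l; [apply Rabs_pos|].
rewrite !Rabs_pos_eq; [exact B2|apply (cyc0_at_bounds x H B)|nra].
Qed.

Lemma continuous_0_of_bound (f : R -> R) K : (forall x, -1 <= x <= 1 -> Rabs (f x) <= K * Rabs x) ->
  continuous f 0.
Proof.
intros H P [eps He].
assert (f0 : f 0 = 0).
{ specialize (H 0 ltac:(lra)); rewrite Rabs_R0, Rmult_0_r in H.
  pose proof (Rabs_pos (f 0)); destruct (Req_dec (f 0) 0) as [E|E]; [exact E|].
  apply Rabs_no_R0 in E; lra. }
assert (K0 : 0 <= K) by (specialize (H 1 ltac:(lra)); rewrite Rabs_R1 in H; pose proof (Rabs_pos (f 1)); lra).
assert (D : 0 < Rmin 1 (eps / (K + 1))).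
{ apply Rmin_pos; [lra|apply Rdiv_lt_0_compat; [apply cond_pos|lra]]. }
exists (mkposreal _ D); intros x Hx.
change (Rabs (x - 0) < Rmin 1 (eps / (K + 1))) in Hx; rewrite Rminus_0_r in Hx.
assert (L1 := Rmin_l 1 (eps / (K + 1))); assert (L2 := Rmin_r 1 (eps / (K + 1))).
apply He; change (Rabs (f x - f 0) < eps); rewrite f0, Rminus_0_r.
assert (B : -1 <= x <= 1) by (apply Rabs_le_between; lra).
specialize (H x B).
assert (Rabs x * (K + 1) < eps).
{ apply Rlt_le_trans with (eps / (K + 1) * (K + 1)); [apply Rmult_lt_compat_r; lra|right; field; lra]. }
pose proof (Rabs_pos x); lra.
Qed.

Lemma is_derive_0_of_bound (f : R -> R) K : (forall x, -1 <= x <= 1 -> Rabs (f x) <= K * x ^ 2) ->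
  is_derive f 0 0.
Proof.
intros H; apply is_derive_Reals; intros eps He.
assert (f0 : f 0 = 0).
{ specialize (H 0 ltac:(lra)); replace (K * 0 ^ 2) with 0 in H by ring.
  pose proof (Rabs_pos (f 0)); destruct (Req_dec (f 0) 0) as [E|E]; [exact E|].
  apply Rabs_no_R0 in E; lra. }
assert (K0 : 0 <= K) by (specialize (H 1 ltac:(lra)); pose proof (Rabs_pos (f 1)); lra).
assert (D : 0 < Rmin 1 (eps / (K + 1))).
{ apply Rmin_pos; [lra|apply Rdiv_lt_0_compat; lra]. }
exists (mkposreal _ D); intros x Hx Hd; simpl in Hd.
assert (L1 := Rmin_l 1 (eps / (K + 1))); assert (L2 := Rmin_r 1 (eps / (K + 1))).
rewrite Rplus_0_l, f0, !Rminus_0_r.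
assert (B : -1 <= x <= 1) by (apply Rabs_le_between; lra).
specialize (H x B).
unfold Rdiv; rewrite Rabs_mult, Rabs_inv.
assert (P := Rabs_pos_lt x Hx).
apply (Rmult_lt_reg_r (Rabs x)); [exact P|]; rewrite Rmult_assoc, Rinv_l, Rmult_1_r by lra.
assert (Rabs x * (K + 1) < eps).
{ apply Rlt_le_trans with (eps / (K + 1) * (K + 1)); [apply Rmult_lt_compat_r; lra|right; field; lra]. }
assert (E : x ^ 2 = Rabs x * Rabs x) by (rewrite <- Rabs_mult, Rabs_pos_eq by nra; ring).
rewrite E in H; nra.
Qed.

Lemma weight0_cont x : continuous weight0 x.
Proof.
destruct (Req_dec x 0) as [->|H]; [apply (continuous_0_of_bound _ 16 weight0_bound)|].
apply cont_mult; [smooth|].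
apply (ex_derive_continuous (V := R_NormedModule)); eexists; now apply is_derive_cyc0_at.
Qed.

Lemma weight2_cont x : continuous weight2 x.
Proof.
destruct (Req_dec x 0) as [->|H]; [apply (continuous_0_of_bound _ 16 weight2_bound)|].
apply cont_mult; [smooth|].
apply (ex_derive_continuous (V := R_NormedModule)); eexists; now apply is_derive_cyc2_at.
Qed.

(** The Cauchy integral of the density g over the cut, in the variable tau =
    x^8. *)
Definition stieltjes (g : R -> R) (z : R) : R := RInt (fun x => g x * / (1 - z * x ^ 8)) 0 1.
Definition dstieltjes (g : R -> R) (z : R) : R := RInt (fun x => g x * (x ^ 8 * / (1 - z * x ^ 8) ^ 2)) 0 1.

Lemma denom_pos z x : z < 1 -> 0 <= x <= 1 -> 0 < 1 - z * x ^ 8.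
Proof.
intros H B; assert (L := pow8_le_1 x ltac:(lra)); destruct (Rle_dec z 0); nra.
Qed.

Lemma cont_x8 z x : continuous (fun x => 1 - z * x ^ 8) x.
Proof. smooth. Qed.

Lemma stieltjes_integrand_cont g z x : continuous g x -> z < 1 -> 0 <= x <= 1 ->
  continuous (fun x => g x * / (1 - z * x ^ 8)) x.
Proof.
intros Hg Hz Hx; apply cont_mult; [exact Hg|].
apply (cont_inv (fun x => 1 - z * x ^ 8)); [apply cont_x8|]; pose proof (denom_pos z x Hz Hx); lra.
Qed.

Lemma dstieltjes_integrand_cont g z x : continuous g x -> z < 1 -> 0 <= x <= 1 ->
  continuous (fun x => g x * (x ^ 8 * / (1 - z * x ^ 8) ^ 2)) x.
Proof.
intros Hg Hz Hx; apply cont_mult; [exact Hg|]; apply cont_mult.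
- smooth.
- apply (cont_inv (fun x => (1 - z * x ^ 8) ^ 2)); [apply (cont_pow (fun x => 1 - z * x ^ 8)), cont_x8|].
  apply pow_nonzero; pose proof (denom_pos z x Hz Hx); lra.
Qed.

Lemma c2d_denom z x : continuity_2d_pt (fun u v => 1 - u * v ^ 8) z x.
Proof.
apply continuity_2d_pt_minus; [apply continuity_2d_pt_const|].
apply continuity_2d_pt_mult; [apply continuity_2d_pt_id1|apply (c2d_pow (fun u v => v)), continuity_2d_pt_id2].
Qed.

Lemma is_derive_stieltjes g z : (forall x, continuous g x) -> z < 1 -> is_derive (stieltjes g) z (dstieltjes g z).
Proof.
intros Hg Hz.
assert (D : forall u v, 1 - u * v ^ 8 <> 0 ->
  is_derive (fun z => g v * / (1 - z * v ^ 8)) u (g v * (v ^ 8 * / (1 - u * v ^ 8) ^ 2))).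
{ intros u v N; auto_derive; [exact N|field; exact N]. }
apply (derive_under_integral (fun z x => g x * / (1 - z * x ^ 8)) (fun z x => g x * (x ^ 8 * / (1 - z * x ^ 8) ^ 2))); [lra|..].
- generalize (locally_lt_1 z Hz); apply filter_imp; intros u Hu t Ht; split.
  + apply D; pose proof (denom_pos u t Hu Ht); lra.
  + now apply stieltjes_integrand_cont.
- intros t Ht.
  assert (N : 1 - z * t ^ 8 <> 0) by (pose proof (denom_pos z t Hz Ht); lra).
  destruct (continuity_2d_pt_neq_0 _ z t (c2d_denom z t) N) as [d Hd].
  exists d; intros u v Hu Hv; apply D; now apply Hd.
- intros t Ht.
  assert (N : 1 - z * t ^ 8 <> 0) by (pose proof (denom_pos z t Hz Ht); lra).
  apply continuity_2d_pt_mult.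
  + apply (continuity_1d_2d_pt_comp g (fun u v => v)); [apply continuity_pt_filterlim, Hg|apply continuity_2d_pt_id2].
  + apply continuity_2d_pt_mult; [apply (c2d_pow (fun u v => v)), continuity_2d_pt_id2|].
    apply continuity_2d_pt_inv; [apply (c2d_pow (fun u v => 1 - u * v ^ 8)), c2d_denom|now apply pow_nonzero].
Qed.

Definition mass0 : R := RInt weight0 0 1.

Lemma RInt_lin5 (c1 c2 c3 c4 c5 : R) (f1 f2 f3 f4 f5 : R -> R) a b :
  ex_RInt f1 a b -> ex_RInt f2 a b -> ex_RInt f3 a b -> ex_RInt f4 a b -> ex_RInt f5 a b ->
  is_RInt (fun t => c1 * f1 t + (c2 * f2 t + (c3 * f3 t + (c4 * f4 t + c5 * f5 t)))) a b
  (c1 * RInt f1 a b + (c2 * RInt f2 a b + (c3 * RInt f3 a b + (c4 * RInt f4 a b + c5 * RInt f5 a b)))).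
Proof.
intros H1 H2 H3 H4 H5.
assert (S : forall c f, ex_RInt f a b -> is_RInt (fun t => c * f t) a b (c * RInt f a b)).
{ intros c f H; apply (is_RInt_scal (V := R_NormedModule)); now apply (RInt_correct (V := R_CompleteNormedModule)). }
apply (is_RInt_plus (V := R_NormedModule)); [now apply S|].
apply (is_RInt_plus (V := R_NormedModule)); [now apply S|].
apply (is_RInt_plus (V := R_NormedModule)); [now apply S|].
apply (is_RInt_plus (V := R_NormedModule)); now apply S.
Qed.

(** The primitives by which the two equations of the system become integrals of
    exact derivatives; both vanish for tau = 0 and for tau = 1. *)
Definition primitive2 (z x : R) : R := 4 * z * (x ^ 16 * cyc2_at x) / (1 - z * x ^ 8).
Definition primitive0 (z x : R) : R := 4 * z * (x ^ 8 * (1 - x ^ 8) * cyc0_at x - x ^ 16 * cyc2_at x) / (1 - z * x ^ 8).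

Lemma exact_form_zero (F : R -> R) (z c1 c2 c3 c4 c5 : R) : z < 1 ->
  (forall x, 0 <= x <= 1 -> is_derive F x
     (c1 * (weight0 x * / (1 - z * x ^ 8)) + (c2 * (weight0 x * (x ^ 8 * / (1 - z * x ^ 8) ^ 2)) +
     (c3 * (weight2 x * / (1 - z * x ^ 8)) + (c4 * (weight2 x * (x ^ 8 * / (1 - z * x ^ 8) ^ 2)) + c5 * weight0 x))))) ->
  F 0 = 0 -> F 1 = 0 ->
  c1 * stieltjes weight0 z + (c2 * dstieltjes weight0 z + (c3 * stieltjes weight2 z + (c4 * dstieltjes weight2 z + c5 * mass0))) = 0.
Proof.
intros Hz D F0 F1.
set (f1 := fun x => weight0 x * / (1 - z * x ^ 8)) in *.
set (f2 := fun x => weight0 x * (x ^ 8 * / (1 - z * x ^ 8) ^ 2)) in *.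
set (f3 := fun x => weight2 x * / (1 - z * x ^ 8)) in *.
set (f4 := fun x => weight2 x * (x ^ 8 * / (1 - z * x ^ 8) ^ 2)) in *.
assert (C1 : forall x, 0 <= x <= 1 -> continuous f1 x) by (intros; apply stieltjes_integrand_cont; [apply weight0_cont|assumption..]).
assert (C2 : forall x, 0 <= x <= 1 -> continuous f2 x) by (intros; apply dstieltjes_integrand_cont; [apply weight0_cont|assumption..]).
assert (C3 : forall x, 0 <= x <= 1 -> continuous f3 x) by (intros; apply stieltjes_integrand_cont; [apply weight2_cont|assumption..]).
assert (C4 : forall x, 0 <= x <= 1 -> continuous f4 x) by (intros; apply dstieltjes_integrand_cont; [apply weight2_cont|assumption..]).
assert (I := RInt_lin5 c1 c2 c3 c4 c5 f1 f2 f3 f4 weight0 0 1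
  (ex_RInt_cont _ _ _ Rle_0_1 C1) (ex_RInt_cont _ _ _ Rle_0_1 C2) (ex_RInt_cont _ _ _ Rle_0_1 C3)
  (ex_RInt_cont _ _ _ Rle_0_1 C4) (ex_RInt_cont _ _ _ Rle_0_1 (fun x _ => weight0_cont x))).
apply (is_RInt_unique (V := R_CompleteNormedModule)) in I.
refine (eq_trans (eq_sym I) _).
apply is_RInt_unique.
replace 0 with (minus (F 1) (F 0)) at 2 by (rewrite F0, F1; unfold minus, plus, opp; simpl; ring).
apply (is_RInt_derive F); rewrite Rmin_left, Rmax_right by lra; [exact D|].
intros x Hx.
apply cont_plus; [apply cont_mult; [apply continuous_const|now apply C1]|].
apply cont_plus; [apply cont_mult; [apply continuous_const|now apply C2]|].
apply cont_plus; [apply cont_mult; [apply continuous_const|now apply C3]|].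
apply (cont_lin2 c4 c5 f4 weight0); [now apply C4|apply weight0_cont].
Qed.

(** At x = 0, where [level] is singular, the derivatives of the primitives are
    read off from these bounds O(x^2). *)
Lemma boundary_terms_small x : -1 <= x <= 1 ->
  0 <= x ^ 8 * (1 - x ^ 8) * cyc0_at x <= 2 * x ^ 2 /\ 0 <= x ^ 16 * cyc2_at x <= 2 * x ^ 2.
Proof.
intros B; destruct (Req_dec x 0) as [->|H]; [rewrite !pow_i by lia; lra|].
destruct (cyc0_at_bounds x H B) as [A1 A2]; destruct (cyc2_at_bounds x H B) as [B1 B2].
assert (P8 := pow8_le_1 x B); assert (P2 := pow2_ge_0 x).
assert (P6 : 0 < x ^ 6) by (replace (x ^ 6) with ((x ^ 3) ^ 2) by ring; apply pow2_gt_0, pow_nonzero, H).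
assert (K : x ^ 8 * cyc0_at x <= 2 * x ^ 2).
{ apply Rle_trans with (x ^ 8 * (2 * / x ^ 6)); [apply Rmult_le_compat_l; lra|right; field; exact H]. }
assert (K0 : 0 <= x ^ 8 * cyc0_at x) by (apply Rmult_le_pos; lra).
split.
- replace (x ^ 8 * (1 - x ^ 8) * cyc0_at x) with ((1 - x ^ 8) * (x ^ 8 * cyc0_at x)) by ring.
  split; [apply Rmult_le_pos; lra|].
  apply Rle_trans with (1 * (x ^ 8 * cyc0_at x)); [apply Rmult_le_compat_r; lra|lra].
- replace (x ^ 16 * cyc2_at x) with (x ^ 8 * (x ^ 8 * cyc2_at x)) by ring.
  split; [apply Rmult_le_pos; [lra|apply Rmult_le_pos; lra]|].
  apply Rle_trans with (x ^ 8 * cyc0_at x); [apply Rmult_le_compat_l; lra|exact K].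
Qed.

Lemma denom_lower z x : z < 1 -> -1 <= x <= 1 -> Rmin 1 (1 - z) <= 1 - z * x ^ 8.
Proof.
intros Hz B; assert (P8 := pow8_le_1 x B).
destruct (Rle_dec z 0); [rewrite Rmin_left by lra|rewrite Rmin_right by lra]; nra.
Qed.

Lemma Rdiv_bound (u v m K : R) : 0 < m <= v -> Rabs u <= K -> Rabs (u / v) <= K / m.
Proof.
intros Hm Hu; unfold Rdiv; rewrite Rabs_mult, Rabs_inv, (Rabs_pos_eq v) by lra.
apply Rmult_le_compat; [apply Rabs_pos|left; apply Rinv_0_lt_compat; lra|exact Hu|].
apply Rinv_le_contravar; lra.
Qed.

(** Integration of the derivative of [primitive2]; the system for cyc0 and cyc2
    brings this derivative into the form required. *)
Lemma system_eq2 z : z < 1 ->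
  3 * z * stieltjes weight2 z + 4 * z ^ 2 * dstieltjes weight2 z - stieltjes weight0 z + mass0 = 0.
Proof.
intros Hz.
assert (E : -1 * stieltjes weight0 z + (0 * dstieltjes weight0 z + (3 * z * stieltjes weight2 z + (4 * z ^ 2 * dstieltjes weight2 z + 1 * mass0))) = 0); [|lra].
apply (exact_form_zero (primitive2 z)); [exact Hz| | |].
- intros x Hx; destruct (Req_dec x 0) as [->|H].
  + evar_last.
    * apply (is_derive_0_of_bound _ (8 * Rabs z / Rmin 1 (1 - z))).
      intros x B; destruct (boundary_terms_small x B) as [_ K].
      unfold primitive2; replace (8 * Rabs z / Rmin 1 (1 - z) * x ^ 2) with (8 * Rabs z * x ^ 2 / Rmin 1 (1 - z)) by (unfold Rdiv; ring).
      apply Rdiv_bound; [split; [apply Rmin_pos; lra|now apply denom_lower]|].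
      set (u := x ^ 16 * cyc2_at x) in *.
      rewrite !Rabs_mult, (Rabs_pos_eq 4), (Rabs_pos_eq u) by lra.
      pose proof (Rabs_pos z); nra.
    * unfold weight0, weight2; simpl; ring.
  + assert (N := denom_pos z x Hz Hx).
    assert (D := is_derive_cyc2_at x H).
    unfold primitive2; auto_derive.
    * repeat split; [eexists; exact D|simpl in N; lra].
    * rewrite_derive.
      rewrite cyc2_at_ode by exact H; unfold weight0, weight2; simpl pow in *; field; split; lra.
- unfold primitive2; rewrite !pow_i by lia; unfold Rdiv; ring.
- unfold primitive2, cyc2_at; rewrite level_1, cyc2_at_0; unfold Rdiv; ring.
Qed.

Lemma system_eq0 z : z < 1 ->
  4 * (z - 1) * (stieltjes weight0 z + z * dstieltjes weight0 z) - 3 * z * stieltjes weight0 z + 4 * mass0 - 8 * z * stieltjes weight2 z - 4 * z ^ 2 * dstieltjes weight2 z = 0.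
Proof.
intros Hz.
assert (E : (4 * (z - 1) - 3 * z) * stieltjes weight0 z + (4 * (z - 1) * z * dstieltjes weight0 z + (- 8 * z * stieltjes weight2 z + (- 4 * z ^ 2 * dstieltjes weight2 z + 4 * mass0))) = 0); [|lra].
apply (exact_form_zero (primitive0 z)); [exact Hz| | |].
- intros x Hx; destruct (Req_dec x 0) as [->|H].
  + evar_last.
    * apply (is_derive_0_of_bound _ (16 * Rabs z / Rmin 1 (1 - z))).
      intros x B; destruct (boundary_terms_small x B) as [K1 K].
      unfold primitive0; replace (16 * Rabs z / Rmin 1 (1 - z) * x ^ 2) with (16 * Rabs z * x ^ 2 / Rmin 1 (1 - z)) by (unfold Rdiv; ring).
      apply Rdiv_bound; [split; [apply Rmin_pos; lra|now apply denom_lower]|].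
      set (u := x ^ 8 * (1 - x ^ 8) * cyc0_at x - x ^ 16 * cyc2_at x) in *.
      assert (Rabs u <= 4 * x ^ 2) by (unfold u; apply Rabs_le; lra).
      rewrite !Rabs_mult, (Rabs_pos_eq 4) by lra.
      pose proof (Rabs_pos z); nra.
    * unfold weight0, weight2; simpl; ring.
  + assert (N := denom_pos z x Hz Hx).
    assert (DB := is_derive_cyc2_at x H); assert (DA := is_derive_cyc0_at x H).
    unfold primitive0; auto_derive.
    * repeat split; [eexists; exact DA|eexists; exact DB|simpl in N; lra].
    * rewrite_derive.
      rewrite cyc2_at_ode by exact H; unfold weight0, weight2; assert (K := cyc0_at_ode x H).
      set (u := dcyc0 (level x)) in *; set (A := cyc0_at x) in *; set (B := cyc2_at x) in *.
      transitivity (4 * z * ((8 * x ^ 7 - 16 * x ^ 15) * A - 2 / x * ((1 - x ^ 8) * u) - 16 * x ^ 15 * B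
          + 2 * x ^ 15 * (A + 5 * B)) / (1 - z * x ^ 8)
        + 4 * z * (x ^ 8 * (1 - x ^ 8) * A - x ^ 16 * B) * (8 * z * x ^ 7) / (1 - z * x ^ 8) ^ 2).
      { simpl pow in *; field; split; lra. }
      rewrite K; simpl pow in *; field; split; lra.
- unfold primitive0; rewrite !pow_i by lia; unfold Rdiv; ring.
- unfold primitive0, cyc2_at; rewrite level_1, cyc2_at_0; unfold Rdiv; ring.
Qed.

(** Cauchy integrals of cyc0 and cyc2 over the cut, with enough subtractions at
    zeta = 0 to converge; the term [mass0] is the one for which the
    Picard-Fuchs system holds without an inhomogeneity. *)
Definition disp0 (z : R) : R := z * stieltjes weight0 z.
Definition disp2 (z : R) : R := mass0 * z - z ^ 2 * stieltjes weight2 z.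
Definition ddisp0 (z : R) : R := stieltjes weight0 z + z * dstieltjes weight0 z.
Definition ddisp2 (z : R) : R := mass0 - 2 * z * stieltjes weight2 z - z ^ 2 * dstieltjes weight2 z.

Lemma is_derive_disp0 z : z < 1 -> is_derive disp0 z (ddisp0 z).
Proof.
intros H; assert (D := is_derive_stieltjes weight0 z weight0_cont H).
unfold disp0, ddisp0; auto_derive; [eexists; exact D|].
rewrite_derive; ring.
Qed.

Lemma is_derive_disp2 z : z < 1 -> is_derive disp2 z (ddisp2 z).
Proof.
intros H; assert (D := is_derive_stieltjes weight2 z weight2_cont H).
unfold disp2, ddisp2; auto_derive; [eexists; exact D|].
rewrite_derive; ring.
Qed.

Definition solves (f0 f2 df0 df2 : R -> R) : Prop :=
  (f0 0 = 0 /\ f2 0 = 0) /\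
  (forall z, z < 1 -> is_derive f0 z (df0 z) /\ is_derive f2 z (df2 z)) /\
  (forall z, z < 1 -> 4 * (z - 1) * df0 z = 3 * f0 z - 4 * df2 z /\ 4 * z * df2 z = 5 * f2 z - f0 z).

Lemma disp_solves : solves disp0 disp2 ddisp0 ddisp2.
Proof.
split; [unfold disp0, disp2; split; ring|]; split; intros z Hz.
- split; [now apply is_derive_disp0|now apply is_derive_disp2].
- assert (E2 := system_eq2 z Hz); assert (E0 := system_eq0 z Hz).
  unfold ddisp0, ddisp2, disp0, disp2; split.
  + lra.
  + assert (Z : z * (3 * z * stieltjes weight2 z + 4 * z ^ 2 * dstieltjes weight2 z - stieltjes weight0 z + mass0) = 0) by (rewrite E2; ring); lra.
Qed.

Lemma Psi_solves : solves Psi0 Psi2 dPsi0 dPsi2.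
Proof.
split; [|split; intros z Hz].
- assert (E := cyc0_at_0); assert (E' := cyc2_at_0); unfold cyc0, cyc2 in E, E'.
  replace (- 4 * 0) with 0 in E, E' by ring; lra.
- split; [now apply is_derive_Psi0|now apply is_derive_Psi2].
- split; [now apply Psi_eq0|now apply Psi_eq2].
Qed.

Lemma constant_of_derive (f : R -> R) u v : u <= v -> (forall t, u <= t <= v -> is_derive f t 0) -> f u = f v.
Proof.
intros L D; apply Rle_antisym.
- apply (nondecreasing_of_derive f (fun _ => 0)); [exact L|exact D|intros; lra].
- enough (- f u <= - f v) by lra.
  apply (nondecreasing_of_derive (fun t => - f t) (fun _ => 0)); [exact L| |intros; lra].
  intros t Ht; evar_last; [apply (is_derive_opp f); now apply D|unfold opp; simpl; ring].
Qed.

Lemma solves_explicit f0 f2 df0 df2 z : solves f0 f2 df0 df2 -> 0 < z < 1 ->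
  df2 z = (5 * f2 z - f0 z) / (4 * z) /\
  df0 z = (3 * f0 z - (5 * f2 z - f0 z) / z) / (4 * (z - 1)).
Proof.
intros (_ & _ & E) Hz; destruct (E z ltac:(lra)) as [E0 E2].
assert (E3 : df2 z = (5 * f2 z - f0 z) / (4 * z)) by (rewrite <- E2; field; lra).
split; [exact E3|]; rewrite E3 in E0.
replace (3 * f0 z - (5 * f2 z - f0 z) / z) with (4 * (z - 1) * df0 z) by (rewrite E0; field; lra).
field; lra.
Qed.

(** By Abel's identity the Wronskian of two solutions is a constant times z (1
    - z). It is o(z) at 0, as both solutions vanish there, hence zero. The
    derivative of the quotient of first components is a multiple of it. *)
Lemma solutions_proportional f0 f2 df0 df2 g0 g2 dg0 dg2 :
  solves f0 f2 df0 df2 -> solves g0 g2 dg0 dg2 -> (forall z, 0 < z < 1 -> 0 < g0 z) ->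
  exists c, forall z, 0 < z < 1 -> f0 z = c * g0 z /\ f2 z = c * g2 z.
Proof.
intros SF SG P.
assert (XF := fun z => solves_explicit f0 f2 df0 df2 z SF).
assert (XG := fun z => solves_explicit g0 g2 dg0 dg2 z SG).
destruct SF as [[F0 F2] [DF _]]; destruct SG as [[G0 G2] [DG _]].
set (W := fun z => f0 z * g2 z - f2 z * g0 z).
assert (DQ : forall z, 0 < z < 1 -> is_derive (fun z => (f0 z * g2 z - f2 z * g0 z) / (z * (1 - z))) z 0).
{ intros z Hz; destruct (DF z ltac:(lra)) as [D1 D2]; destruct (DG z ltac:(lra)) as [D3 D4].
  auto_derive.
  - repeat split; try (eexists; eassumption); nra.
  - rewrite_derive; destruct (XF z Hz) as [-> ->], (XG z Hz) as [-> ->]; field; lra. }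
assert (W0 : forall z, 0 < z < 1 -> W z = 0).
{ intros z Hz.
  assert (Q : W z / (z * (1 - z)) = 0).
  { set (q := W z / (z * (1 - z))).
    destruct (Req_dec q 0) as [E|E]; [exact E|exfalso].
    assert (DW : is_derive W 0 0).
    { destruct (DF 0 ltac:(lra)) as [D1 D2]; destruct (DG 0 ltac:(lra)) as [D3 D4].
      unfold W; auto_derive; [repeat split; eexists; eassumption|].
      rewrite_derive; rewrite F0, F2, G0, G2; ring. }
    assert (Q0 := Rabs_pos_lt q E).
    destruct (real_der_eps W 0 DW (Rabs q / 4)) as [d [Hd B]]; [lra|].
    set (e := Rmin (d / 2) (Rmin (/ 2) z)).
    assert (Pe : 0 < e) by (unfold e; repeat apply Rmin_pos; lra).
    assert (e1 : e <= d / 2) by (unfold e; le_Rmin).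
    assert (e2 : e <= / 2) by (unfold e; le_Rmin).
    assert (e3 : e <= z) by (unfold e; le_Rmin).
    assert (Eq : W e / (e * (1 - e)) = q).
    { unfold q; apply (constant_of_derive (fun z => W z / (z * (1 - z)))); [exact e3|].
      intros t Ht; apply DQ; lra. }
    assert (Ab : Rabs e = e) by (apply Rabs_pos_eq; lra).
    specialize (B e ltac:(lra)); rewrite Ab in B.
    replace (W e - W 0 - e * 0) with (q * (e * (1 - e))) in B
      by (unfold W at 2; rewrite F0, F2, <- Eq; field; lra).
    rewrite Rabs_mult, (Rabs_pos_eq (e * (1 - e))) in B by nra.
    assert (0 < Rabs q * e * (3 / 4 - e)) by (repeat apply Rmult_lt_0_compat; lra).
    lra. }
  replace (W z) with (W z / (z * (1 - z)) * (z * (1 - z))) by (field; lra); rewrite Q; ring. }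
(* The derivative of f0 / g0 is proportional to W. *)
assert (DR : forall z, 0 < z < 1 -> is_derive (fun z => f0 z / g0 z) z 0).
{ intros z Hz; destruct (DF z ltac:(lra)) as [D1 _]; destruct (DG z ltac:(lra)) as [D3 _].
  specialize (P z Hz); specialize (W0 z Hz); unfold W in W0.
  auto_derive.
  - repeat split; try (eexists; eassumption); lra.
  - rewrite_derive.
    destruct (XF z Hz) as [_ ->], (XG z Hz) as [_ ->].
    transitivity (5 * (f0 z * g2 z - f2 z * g0 z) / (4 * (z - 1) * z * g0 z ^ 2)); [field; lra|].
    rewrite W0; field; lra. }
exists (f0 (/ 2) / g0 (/ 2)); intros z Hz.
assert (E : f0 z / g0 z = f0 (/ 2) / g0 (/ 2)).
{ destruct (Rle_dec z (/ 2)).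
  - apply (constant_of_derive (fun z => f0 z / g0 z)); [lra|]; intros; apply DR; lra.
  - symmetry; apply (constant_of_derive (fun z => f0 z / g0 z)); [lra|]; intros; apply DR; lra. }
specialize (P z Hz); specialize (W0 z Hz); unfold W in W0.
rewrite <- E; split; [field; lra|].
apply (Rmult_eq_reg_r (g0 z)); [|lra].
transitivity (f0 z * g2 z); [lra|field; lra].
Qed.

Lemma disp0_pos z : 0 < z < 1 -> 0 < disp0 z.
Proof.
intros Hz; unfold disp0; apply Rmult_lt_0_compat; [lra|].
apply RInt_gt_0; [lra| |].
- intros x Hx; apply Rmult_lt_0_compat.
  + unfold weight0; apply Rmult_lt_0_compat; [apply Rmult_lt_0_compat; [lra|apply pow_lt; lra]|].
    now apply cyc0_pos, level_pos.
  + apply Rinv_0_lt_compat, denom_pos; lra.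
- intros x Hx; apply stieltjes_integrand_cont; [apply weight0_cont|lra|lra].
Qed.

(** The dispersion relation: the integrals over the oval are Cauchy integrals
    of those over the vanishing cycle. Uniqueness at the centre takes the
    place of a contour argument, which would need the growth of the
    continuations at infinity. *)
Lemma Psi_proportional_disp : exists c, forall z, 0 < z < 1 -> Psi0 z = c * disp0 z /\ Psi2 z = c * disp2 z.
Proof. exact (solutions_proportional _ _ _ _ _ _ _ _ Psi_solves disp_solves disp0_pos). Qed.

(** * Divided differences of a Cauchy integral *)

Definition cut_plane (z : C) : Prop := ~ (Im z = 0 /\ 1 <= Re z).
Definition cdenom (a : C) (x : R) : C := (1 - a * RtoC (x ^ 8))%C.

Lemma cdenom_cont a x : ccont (cdenom a) x.
Proof.
apply ccont_minus; [apply ccont_const|]; apply ccont_mult; [apply ccont_const|].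
apply (ccont_RtoC (fun x => x ^ 8)).
smooth.
Qed.

Lemma cdenom_neq_0 a x : cut_plane a -> 0 <= x <= 1 -> cdenom a x <> 0%C.
Proof.
intros Ha Hx E; unfold cdenom in E; destruct a as [p q].
assert (E1 := f_equal fst E); assert (E2 := f_equal snd E); cbn [fst snd Cminus Cplus Copp Cmult RtoC] in E1, E2.
assert (L := pow8_le_1 x ltac:(lra)).
assert (Q : p * x ^ 8 = 1) by lra.
assert (Z : q * x ^ 8 = 0) by lra.
apply Ha; unfold Re, Im; simpl fst; simpl snd; split.
- apply Rmult_integral in Z; destruct Z as [Z|Z]; [exact Z|rewrite Z in Q; lra].
- destruct (Rle_dec 1 p); [assumption|exfalso].
  assert (0 <= (1 - p) * x ^ 8) by (apply Rmult_le_pos; lra).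
  assert (E3 : x ^ 8 = 1) by lra; rewrite E3 in Q; lra.
Qed.

(** Compactness of [0, 1] gives a bound at [a], and a perturbation of size m /
    2 costs at most half of it. *)
Lemma cdenom_lower a : cut_plane a -> exists m, 0 < m /\ forall z x, 0 <= x <= 1 -> Cmod (z - a) < m ->
  m <= Cmod (cdenom z x).
Proof.
intros Ha.
destruct (continuity_ab_min (fun x => Cmod (cdenom a x)) 0 1 Rle_0_1) as [x0 [H0 B0]].
{ intros x Hx; apply continuity_pt_filterlim.
  apply (continuous_ext (fun x => norm (cdenom a x : C_R_NormedModule))); [intros; apply norm_C_R|].
  apply (continuous_comp (cdenom a) (fun z : C_R_NormedModule => norm z)); [apply cdenom_cont|].
  apply (filterlim_norm (V := C_R_NormedModule)). }
set (m := Cmod (cdenom a x0)) in *.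
assert (M0 : 0 < m) by (apply Cmod_gt_0, cdenom_neq_0; assumption).
exists (m / 2); split; [lra|]; intros z x Hx Hz.
assert (H1 := H0 x Hx).
replace (cdenom a x) with (cdenom z x + (z - a) * RtoC (x ^ 8))%C in H1 by (unfold cdenom; ring).
assert (T := Cmod_triangle (cdenom z x) ((z - a) * RtoC (x ^ 8))).
rewrite Cmod_mult, Cmod_R in T.
assert (L := pow8_le_1 x ltac:(lra)); rewrite (Rabs_pos_eq (x ^ 8)) in T by lra.
pose proof (Cmod_ge_0 (z - a)); nra.
Qed.

(** A point p >= 1 of the cut is where [cdenom] vanishes at x^8 = 1 / p, which
    [cdenom_lower] excludes near [a]. *)
Lemma cut_plane_open a : cut_plane a -> exists m, 0 < m /\ forall z, Cmod (z - a) < m -> cut_plane z.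
Proof.
intros Ha; destruct (cdenom_lower a Ha) as [m [M0 H]]; exists m; split; [exact M0|].
intros z Hz [E1 E2]; destruct z as [p q]; unfold Re, Im in *; simpl in E1, E2; subst q.
destruct (eighth_root (/ p)) as (x & X1 & X8).
{ split; [apply Rinv_0_lt_compat; lra|rewrite <- Rinv_1; apply Rinv_le_contravar; lra]. }
specialize (H (p, 0) x X1 Hz).
replace (cdenom (p, 0) x) with (RtoC 0) in H; [rewrite Cmod_0 in H; lra|].
unfold cdenom; rewrite X8; apply injective_projections; simpl; field; lra.
Qed.

Definition cstieltjes (g : R -> C) (z : C) : C := CInt (fun x => (g x * / cdenom z x)%C) 0 1.
Definition cont_on_unit (g : R -> C) : Prop := forall x, 0 <= x <= 1 -> ccont g x.

Lemma div_cdenom_cont g a : cont_on_unit g -> cut_plane a -> cont_on_unit (fun x => g x * / cdenom a x)%C.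
Proof.
intros Hg Ha x Hx; apply ccont_mult; [now apply Hg|].
apply ccont_inv; [apply cdenom_cont|now apply cdenom_neq_0].
Qed.

Lemma ex_CInt_cont_on_unit g : cont_on_unit g -> ex_CInt g 0 1.
Proof. intros Hg; apply ex_CInt_cont; [lra|exact Hg]. Qed.

Lemma pow8_cont_on_unit : cont_on_unit (fun x => RtoC (x ^ 8)).
Proof.
intros x _; apply (ccont_RtoC (fun x => x ^ 8)).
smooth.
Qed.

Lemma cont_on_unit_mult g h : cont_on_unit g -> cont_on_unit h -> cont_on_unit (fun x => g x * h x)%C.
Proof. intros Hg Hh x Hx; apply ccont_mult; [now apply Hg|now apply Hh]. Qed.

(** The divided difference of 1 / (1 - z tau) at z and a is tau / ((1 - z tau)
    (1 - a tau)). *)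
Lemma cstieltjes_difference g a z : cont_on_unit g -> cut_plane a -> cut_plane z ->
  (cstieltjes g z - cstieltjes g a = (z - a) * cstieltjes (fun x => g x * RtoC (x ^ 8) * / cdenom a x) z)%C.
Proof.
intros Hg Ha Hz; unfold cstieltjes.
rewrite <- CInt_minus by (apply ex_CInt_cont_on_unit; now apply div_cdenom_cont).
rewrite <- (CInt_mult (z - a) (fun x => (g x * RtoC (x ^ 8) * / cdenom a x * / cdenom z x)%C)).
- apply CInt_ext; [lra|]; intros x Hx.
  assert (N1 := cdenom_neq_0 a x Ha Hx); assert (N2 := cdenom_neq_0 z x Hz Hx).
  unfold cdenom in *; field; split; assumption.
- apply ex_CInt_cont_on_unit, div_cdenom_cont; [|exact Hz].
  apply (div_cdenom_cont (fun x => (g x * RtoC (x ^ 8))%C)); [|exact Ha].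
  apply cont_on_unit_mult; [exact Hg|apply pow8_cont_on_unit].
Qed.

Lemma cont_on_unit_bounded g : cont_on_unit g -> exists M, 0 <= M /\ forall x, 0 <= x <= 1 -> Cmod (g x) <= M.
Proof.
intros Hg; destruct (bounded_continuity (V := C_R_NormedModule) g 0 1 Hg) as [M HM].
exists M; split.
- eapply Rle_trans; [apply Cmod_ge_0|]; rewrite <- (norm_C_R (g 0)); left; apply HM; lra.
- intros x Hx; rewrite <- norm_C_R; left; now apply HM.
Qed.

Lemma cstieltjes_cont g a : cont_on_unit g -> cut_plane a -> ccont (cstieltjes g) a.
Proof.
intros Hg Ha; destruct (cdenom_lower a Ha) as [m [M0 H]]; destruct (cut_plane_open a Ha) as [m' [M0' H']].
set (h := fun x => (g x * RtoC (x ^ 8) * / cdenom a x)%C).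
assert (Hh : cont_on_unit h).
{ apply (div_cdenom_cont (fun x => (g x * RtoC (x ^ 8))%C)); [|exact Ha].
  apply cont_on_unit_mult; [exact Hg|apply pow8_cont_on_unit]. }
destruct (cont_on_unit_bounded h Hh) as [M [MM HM]].
apply ccont_eps; intros eps He.
set (K := M * / m).
assert (K0 : 0 <= K) by (apply Rmult_le_pos; [exact MM|left; now apply Rinv_0_lt_compat]).
exists (Rmin (Rmin m m') (eps / (K + 1))); split.
{ repeat apply Rmin_pos; try assumption; apply Rdiv_lt_0_compat; lra. }
intros z Hz.
assert (L1 : Cmod (z - a) < m) by (eapply Rlt_le_trans; [exact Hz|le_Rmin]).
assert (L2 : Cmod (z - a) < m') by (eapply Rlt_le_trans; [exact Hz|le_Rmin]).
assert (L3 : Cmod (z - a) < eps / (K + 1)) by (eapply Rlt_le_trans; [exact Hz|apply Rmin_r]).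
rewrite cstieltjes_difference, Cmod_mult by (auto).
assert (B : Cmod (cstieltjes h z) <= K).
{ unfold cstieltjes; replace K with ((1 - 0) * K) by ring.
  apply (CInt_bound (fun x => (h x * / cdenom z x)%C)); [lra| |].
  - apply ex_CInt_cont_on_unit, div_cdenom_cont; auto.
  - intros x Hx; rewrite Cmod_mult, Cmod_inv by (apply cdenom_neq_0; auto).
    unfold K; apply Rmult_le_compat; [apply Cmod_ge_0|left; apply Rinv_0_lt_compat, Cmod_gt_0, cdenom_neq_0; auto|now apply HM|].
    apply Rinv_le_contravar; [exact M0|now apply H]. }
fold h; apply Rle_lt_trans with (Cmod (z - a) * K); [apply Rmult_le_compat_l; [apply Cmod_ge_0|exact B]|].
assert (Cmod (z - a) * (K + 1) < eps).
{ apply Rlt_le_trans with (eps / (K + 1) * (K + 1)); [apply Rmult_lt_compat_r; lra|right; field; lra]. }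
pose proof (Cmod_ge_0 (z - a)); lra.
Qed.

Definition prod_cdenom (L : list C) (x : R) : C := fold_right (fun a w => (cdenom a x * w)%C) (RtoC 1) L.

Lemma prod_cdenom_neq_0 L x : List.Forall cut_plane L -> 0 <= x <= 1 -> prod_cdenom L x <> 0%C.
Proof.
intros HL Hx; induction HL as [|a L Ha HL IH]; simpl; [apply C1_nz|].
apply Cmult_neq_0; [now apply cdenom_neq_0|exact IH].
Qed.

Lemma prod_cdenom_perm L L' x : Permutation L L' -> prod_cdenom L x = prod_cdenom L' x.
Proof.
induction 1; simpl; [reflexivity|now rewrite IHPermutation|ring|congruence].
Qed.

Lemma prod_cdenom_cont L x : ccont (prod_cdenom L) x.
Proof.
induction L as [|a L IH]; simpl; [apply ccont_const|].
apply (ccont_mult (cdenom a) (prod_cdenom L)); [apply cdenom_cont|exact IH].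
Qed.

Section DividedDifferences.

Variables (N : R -> R) (b0 b1 : R).
Hypothesis HN : forall x, continuous N x.

(** The density of the divided difference, at the nodes L, of E(z) = b0 + b1 z
    + z times the Cauchy integral of N. The first node uses up the factor z
    in front of the integral, so a list of k > 0 nodes gives the power k -
    1 of tau. *)
Definition divdiff_weight (L : list C) (x : R) : C :=
  match L with
  | nil => RtoC (N x)
  | _ => (RtoC (N x) * RtoC (x ^ 8) ^ pred (length L) * / prod_cdenom L x)%C
  end.

(** The divided difference of E at the nodes L and z, written so that
    coinciding nodes are allowed. The polynomial part b0 + b1 z becomes b1
    with one node and 0 with two. *)
Definition divdiff (L : list C) (z : C) : C :=
  match L with
  | nil => (RtoC b0 + RtoC b1 * z + z * cstieltjes (divdiff_weight nil) z)%C
  | a :: nil => (RtoC b1 + cstieltjes (divdiff_weight L) z)%C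
  | _ => cstieltjes (divdiff_weight L) z
  end.

Lemma divdiff_weight_cont L : List.Forall cut_plane L -> cont_on_unit (divdiff_weight L).
Proof.
intros HL x Hx; destruct L as [|a L]; [apply ccont_RtoC, HN|].
assert (NZ := prod_cdenom_neq_0 (a :: L) x HL Hx).
unfold divdiff_weight; apply ccont_mult; [apply ccont_mult; [apply ccont_RtoC, HN|apply ccont_pow; now apply pow8_cont_on_unit]|].
apply ccont_inv; [apply prod_cdenom_cont|exact NZ].
Qed.

Lemma divdiff_cont L z : List.Forall cut_plane L -> cut_plane z -> ccont (divdiff L) z.
Proof.
intros HL Hz; assert (HW := divdiff_weight_cont L HL).
destruct L as [|a [|b L]]; unfold divdiff.
- apply ccont_plus; [apply ccont_plus; [apply ccont_const|apply ccont_mult; [apply ccont_const|apply continuous_id]]|].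
  apply ccont_mult; [apply continuous_id|now apply cstieltjes_cont].
- apply ccont_plus; [apply ccont_const|now apply cstieltjes_cont].
- now apply cstieltjes_cont.
Qed.

Lemma cstieltjes_ext g h z : (forall x, 0 <= x <= 1 -> g x = h x) -> cstieltjes g z = cstieltjes h z.
Proof.
intros E; unfold cstieltjes; apply (CInt_ext (fun x => g x * / cdenom z x)%C (fun x => h x * / cdenom z x)%C); [lra|].
intros x Hx; now rewrite E.
Qed.

Lemma divdiff_rec L a z : List.Forall cut_plane L -> cut_plane a -> cut_plane z ->
  (divdiff L z - divdiff L a = (z - a) * divdiff (a :: L) z)%C.
Proof.
intros HL Ha Hz; assert (HW := divdiff_weight_cont L HL).
destruct L as [|b L].
- unfold divdiff.
  assert (E : (z * cstieltjes (divdiff_weight nil) z - a * cstieltjes (divdiff_weight nil) a = (z - a) * cstieltjes (divdiff_weight (a :: nil)) z)%C).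
  { unfold cstieltjes; rewrite <- !CInt_mult by (apply ex_CInt_cont_on_unit, div_cdenom_cont; try apply divdiff_weight_cont; auto).
    rewrite <- CInt_minus.
    - apply CInt_ext; [lra|]; intros x Hx.
      assert (N1 := cdenom_neq_0 a x Ha Hx); assert (N2 := cdenom_neq_0 z x Hz Hx).
      unfold divdiff_weight; simpl; unfold cdenom in *; field; split; assumption.
    - apply ex_CInt_cont_on_unit, cont_on_unit_mult; [intros u _; apply ccont_const|now apply div_cdenom_cont].
    - apply ex_CInt_cont_on_unit, cont_on_unit_mult; [intros u _; apply ccont_const|now apply div_cdenom_cont]. }
  transitivity (RtoC b1 * (z - a) + (z * cstieltjes (divdiff_weight nil) z - a * cstieltjes (divdiff_weight nil) a))%C; [ring|].
  rewrite E; ring.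
- assert (E : (cstieltjes (divdiff_weight (b :: L)) z - cstieltjes (divdiff_weight (b :: L)) a = (z - a) * cstieltjes (divdiff_weight (a :: b :: L)) z)%C).
  { rewrite cstieltjes_difference by assumption; f_equal; apply cstieltjes_ext; intros x Hx.
    assert (N1 := cdenom_neq_0 a x Ha Hx); assert (N2 := prod_cdenom_neq_0 (b :: L) x HL Hx).
    unfold divdiff_weight; change (prod_cdenom (a :: b :: L) x) with (cdenom a x * prod_cdenom (b :: L) x)%C.
    simpl length; simpl pred; set (y := RtoC (x ^ 8)); simpl Cpow; field; split; assumption. }
  destruct L as [|c L]; unfold divdiff at 1 2 3.
  + rewrite <- E; ring.
  + exact E.
Qed.

Lemma divdiff_perm L L' z : Permutation L L' -> divdiff L z = divdiff L' z.
Proof.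
intros HP; assert (Hl := Permutation_length HP).
destruct L as [|a L], L' as [|a' L']; try discriminate; [reflexivity|].
assert (W : cstieltjes (divdiff_weight (a :: L)) z = cstieltjes (divdiff_weight (a' :: L')) z).
{ apply cstieltjes_ext; intros x Hx; unfold divdiff_weight; now rewrite (prod_cdenom_perm _ _ x HP), Hl. }
destruct L as [|b L], L' as [|b' L']; try discriminate; unfold divdiff; now rewrite W.
Qed.

(** [chain M l] says that the points of [l] are in turn zeros of E divided by
    the earlier ones, those of [M] included. A repeated point is a multiple
    zero. *)
Fixpoint chain (M l : list C) : Prop :=
  match l with nil => True | a :: l' => divdiff M a = 0%C /\ chain (a :: M) l' end.

(** The same condition for a list of nodes in which the most recent zero comes
    first. *)
Fixpoint nested_zeros (L : list C) : Prop :=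
  match L with nil => True | a :: L' => divdiff L' a = 0%C /\ nested_zeros L' end.

Lemma chain_perm l : forall M M', Permutation M M' -> chain M l -> chain M' l.
Proof.
induction l as [|a l IH]; intros M M' HP; simpl; [easy|]; intros [H1 H2]; split.
- now rewrite <- (divdiff_perm M M').
- apply (IH (a :: M)); [now constructor|exact H2].
Qed.

Fixpoint remove_one (b : C) (l : list C) : list C :=
  match l with nil => nil | a :: l' => if Ceq_dec a b then l' else a :: remove_one b l' end.

Lemma remove_one_length b l : (length l <= S (length (remove_one b l)))%nat.
Proof. induction l as [|a l IH]; simpl; [lia|]; destruct Ceq_dec; simpl; lia. Qed.

Lemma remove_one_length_le b l : (length (remove_one b l) <= length l)%nat.
Proof. induction l as [|a l IH]; simpl; [lia|]; destruct Ceq_dec; simpl; lia. Qed.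

Lemma remove_one_Forall (P : C -> Prop) b l : List.Forall P l -> List.Forall P (remove_one b l).
Proof. induction 1; simpl; [constructor|]; destruct Ceq_dec; [assumption|now constructor]. Qed.

Lemma divdiff_common_zero M a b : List.Forall cut_plane M -> cut_plane a -> cut_plane b -> a <> b ->
  divdiff M a = 0%C -> divdiff M b = 0%C -> divdiff (a :: M) b = 0%C.
Proof.
intros HM Ha Hb Nab E1 E2.
apply (Cmult_integral_contr (b - a)); [apply Cminus_neq; congruence|].
rewrite <- divdiff_rec by assumption; rewrite E1, E2; ring.
Qed.

(** The zeros may be divided out in another order. If [b] does not occur in [l]
    it is an additional zero and nothing is removed. *)
Lemma chain_remove_one b : cut_plane b -> forall l M, List.Forall cut_plane M -> List.Forall cut_plane l ->
  divdiff M b = 0%C -> chain M l -> chain (b :: M) (remove_one b l).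
Proof.
intros Hb l; induction l as [|x l IH]; intros M HM Hl Eb; simpl; [easy|]; intros [H1 H2].
inversion_clear Hl; destruct (Ceq_dec x b) as [->|Nx]; [exact H2|]; simpl; split.
- apply divdiff_common_zero; auto.
- apply (chain_perm _ (b :: x :: M)); [constructor|].
  apply IH; auto; apply divdiff_common_zero; auto.
Qed.

Definition real_positive (L : list C) : Prop := forall x, 0 <= x <= 1 -> exists r, 0 < r /\ prod_cdenom L x = RtoC r.

Lemma cdenom_conj a x : Cconj (cdenom a x) = cdenom (Cconj a) x.
Proof. unfold cdenom; destruct a; apply injective_projections; simpl; ring. Qed.

Lemma cut_plane_conj a : cut_plane a -> cut_plane (Cconj a).
Proof. destruct a as [p q]; unfold cut_plane, Re, Im; simpl; intros H [E1 E2]; apply H; split; lra. Qed.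

Lemma CInt_conj f : ex_CInt f 0 1 -> CInt (fun x => Cconj (f x)) 0 1 = Cconj (CInt f 0 1).
Proof.
intros H; assert (K := RInt_correct (V := C_R_CompleteNormedModule) _ _ _ H).
assert (K1 := is_RInt_fct_extend_fst (U := R_NormedModule) (V := R_NormedModule) _ _ _ _ K).
assert (K2 := is_RInt_fct_extend_snd (U := R_NormedModule) (V := R_NormedModule) _ _ _ _ K).
apply (is_RInt_unique (V := C_R_CompleteNormedModule)).
apply (is_RInt_fct_extend_pair (U := R_NormedModule) (V := R_NormedModule)); simpl.
- exact K1.
- apply (is_RInt_opp (V := R_NormedModule)); exact K2.
Qed.

Lemma cstieltjes_conj g z : cont_on_unit g -> cut_plane z -> (forall x, 0 <= x <= 1 -> Cconj (g x) = g x) ->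
  cstieltjes g (Cconj z) = Cconj (cstieltjes g z).
Proof.
intros Hg Hz E; unfold cstieltjes; rewrite <- CInt_conj by (apply ex_CInt_cont_on_unit; now apply div_cdenom_cont).
apply CInt_ext; [lra|]; intros x Hx.
rewrite Cmult_conj, Cinv_conj, E, cdenom_conj; [reflexivity|exact Hx|now apply cdenom_neq_0].
Qed.

Lemma Cconj_RtoC r : Cconj (RtoC r) = RtoC r.
Proof. apply injective_projections; simpl; ring. Qed.

Lemma divdiff_weight_real L x : List.Forall cut_plane L -> real_positive L -> 0 <= x <= 1 -> Cconj (divdiff_weight L x) = divdiff_weight L x.
Proof.
intros HL HP Hx; destruct L as [|a L]; [apply Cconj_RtoC|].
unfold divdiff_weight; destruct (HP x Hx) as [r [R0 ->]].
rewrite <- RtoC_pow, <- RtoC_inv by lra; rewrite <- !RtoC_mult; apply Cconj_RtoC.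
Qed.

Lemma divdiff_conj L z : List.Forall cut_plane L -> real_positive L -> cut_plane z -> divdiff L (Cconj z) = Cconj (divdiff L z).
Proof.
intros HL HP Hz.
assert (E := cstieltjes_conj (divdiff_weight L) z (divdiff_weight_cont L HL) Hz (fun x Hx => divdiff_weight_real L x HL HP Hx)).
destruct L as [|a [|b L]]; unfold divdiff; rewrite E, ?Cplus_conj, ?Cmult_conj, ?Cconj_RtoC; reflexivity.
Qed.

(** While the nodes already used have a real product the divided difference is
    real on the real axis, so a nonreal zero [a] comes with its conjugate:
    either it occurs later in the list, or it is a further zero. The two
    are moved to the nodes together, and their product |1 - a tau|^2 is
    positive. *)
Lemma symmetrize n : forall l M, (length l <= n)%nat -> List.Forall cut_plane M -> List.Forall cut_plane l ->
  real_positive M -> nested_zeros M -> chain M l ->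
  exists L, List.Forall cut_plane L /\ real_positive L /\ nested_zeros L /\ (length M + length l <= length L)%nat.
Proof.
induction n as [|n IH]; intros l M Hn HM Hl HP HZ HC.
{ destruct l; simpl in *; [|lia]; exists M; repeat split; auto; lia. }
destruct l as [|a l]; [exists M; simpl; repeat split; auto; lia|].
simpl in Hn, HC; destruct HC as [E1 HC]; inversion_clear Hl as [|? ? Ha Hl'].
destruct (Req_dec (Im a) 0) as [Im0|Im0].
- destruct (IH l (a :: M)) as (L & L1 & L2 & L3 & L4); auto; [lia| |simpl; auto|].
  + intros x Hx; destruct (HP x Hx) as [r [R0 Er]]; simpl; rewrite Er.
    destruct a as [p q]; unfold Im in Im0; simpl in Im0; subst q.
    assert (Hp : p < 1).
    { destruct (Rlt_dec p 1); [assumption|exfalso; apply Ha; unfold Re, Im; simpl; lra]. }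
    exists ((1 - p * x ^ 8) * r); split; [apply Rmult_lt_0_compat; [now apply denom_pos|exact R0]|].
    unfold cdenom; apply injective_projections; simpl; ring.
  + exists L; repeat split; auto; simpl in *; lia.
- assert (Nc : a <> Cconj a).
  { intros E; apply Im0; apply (f_equal snd) in E; destruct a as [p q]; unfold Im; simpl in *; lra. }
  assert (Hc := cut_plane_conj a Ha).
  assert (E2 : divdiff M (Cconj a) = 0%C) by (rewrite divdiff_conj, E1 by auto; apply Cconj_RtoC).
  assert (E3 : divdiff (a :: M) (Cconj a) = 0%C) by (apply divdiff_common_zero; auto).
  destruct (IH (remove_one (Cconj a) l) (Cconj a :: a :: M)) as (L & L1 & L2 & L3 & L4); auto.
  + pose proof (remove_one_length_le (Cconj a) l); lia.
  + now apply remove_one_Forall.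
  + intros x Hx; destruct (HP x Hx) as [r [R0 Er]]; simpl; rewrite Er.
    assert (Na := cdenom_neq_0 a x Ha Hx).
    exists (Cmod (cdenom a x) ^ 2 * r); split.
    * apply Rmult_lt_0_compat; [apply pow_lt; now apply Cmod_gt_0|exact R0].
    * rewrite RtoC_mult, Cmod2_conj, cdenom_conj; ring.
  + simpl; auto.
  + apply chain_remove_one; auto.
  + exists L; repeat split; auto; pose proof (remove_one_length (Cconj a) l); simpl in *; lia.
Qed.

(** The divided differences whose nodes are all points but the first, the first
    two, the first three vanish at the first, second, third point. Over the
    common denominator they are the integrals of N times tau^(k + 2),
    tau^(k + 1) (1 - a_1 tau) and tau^k (1 - a_1 tau) (1 - a_2 tau), which
    span the polynomials of degree at most two times tau^k. *)
Lemma moments L : List.Forall cut_plane L -> nested_zeros L -> (5 <= length L)%nat ->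
  exists k, forall j, (j <= 2)%nat ->
    CInt (fun x => RtoC (N x) * RtoC (x ^ 8) ^ (k + j) * / prod_cdenom L x)%C 0 1 = RtoC 0.
Proof.
intros HL HZ Hn.
destruct L as [|a1 [|a2 [|a3 [|a4 [|a5 L]]]]]; try (simpl in Hn; lia); clear Hn.
set (L3 := a4 :: a5 :: L) in *; set (k := S (length L)).
exists k.
set (V := (fun j => CInt (fun x => RtoC (N x) * RtoC (x ^ 8) ^ (k + j) * / prod_cdenom (a1 :: a2 :: a3 :: L3) x)%C 0 1) : nat -> C).
destruct HZ as (Z1 & Z2 & Z3 & _).
inversion_clear HL as [|? ? H1 HL1]; inversion_clear HL1 as [|? ? H2 HL2]; inversion_clear HL2 as [|? ? H3 HL3].
assert (NZ : forall x, 0 <= x <= 1 -> prod_cdenom L3 x <> 0%C /\ cdenom a1 x <> 0%C /\ cdenom a2 x <> 0%C /\ cdenom a3 x <> 0%C).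
{ intros x Hx; repeat split; first [now apply prod_cdenom_neq_0|now apply cdenom_neq_0]. }
assert (EX : forall j, ex_CInt (fun x => RtoC (N x) * RtoC (x ^ 8) ^ (k + j) * / prod_cdenom (a1 :: a2 :: a3 :: L3) x)%C 0 1).
{ intros j; apply ex_CInt_cont_on_unit; intros x Hx.
  apply ccont_mult; [apply ccont_mult; [apply ccont_RtoC, HN|apply ccont_pow; now apply pow8_cont_on_unit]|].
  apply ccont_inv; [apply prod_cdenom_cont|apply prod_cdenom_neq_0; auto]. }
assert (V2 : V 2%nat = RtoC 0).
{ rewrite <- Z1; unfold divdiff, L3, cstieltjes, V; apply CInt_ext; [lra|]; intros x Hx.
  destruct (NZ x Hx) as (N0 & N1 & N2 & N3).
  unfold divdiff_weight; change (prod_cdenom (a1 :: a2 :: a3 :: L3) x) with (cdenom a1 x * (cdenom a2 x * (cdenom a3 x * prod_cdenom L3 x)))%C.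
  change (prod_cdenom (a2 :: a3 :: a4 :: a5 :: L) x) with (cdenom a2 x * (cdenom a3 x * prod_cdenom L3 x))%C.
  change (pred (length (a2 :: a3 :: a4 :: a5 :: L))) with (2 + k)%nat; rewrite (Nat.add_comm k 2).
  field; auto. }
assert (V1 : V 1%nat = (a1 * V 2%nat)%C).
{ apply Cminus_eq_0.
  rewrite <- Z2; unfold divdiff, L3, cstieltjes, V; rewrite <- CInt_mult by apply EX.
  rewrite <- CInt_minus; [|apply EX|].
  - apply CInt_ext; [lra|]; intros x Hx.
    destruct (NZ x Hx) as (N0 & N1 & N2 & N3).
    unfold divdiff_weight; change (prod_cdenom (a1 :: a2 :: a3 :: L3) x) with (cdenom a1 x * (cdenom a2 x * (cdenom a3 x * prod_cdenom L3 x)))%C.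
    change (prod_cdenom (a3 :: a4 :: a5 :: L) x) with (cdenom a3 x * prod_cdenom L3 x)%C.
    change (pred (length (a3 :: a4 :: a5 :: L))) with (1 + k)%nat; rewrite (Nat.add_comm k 2), (Nat.add_comm k 1).
    simpl Nat.add; unfold cdenom in *; set (y := RtoC (x ^ 8)) in *; simpl Cpow; field; auto.
  - destruct (EX 2%nat) as [v Hv]; exists (a1 * v)%C; now apply is_CInt_mult. }
assert (V0 : V 0%nat = ((a1 + a2) * V 1%nat - a1 * a2 * V 2%nat)%C).
{ apply Cminus_eq_0.
  assert (X1 := EX 1%nat); assert (X2 := EX 2%nat).
  assert (Y1 : ex_CInt (fun x => (a1 + a2) * (RtoC (N x) * RtoC (x ^ 8) ^ (k + 1) * / prod_cdenom (a1 :: a2 :: a3 :: L3) x))%C 0 1).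
  { destruct X1 as [v Hv]; eexists; apply is_CInt_mult, Hv. }
  assert (Y2 : ex_CInt (fun x => (a1 * a2) * (RtoC (N x) * RtoC (x ^ 8) ^ (k + 2) * / prod_cdenom (a1 :: a2 :: a3 :: L3) x))%C 0 1).
  { destruct X2 as [v Hv]; eexists; apply is_CInt_mult, Hv. }
  rewrite <- Z3; unfold divdiff, L3, cstieltjes, V; rewrite <- !CInt_mult by apply EX.
  rewrite <- CInt_minus by assumption.
  rewrite <- CInt_minus; [|apply EX|apply (ex_RInt_minus (V := C_R_NormedModule)); assumption].
  apply CInt_ext; [lra|]; intros x Hx.
  destruct (NZ x Hx) as (N0 & N1 & N2 & N3).
  unfold divdiff_weight; change (prod_cdenom (a1 :: a2 :: a3 :: L3) x) with (cdenom a1 x * (cdenom a2 x * (cdenom a3 x * prod_cdenom L3 x)))%C.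
  change (prod_cdenom (a4 :: a5 :: L) x) with (prod_cdenom L3 x); change (pred (length (a4 :: a5 :: L))) with (0 + k)%nat; rewrite (Nat.add_comm k 2), (Nat.add_comm k 1), (Nat.add_comm k 0).
  simpl Nat.add; unfold cdenom in *; set (y := RtoC (x ^ 8)) in *; simpl Cpow; field; auto. }
intros j Hj; change (V j = RtoC 0).
destruct j as [|[|[|j]]]; [|now rewrite V1, V2, Cmult_0_r|exact V2|lia].
rewrite V0, V1, V2; ring.
Qed.

End DividedDifferences.

(** * Counting the zeros *)

Lemma ccont_limit_eq (f g : C -> C) a d : 0 < d -> ccont f a -> ccont g a ->
  (forall z, z <> a -> Cmod (z - a) < d -> f z = g z) -> f a = g a.
Proof.
intros Hd Hf Hg E.
apply Ceq_of_close; intros eps He.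
destruct (proj1 (ccont_eps f a) Hf (eps / 2) ltac:(lra)) as [d1 [D1 H1]].
destruct (proj1 (ccont_eps g a) Hg (eps / 2) ltac:(lra)) as [d2 [D2 H2]].
set (r := Rmin d (Rmin d1 d2) / 2).
assert (R0 : 0 < Rmin d (Rmin d1 d2)) by (repeat apply Rmin_pos; assumption).
assert (R1 : Rmin d (Rmin d1 d2) <= d) by apply Rmin_l.
assert (R2 : Rmin d (Rmin d1 d2) <= d1) by le_Rmin.
assert (R3 : Rmin d (Rmin d1 d2) <= d2) by le_Rmin.
set (z := (a + RtoC r)%C).
assert (Hz : Cmod (z - a) = r).
{ replace (z - a)%C with (RtoC r) by (unfold z; ring); rewrite Cmod_R; apply Rabs_pos_eq; unfold r; lra. }
assert (Nz : z <> a).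
{ intros K; rewrite K in Hz; replace (a - a)%C with (RtoC 0) in Hz by ring; rewrite Cmod_0 in Hz; unfold r in Hz; lra. }
assert (E1 := E z Nz ltac:(unfold r in Hz; lra)).
specialize (H1 z ltac:(unfold r in Hz; lra)); specialize (H2 z ltac:(unfold r in Hz; lra)).
replace (f a - g a)%C with ((g z - g a) - (f z - f a))%C by (rewrite E1; ring).
eapply Rle_trans; [apply Cmod_triangle|]; rewrite Cmod_opp; lra.
Qed.

Definition lin_prod (l : list C) (z g : C) : C := fold_right (fun a w => ((z - a) * w)%C) g l.

Lemma lin_prod_cont l (G : C -> C) z : ccont G z -> ccont (fun z => lin_prod l z (G z)) z.
Proof.
intros H; induction l as [|a l IH]; simpl; [exact H|].
apply ccont_mult; [apply ccont_minus; [apply continuous_id|apply ccont_const]|exact IH].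
Qed.

Lemma RInt_pos_at (f : R -> R) x0 : (forall x, 0 <= x <= 1 -> continuous f x) ->
  (forall x, 0 <= x <= 1 -> 0 <= f x) -> 0 < x0 < 1 -> 0 < f x0 -> 0 < RInt f 0 1.
Proof.
intros Hc H0 Hx Hp.
assert (L : locally (f x0) (fun y => 0 < y)) by now apply (open_gt 0).
destruct (Hc x0 ltac:(lra) _ L) as [d Hd].
set (u := Rmax (x0 / 2) (x0 - d / 2)); set (v := Rmin ((x0 + 1) / 2) (x0 + d / 2)).
pose proof (cond_pos d).
assert (U1 := Rmax_l (x0 / 2) (x0 - d / 2)); assert (U2 := Rmax_r (x0 / 2) (x0 - d / 2)).
assert (U3 : u < x0) by (apply Rmax_lub_lt; lra).
assert (V1 := Rmin_l ((x0 + 1) / 2) (x0 + d / 2)); assert (V2 := Rmin_r ((x0 + 1) / 2) (x0 + d / 2)).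
assert (V3 : x0 < v) by (apply Rmin_glb_lt; lra).
fold u in U1, U2; fold v in V1, V2.
assert (X : forall p q, 0 <= p <= q -> q <= 1 -> ex_RInt f p q).
{ intros p q Hpq Hq; apply ex_RInt_cont; [lra|]; intros; apply Hc; lra. }
assert (C1 : RInt f 0 1 = RInt f 0 u + RInt f u 1) by (symmetry; apply (RInt_Chasles (V := R_CompleteNormedModule)); apply X; lra).
assert (C2 : RInt f u 1 = RInt f u v + RInt f v 1) by (symmetry; apply (RInt_Chasles (V := R_CompleteNormedModule)); apply X; lra).
assert (P1 : 0 <= RInt f 0 u) by (apply RInt_ge_0; [lra|apply X; lra|intros; apply H0; lra]).
assert (P3 : 0 <= RInt f v 1) by (apply RInt_ge_0; [lra|apply X; lra|intros; apply H0; lra]).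
assert (P2 : 0 < RInt f u v).
{ apply RInt_gt_0; [lra| |intros; apply Hc; lra].
  intros x Hxx; apply Hd; change (Rabs (x - x0) < d); apply Rabs_def1; lra. }
lra.
Qed.

Section SecondMelnikovFunction.

Variables (alpha0 alpha1 rho c D beta0 beta1 : R).

(* The density, and the polynomial b0 + b1 z that accompanies it. Here D is
   the constant such that I_1 is D times 1 + 4 h, and c is the factor of the
   dispersion relation. *)
Let N (x : R) : R := c * (((alpha0 - alpha1) * x ^ 8 + alpha1) * weight0 x - rho * weight2 x).
Let b0 : R := c * (alpha0 - alpha1) * mass0 + (beta0 - beta1) * D + rho * c * mass0.
Let b1 : R := beta1 * D.
Let phi (t : R) : R := alpha0 + 4 * alpha1 * t - rho * cyc_ratio t.

Lemma N_cont x : continuous N x.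
Proof.
unfold N; apply cont_mult; [apply continuous_const|].
apply (cont_minus (fun x => ((alpha0 - alpha1) * x ^ 8 + alpha1) * weight0 x) (fun x => rho * weight2 x)).
- apply (cont_mult (fun x => (alpha0 - alpha1) * x ^ 8 + alpha1)); [|apply weight0_cont].
  smooth.
- apply (cont_mult (fun _ => rho)); [apply continuous_const|apply weight2_cont].
Qed.

(** The density in terms of the level t: the sign of N is that of c phi(t). *)
Lemma N_phi x : 0 < x < 1 -> N x = c * (8 * x ^ 15 * cyc0_at x * phi (level x)).
Proof.
intros Hx; assert (P := cyc0_pos _ (level_pos x Hx)).
unfold N, phi, cyc_ratio, weight0, weight2, cyc0_at, cyc2_at in *; unfold level at 4; field; split; lra.
Qed.

Lemma N_0 : N 0 = 0.
Proof. unfold N, weight0, weight2; rewrite !pow_i by lia; ring. Qed.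

Lemma N_1 : N 1 = 0.
Proof. unfold N, weight0, weight2, cyc0_at, cyc2_at; rewrite level_1, cyc0_at_0, cyc2_at_0; ring. Qed.

Lemma stieltjes_N z : z < 1 ->
  z * stieltjes N z = c * ((alpha0 - alpha1) * (stieltjes weight0 z - mass0) + alpha1 * z * stieltjes weight0 z - rho * z * stieltjes weight2 z).
Proof.
intros Hz.
set (f1 := fun x => weight0 x * / (1 - z * x ^ 8)); set (f3 := fun x => weight2 x * / (1 - z * x ^ 8)).
assert (C1 : forall x, 0 <= x <= 1 -> continuous f1 x) by (intros; apply stieltjes_integrand_cont; [apply weight0_cont|assumption..]).
assert (C3 : forall x, 0 <= x <= 1 -> continuous f3 x) by (intros; apply stieltjes_integrand_cont; [apply weight2_cont|assumption..]).
assert (X1 := ex_RInt_cont _ _ _ Rle_0_1 C1); assert (X3 := ex_RInt_cont _ _ _ Rle_0_1 C3).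
assert (X5 := ex_RInt_cont _ _ _ Rle_0_1 (fun x _ => weight0_cont x)).
assert (XN : ex_RInt (fun x => N x * / (1 - z * x ^ 8)) 0 1).
{ apply ex_RInt_cont; [lra|]; intros; apply stieltjes_integrand_cont; [apply N_cont|assumption..]. }
set (f4 := fun x => (c * (alpha0 - alpha1 + alpha1 * z)) * f1 x + - (c * rho * z) * f3 x).
assert (X4 : ex_RInt f4 0 1).
{ apply ex_RInt_cont; [lra|]; intros; apply (cont_lin2 _ _ f1 f3); auto. }
transitivity (1 * RInt f4 0 1 + - (c * (alpha0 - alpha1)) * RInt weight0 0 1).
- unfold stieltjes; transitivity (z * RInt (fun x => N x * / (1 - z * x ^ 8)) 0 1 + 0 * RInt (fun x => N x * / (1 - z * x ^ 8)) 0 1); [ring|].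
  rewrite <- !RInt_lin2 by assumption; apply RInt_ext_le; [lra|]; intros x Hx.
  assert (P := denom_pos z x Hz Hx); unfold f4, f1, f3, N; field; lra.
- unfold f4; rewrite RInt_lin2 by assumption; unfold stieltjes, mass0, f1, f3; ring.
Qed.

(** Multiplying a Cauchy integral by z replaces the density by density / tau up
    to a constant; this is where the coefficient (alpha0 - alpha1) x^8 +
    alpha1 of N and the terms with [mass0] in b0 come from. *)
Lemma second_melnikov_formula (U0z U2z z : R) : 0 < z < 1 -> U0z = c * disp0 z -> U2z = c * disp2 z ->
  (alpha0 + 4 * alpha1 * ((z - 1) / 4)) * U0z + (beta0 + 4 * ((z - 1) / 4) * beta1) * (z * D) + rho * U2z
  = z * (b0 + b1 * z + z * stieltjes N z).
Proof.
intros Hz -> ->; rewrite stieltjes_N by lra; unfold b0, b1, disp0, disp2; field.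
Qed.

Lemma divdiff_nil_real z : z < 1 -> divdiff N b0 b1 nil (RtoC z) = RtoC (b0 + b1 * z + z * stieltjes N z).
Proof.
intros Hz; unfold divdiff.
assert (E : cstieltjes (divdiff_weight N nil) (RtoC z) = RtoC (stieltjes N z)).
{ unfold cstieltjes, stieltjes; rewrite <- CInt_RtoC.
  - apply CInt_ext; [lra|]; intros x Hx; assert (P := denom_pos z x Hz Hx).
    unfold divdiff_weight, cdenom; rewrite RtoC_mult, RtoC_inv by lra; rewrite RtoC_minus, RtoC_mult; reflexivity.
  - apply ex_RInt_cont; [lra|]; intros; apply stieltjes_integrand_cont; [apply N_cont|assumption..]. }
rewrite E, !RtoC_plus, !RtoC_mult; reflexivity.
Qed.

(** Each factor z - a is cancelled away from a, and at a by continuity. *)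
Lemma chain_of_factorization l : forall (M : list C) (G : C -> C), List.Forall cut_plane M -> List.Forall cut_plane l ->
  (forall z, cut_plane z -> ccont G z) ->
  (forall z, cut_plane z -> divdiff N b0 b1 M z = lin_prod l z (G z)) -> chain N b0 b1 M l.
Proof.
induction l as [|a l IH]; intros M G HM Hl HG E; simpl; [easy|].
inversion_clear Hl as [|? ? Ha Hl'].
assert (E0 : divdiff N b0 b1 M a = 0%C) by (rewrite (E a Ha); simpl; ring).
split; [exact E0|].
apply (IH (a :: M) G); auto.
assert (Q : forall z, cut_plane z -> z <> a -> divdiff N b0 b1 (a :: M) z = lin_prod l z (G z)).
{ intros z Hz Nz.
  assert (K := divdiff_rec N b0 b1 N_cont M a z HM Ha Hz).
  rewrite E0, (E z Hz) in K.
  change (lin_prod (a :: l) z (G z)) with ((z - a) * lin_prod l z (G z))%C in K.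
  set (X := divdiff N b0 b1 (a :: M) z) in *.
  assert (NN := Cminus_neq z a Nz).
  replace (lin_prod l z (G z)) with (((z - a) * lin_prod l z (G z) - 0) / (z - a))%C by (field; exact NN).
  rewrite K; field; exact NN. }
intros z Hz; destruct (Ceq_dec z a) as [->|Nz]; [|now apply Q].
destruct (cut_plane_open a Ha) as [d [Hd Od]].
apply (ccont_limit_eq (divdiff N b0 b1 (a :: M)) (fun z => lin_prod l z (G z)) a d Hd).
- apply divdiff_cont; auto; apply N_cont.
- now apply lin_prod_cont, HG.
- intros z' N' Hz'; apply Q; [now apply Od|exact N'].
Qed.

(** The density with positive denominator is orthogonal to polynomials of
    degree two in tau, one of which has its sign. *)
Lemma no_five_zeros l : List.Forall cut_plane l -> chain N b0 b1 nil l -> (5 <= length l)%nat ->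
  (exists x, 0 <= x <= 1 /\ N x <> 0) -> False.
Proof.
intros Hl HC Hn [x1 [Hx1 N1]].
assert (Hx1' : 0 < x1 < 1).
{ destruct (Req_dec x1 0) as [E|E]; [subst; now rewrite N_0 in N1|].
  destruct (Req_dec x1 1) as [E'|E']; [subst; now rewrite N_1 in N1|]; lra. }
rewrite N_phi in N1 by exact Hx1'.
assert (Hc : c <> 0) by (intros E; apply N1; rewrite E; ring).
assert (Hphi : exists t, 0 < t /\ alpha0 + 4 * alpha1 * t - rho * cyc_ratio t <> 0).
{ exists (level x1); split; [now apply level_pos|]; intros E; apply N1; unfold phi; rewrite E; ring. }
destruct (density_sign alpha0 (4 * alpha1) rho Hphi) as (p0 & p1 & p2 & Sg & s & Hs & Ps).
destruct (symmetrize N b0 b1 N_cont (length l) l nil) as (L & L1 & L2 & L3 & L4); auto.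
{ intros x _; exists 1; split; [lra|reflexivity]. }
{ simpl; auto. }
destruct (moments N b0 b1 N_cont L L1 L3) as [k Mk]; [simpl in L4; lia|].
set (q := fun x => Re (prod_cdenom L x)).
assert (Q0 : forall x, 0 <= x <= 1 -> 0 < q x /\ prod_cdenom L x = RtoC (q x)).
{ intros x Hx; destruct (L2 x Hx) as [r [R0 E]]; unfold q; rewrite E; split; [exact R0|reflexivity]. }
set (g := fun j x => N x * (x ^ 8) ^ (k + j) * / q x).
assert (Gc : forall j x, 0 <= x <= 1 -> continuous (g j) x).
{ intros j x Hx; unfold g; apply cont_mult; [apply cont_mult; [apply N_cont|]|].
  - apply (cont_pow (fun x => x ^ 8)); smooth.
  - apply cont_inv; [apply (continuous_Re (prod_cdenom L)), prod_cdenom_cont|].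
    destruct (Q0 x Hx); lra. }
assert (Gx : forall j, ex_RInt (g j) 0 1) by (intros; apply ex_RInt_cont; [lra|apply Gc]).
assert (G0 : forall j, (j <= 2)%nat -> RInt (g j) 0 1 = 0).
{ intros j Hj; specialize (Mk j Hj).
  assert (E : RtoC (RInt (g j) 0 1) = RtoC 0).
  { rewrite <- CInt_RtoC by apply Gx; rewrite <- Mk; apply CInt_ext; [lra|]; intros x Hx.
    destruct (Q0 x Hx) as [Qp ->]; unfold g.
    rewrite !RtoC_mult, RtoC_inv, <- RtoC_pow by lra; reflexivity. }
  apply (f_equal fst) in E; exact E. }
(* Here 4 t = 1 / tau - 1, and tau^2 (p0 + p1 t + p2 t^2) is the polynomial
   p2 / 16 + (p1 / 4 - p2 / 8) tau + (p0 - p1 / 4 + p2 / 16) tau^2. *)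
set (G := fun x => c * (p2 / 16) * g 0%nat x + 1 * (c * (p1 / 4 - p2 / 8) * g 1%nat x
   + c * (p0 - p1 / 4 + p2 / 16) * g 2%nat x)).
assert (GI : RInt G 0 1 = 0).
{ unfold G; rewrite (RInt_lin2 (c * (p2 / 16)) 1 (g 0%nat)
    (fun x => c * (p1 / 4 - p2 / 8) * g 1%nat x + c * (p0 - p1 / 4 + p2 / 16) * g 2%nat x)).
  - rewrite RInt_lin2 by apply Gx; rewrite !G0 by lia; real_eq; ring.
  - apply Gx.
  - apply ex_RInt_cont; [lra|]; intros x Hx; apply (cont_lin2 _ _ (g 1%nat) (g 2%nat)); now apply Gc. }
(* G is a positive function times the product of P and phi at level x. *)
assert (GE : forall x, 0 < x < 1 -> G x =
   c ^ 2 * (8 * x ^ 31 * cyc0_at x * (x ^ 8) ^ k * / q x) * ((p0 + p1 * level x + p2 * level x ^ 2) * (alpha0 + 4 * alpha1 * level x - rho * cyc_ratio (level x)))).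
{ intros x Hx; destruct (Q0 x ltac:(lra)) as [Qp _].
  unfold G, g; rewrite N_phi by exact Hx; fold (phi (level x)); rewrite !pow_add.
  generalize (phi (level x)); intros ph; generalize ((x ^ 8) ^ k); intros y.
  unfold level; field; split; lra. }
assert (GP : forall x, 0 < x < 1 -> 0 < c ^ 2 * (8 * x ^ 31 * cyc0_at x * (x ^ 8) ^ k * / q x)).
{ intros x Hx; destruct (Q0 x ltac:(lra)) as [Qp _].
  assert (P := cyc0_pos _ (level_pos x Hx)); fold (cyc0_at x) in P.
  apply Rmult_lt_0_compat; [now apply pow2_gt_0|].
  apply Rmult_lt_0_compat; [|now apply Rinv_0_lt_compat].
  apply Rmult_lt_0_compat; [|apply pow_lt, pow_lt; lra].
  apply Rmult_lt_0_compat; [|exact P].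
  apply Rmult_lt_0_compat; [lra|apply pow_lt; lra]. }
assert (Ps' : 0 < / (1 + 4 * s) < 1).
{ split; [apply Rinv_0_lt_compat; lra|rewrite <- Rinv_1; apply Rinv_lt_contravar; lra]. }
(* The point at the level s, where the product is positive. *)
destruct (eighth_root (/ (1 + 4 * s)) ltac:(lra)) as (x0 & X1 & X8).
assert (X0 : 0 < x0 < 1).
{ destruct (Req_dec x0 0) as [E|E]; [rewrite E, pow_i in X8 by lia; lra|].
  destruct (Req_dec x0 1) as [E'|E']; [rewrite E', pow1 in X8|]; lra. }
assert (T0 : level x0 = s) by (unfold level; rewrite X8, Rinv_inv; field).
assert (Pos : 0 < RInt G 0 1); [|lra].
apply (RInt_pos_at G x0); [| |exact X0|].
- intros x Hx; unfold G; apply (cont_lin2 _ _ (g 0%nat)); [now apply Gc|].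
  apply (cont_lin2 _ _ (g 1%nat) (g 2%nat)); now apply Gc.
- intros x Hx; destruct (Req_dec x 0) as [->|E0]; [unfold G, g; rewrite N_0; lra|].
  destruct (Req_dec x 1) as [->|E1]; [unfold G, g; rewrite N_1; lra|].
  rewrite GE by lra; apply Rmult_le_pos; [left; apply GP; lra|apply Sg, level_pos; lra].
- rewrite GE by exact X0; apply Rmult_lt_0_compat; [now apply GP|rewrite T0; exact Ps].
Qed.

(** Without the integral E(z) = b0 + b1 z. *)
Lemma no_two_zeros_degenerate l : (forall x, 0 <= x <= 1 -> N x = 0) ->
  List.Forall cut_plane l -> chain N b0 b1 nil l -> (2 <= length l)%nat -> b0 = 0 /\ b1 = 0.
Proof.
intros HN Hl HC Hn; destruct l as [|a1 [|a2 l]]; try (simpl in Hn; lia).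
destruct HC as (Z1 & Z2 & _).
assert (CT0 : forall L z, cstieltjes (divdiff_weight N L) z = RtoC 0).
{ intros L z; unfold cstieltjes; rewrite (CInt_ext _ (fun _ => RtoC 0)); [rewrite CInt_const; ring|lra|].
  intros x Hx; destruct L; unfold divdiff_weight; rewrite HN by exact Hx; ring. }
unfold divdiff in Z1, Z2; rewrite CT0 in Z1, Z2.
assert (B1 : b1 = 0).
{ apply (f_equal fst) in Z2; simpl in Z2; lra. }
split; [|exact B1]; rewrite B1 in Z1.
apply (f_equal fst) in Z1; simpl in Z1; lra.
Qed.

End SecondMelnikovFunction.

Lemma cut_plane_slit z : cut_plane (1 + 4 * z)%C <-> slit_plane z.
Proof.
destruct z as [x y]; unfold cut_plane, slit_plane, Re, Im; simpl; split; intros H [E1 E2]; apply H; lra.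
Qed.

Lemma lin_prod_scal l z k g : lin_prod l z (k * g)%C = (k * lin_prod l z g)%C.
Proof.
unfold lin_prod; induction l as [|a l IH]; simpl; [reflexivity|]; rewrite IH; ring.
Qed.

Lemma lin_prod_rescale l z g :
  lin_prod l z g = lin_prod (map (fun a => 1 + 4 * a)%C l) (1 + 4 * z)%C (RtoC (/ 4) ^ length l * g)%C.
Proof.
assert (Q : (RtoC (/ 4) * 4 = 1)%C) by (rewrite <- RtoC_mult; f_equal; field).
rewrite lin_prod_scal; induction l as [|a l IH]; [simpl; ring|].
change (lin_prod (a :: l) z g) with ((z - a) * lin_prod l z g)%C; rewrite IH.
set (P := lin_prod (map (fun a => 1 + 4 * a)%C l) (1 + 4 * z)%C g).
change (lin_prod (map (fun a => 1 + 4 * a)%C (a :: l)) (1 + 4 * z)%C g)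
  with ((1 + 4 * z - (1 + 4 * a)) * P)%C.
change (RtoC (/ 4) ^ length (a :: l))%C with (RtoC (/ 4) * RtoC (/ 4) ^ length l)%C.
transitivity ((RtoC (/ 4) * 4) * (z - a) * (RtoC (/ 4) ^ length l * P))%C; [rewrite Q; ring|ring].
Qed.

Theorem lemma4 (s : R) (a b : nat -> nat -> R -> R) (M : nat -> R -> R)
  (alpha0 alpha1 beta0 beta1 rho : R) (F : C -> C)
  (Hs : s = 1 \/ s = -1)
  (Ha : analytic_coefs a) (Hb : analytic_coefs b)
  (HM : Melnikov_functions s (cubic a) (cubic b) M)
  (HM1 : forall h : R, -1/4 < h < 0 -> M 1%nat h = 0)
  (HM2 : forall h : R, -1/4 < h < 0 ->
     M 2%nat h = (alpha0 + 4 * alpha1 * h) * oint s 0 h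
                 + (beta0 + 4 * h * beta1) * oint s 1 h + rho * oint s 2 h)
  (HM2_neq0 : exists h : R, -1/4 < h < 0 /\ M 2%nat h <> 0)
  (HF : analytic_continuation slit_plane (M 2%nat) F) :
  at_most_zeros_besides_centre slit_plane F 4.
Proof.
destruct Psi_proportional_disp as [c Hc].
set (D := RInt (fun t => s / (2 * sqrt 2) * sin t ^ 2) 0 (2 * PI)).
set (N := fun x => c * (((alpha0 - alpha1) * x ^ 8 + alpha1) * weight0 x - rho * weight2 x)).
set (b0 := c * (alpha0 - alpha1) * mass0 + (beta0 - beta1) * D + rho * c * mass0).
set (b1 := beta1 * D).
assert (NC : forall x, continuous N x) by apply N_cont.
assert (Form : forall h, -1/4 < h < 0 ->
   M 2%nat h = (1 + 4 * h) * (b0 + b1 * (1 + 4 * h) + (1 + 4 * h) * stieltjes N (1 + 4 * h))).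
{ intros h Hh; rewrite HM2, oint_Psi0, oint_Psi2, oint_1 by assumption; fold D.
  destruct (Hc (1 + 4 * h) ltac:(lra)) as [E0 E2].
  rewrite <- (second_melnikov_formula alpha0 alpha1 rho c D beta0 beta1 (Psi0 (1 + 4 * h)) (Psi2 (1 + 4 * h)));
    [|lra|exact E0|exact E2].
  replace ((1 + 4 * h - 1) / 4) with h by field; reflexivity. }
destruct HF as [HolF HF].
assert (nilC : List.Forall cut_plane nil) by constructor.
(* Both sides are differentiable on the slit plane and agree on (-1/4, 0);
   the derivative of the right-hand side is a divided difference. *)
assert (EF : forall z, slit_plane z -> F z = ((1 + 4 * z) * divdiff N b0 b1 nil (1 + 4 * z))%C).
{ intros z Hz.
  apply Cminus_eq_0.
  apply (slit_identity (fun z => F z - (1 + 4 * z) * divdiff N b0 b1 nil (1 + 4 * z))%C); [| |exact Hz].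
  - intros w Hw; assert (Hw' := proj2 (cut_plane_slit w) Hw).
    assert (Aff : cder (fun w => 1 + 4 * w)%C w).
    { apply cder_plus; [apply cder_const|apply cder_mult; [apply cder_const|apply cder_id]]. }
    apply cder_minus; [apply cder_of_ex_derive, HolF, Hw|].
    apply cder_mult; [exact Aff|].
    apply (cder_comp (divdiff N b0 b1 nil)); [exact Aff|].
    destruct (cut_plane_open _ Hw') as [d [Hd Od]].
    apply (cder_loc _ (divdiff N b0 b1 ((1 + 4 * w)%C :: nil)) _ d Hd).
    + apply divdiff_cont; auto.
    + intros u Hu; rewrite <- divdiff_rec by auto; ring.
  - intros h Hh; rewrite HF, Form by exact Hh.
    replace (1 + 4 * RtoC h)%C with (RtoC (1 + 4 * h)) by (rewrite RtoC_plus, RtoC_mult; reflexivity).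
    unfold N, b0, b1; rewrite divdiff_nil_real by lra; rewrite <- RtoC_mult; ring. }
intros l [Hl [G [HolG HG]]].
destruct (Nat.le_gt_cases (length l) 4) as [Hlen|Hlen]; [exact Hlen|exfalso].
inversion_clear Hl as [|? ? _ Hl'].
set (l' := map (fun a => 1 + 4 * a)%C l).
(* In the variable u = 1 + 4 z each factor z - a becomes (u - u_a) / 4; one
   of the length l + 1 factors is the zero at the centre, which is u / 4. *)
set (G' := fun u => (RtoC (/ 4) ^ S (length l) * G ((u - 1) * RtoC (/ 4)))%C).
assert (Q4 : (RtoC (/ 4) * 4 = 1)%C) by (rewrite <- RtoC_mult; f_equal; field).
assert (inv4 : forall u, (1 + 4 * ((u - 1) * RtoC (/ 4)) = u)%C).
{ intros u; transitivity (1 + (RtoC (/ 4) * 4) * (u - 1))%C; [ring|rewrite Q4; ring]. }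
assert (slit_u : forall u, cut_plane u -> slit_plane ((u - 1) * RtoC (/ 4))%C).
{ intros u Hu; apply cut_plane_slit; now rewrite inv4. }
assert (CG' : forall u, cut_plane u -> ccont G' u).
{ intros u Hu; apply ccont_mult; [apply ccont_const|].
  apply (continuous_comp (fun u : C_UniformSpace => ((u - 1) * RtoC (/ 4))%C : C_UniformSpace) G).
  - apply ccont_mult; [apply ccont_minus; [apply continuous_id|apply ccont_const]|apply ccont_const].
  - apply cder_ccont, cder_of_ex_derive, HolG, slit_u, Hu. }
assert (Hl2 : List.Forall cut_plane l').
{ unfold l'; clear - Hl'; induction Hl'; simpl; constructor; [now apply cut_plane_slit|assumption]. }
assert (Fact : forall u, cut_plane u -> u <> 0%C -> divdiff N b0 b1 nil u = lin_prod l' u (G' u)).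
{ intros u Hu Nu; assert (Su := slit_u u Hu).
  set (v := ((u - 1) * RtoC (/ 4))%C) in *.
  assert (E : F v = ((v - RtoC (-1 / 4)) * lin_prod l v (G v))%C) by exact (HG v Su).
  rewrite (EF _ Su) in E; unfold v in E at 1 2; rewrite inv4 in E.
  rewrite lin_prod_rescale in E; unfold v in E at 2; rewrite inv4 in E; fold l' in E.
  apply (f_equal (fun w => / u * w)%C) in E.
  rewrite Cmult_assoc, Cinv_l, Cmult_1_l in E by exact Nu; rewrite E.
  unfold G'; simpl Cpow; rewrite <- Cmult_assoc, (lin_prod_scal l' u (RtoC (/ 4))).
  fold v; replace (v - RtoC (-1 / 4))%C with (u * RtoC (/ 4))%C.
  - field; exact Nu.
  - unfold v; replace (RtoC (-1 / 4)) with (- RtoC (/ 4))%C by (apply injective_projections; simpl; field); ring. }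
assert (C0 : cut_plane 0%C) by (unfold cut_plane, Re, Im; simpl; lra).
(* The factor u was cancelled for u <> 0 only. *)
assert (Fact' : forall u, cut_plane u -> divdiff N b0 b1 nil u = lin_prod l' u (G' u)).
{ intros u Hu; destruct (Ceq_dec u 0%C) as [->|Nu]; [|now apply Fact].
  destruct (cut_plane_open _ C0) as [d [Hd Od]].
  apply (ccont_limit_eq (divdiff N b0 b1 nil) (fun u => lin_prod l' u (G' u)) (RtoC 0) d Hd).
  - apply divdiff_cont; auto.
  - apply lin_prod_cont, CG', C0.
  - intros z Nz Hz; apply Fact; [now apply Od|exact Nz]. }
assert (CH : chain N b0 b1 nil l') by (apply (chain_of_factorization alpha0 alpha1 rho c D beta0 beta1 l' nil G'); auto).
assert (Hlen' : (5 <= length l')%nat) by (unfold l'; rewrite length_map; lia).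
destruct (classic (exists x, 0 <= x <= 1 /\ N x <> 0)) as [Ex|Nex].
- exact (no_five_zeros alpha0 alpha1 rho c D beta0 beta1 l' Hl2 CH Hlen' Ex).
- assert (N0 : forall x, 0 <= x <= 1 -> N x = 0).
  { intros x Hx; destruct (Req_dec (N x) 0); [assumption|exfalso; apply Nex; now exists x]. }
  destruct (no_two_zeros_degenerate alpha0 alpha1 rho c D beta0 beta1 l' N0 Hl2 CH ltac:(lia)) as [B0 B1].
  destruct HM2_neq0 as [h [Hh Nh]]; apply Nh; rewrite Form by exact Hh.
  assert (R0 : stieltjes N (1 + 4 * h) = 0).
  { unfold stieltjes; rewrite (RInt_ext_le _ (fun _ => 0)); [rewrite RInt_const; unfold scal; simpl; unfold mult; simpl; ring|lra|].
    intros x Hx; rewrite N0 by exact Hx; ring. }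
  fold b0 in B0; fold b1 in B1; rewrite R0, B0, B1; ring.
Qed.
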